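(* Assume that $\omega$ satisfies the Diophantine condition, that $a\in\mathcal E_\mu$ for some $\mu>0$ with $\mathcal N_\mu(a)\le M$, and that $\tau\mapsto a_\tau$ is of class $C^q$ for some $q\in\mathbb N$ with $\sup_{0\le p\le q}\|\partial_\tau^p a\|\le C_a^{(q)}M$ (precise formulations in the context). Let $c\in(0,1)$, $n\in\mathbb N$, let $\varepsilon_n$ be as given in the context, and for $0<\varepsilon\le\varepsilon_n$ let $(v^{[n]},w^{[n]})$ be the solution of the micro-macro problem $$\begin{cases}\partial_t v^{[n]}(t)=A^{[n]}v^{[n]}(t), & v^{[n]}(0)=(\Phi^{[n]}_0)^{-1}u_0,\\ \partial_t w^{[n]}(t)=a_{t/\varepsilon}w^{[n]}(t)-\delta^{[n]}_{t/\varepsilon}v^{[n]}(t), & w^{[n]}(0)=0.\end{cases}$$ Then the time derivatives of $(v^{[n]},w^{[n]})$ are uniformly bounded (with respect to $\varepsilon$) up to order $\min(n,q)+1$. Indeed, at fixed final time $T>0$, for all $t\in[0,T]$ and all $p\in\{0,\dots,\min(n,q)+1\}$, $$|\partial_t^pv^{[n]}(t)|=\mathcal O(1),\qquad|\partial_t^pw^{[n]}(t)|=\mathcal O(\varepsilon^{n+1-p}),$$ where the $\mathcal O$ constants are independent of $\varepsilon\in(0,\varepsilon_n]$ and of $t\in[0,T]$.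
   Context: $(X,|\cdot|)$ is a Banach space, $u_0\in X$, and $\mathrm{End}(X)$ is the space of (bounded) linear maps $X\to X$ with the induced norm, also denoted $|\cdot|$ (Fourier coefficients are taken in the complexification if $X$ is real). For $\varphi:\mathbb R_+\to\mathrm{End}(X)$, the time average is $\langle\varphi\rangle=\lim_{\tau\to\infty}\frac1\tau\int_0^\tau\varphi_\sigma\,d\sigma$, and $\|\varphi\|=\sup_{\tau\ge0}|\varphi_\tau|$. Fix $r\ge1$ and $\omega\in\mathbb R^r$; $\mathbb T=\mathbb R/(2\pi\mathbb Z)$; for $\alpha\in\mathbb Z^r$, $|\alpha|=|\alpha_1|+\dots+|\alpha_r|$. Diophantine condition: there exist $c_D>0$ and $\nu\ge r-1$ such that $|\alpha\cdot\omega|\ge c_D/|\alpha|^\nu$ for all $\alpha\in\mathbb Z^r\setminus\{0\}$ (if $r=1$, one takes $\nu=0$, $c_D=|\omega|$). For $\kappa\ge0$, $\mathcal T_\kappa$ is the set of $\varphi^\sharp\in C^0(\mathbb T^r,\mathrm{End}(X))$, with Fourier coefficients $\widehat\varphi^\sharp_\alpha$, such that $\|\varphi^\sharp\|_\kappa:=\sum_{\alpha\in\mathbb Z^r}e^{\kappa|\alpha|}|\widehat\varphi^\sharp_\alpha|<\infty$; $\mathcal E^\sharp_\kappa$ is the set of maps $\tau\mapsto\varphi^\sharp_{\omega\tau}$ with $\varphi^\sharp\in\mathcal T_\kappa$. $\mathcal E^\flat$ is the set of $\varphi^\flat\in C^0(\mathbb R_+,\mathrm{End}(X))$ with $\|\varphi^\flat\|_{L^\infty_{\exp}}:=\sup_{\tau\ge0}e^\tau|\varphi^\flat_\tau|<\infty$.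 Under the Diophantine condition, the sum $\mathcal E_\kappa=\mathcal E^\sharp_\kappa\oplus\mathcal E^\flat$ is direct and each $\varphi\in\mathcal E_\kappa$ splits uniquely as $\varphi_\tau=\varphi^\sharp_{\omega\tau}+\varphi^\flat_\tau$; set $\mathcal N_\kappa(\varphi)=\|\varphi^\sharp\|_\kappa+\|\varphi^\flat\|_{L^\infty_{\exp}}$. Assumptions on $a$: $\tau\mapsto a_\tau\in\mathrm{End}(X)$ belongs to $\mathcal E_\mu$ for some $\mu>0$, $M>0$ is a constant with $\|a\|\le\mathcal N_\mu(a)\le M$; moreover $a$ is of class $C^q$ on $\mathbb R_+$ and there is $C_a^{(q)}>0$ with $\sup_{0\le p\le q}\|\partial_\tau^pa\|\le C_a^{(q)}M$. For $\varphi$ with $\langle\varphi\rangle=\mathrm{id}$ set $\Lambda\{\varphi\}_\tau=a_\tau\varphi_\tau-\varphi_\tau\langle a\varphi\rangle$. For $\varepsilon>0$ define inductively $\Phi^{[0]}=\mathrm{id}$ and $$A^{[n]}=\langle a\Phi^{[n]}\rangle,\qquad \Phi^{[n+1]}_\tau=\mathrm{id}+\varepsilon\int_0^\tau\Lambda\{\Phi^{[n]}\}_\sigma d\sigma-\varepsilon\Big\langle\int_0^{\bullet}\Lambda\{\Phi^{[n]}\}_\sigma d\sigma\Big\rangle,$$ so that $\langle\Phi^{[n]}\rangle=\mathrm{id}$. The defect is $\delta^{[n]}_\tau=\frac1\varepsilon\partial_\tau\Phi^{[n]}_\tau-\big(a_\tau\Phi^{[n]}_\tau-\Phi^{[n]}_\tau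 A^{[n]}\big)=\Lambda\{\Phi^{[n-1]}\}_\tau-\Lambda\{\Phi^{[n]}\}_\tau$, with the convention $\Lambda\{\Phi^{[-1]}\}=0$. Threshold: $\varepsilon_n=\dfrac{c}{c_I(\mu/(n+1))\,N_c\,M}$ with $N_c=(2+c)(1+c)$ and $c_I(\kappa)=\max\{1,\frac1{c_D}(\frac{\nu}{\kappa e})^\nu\}$ if $\nu\ne0$, $c_I(\kappa)=\max\{1,\frac1{c_D}\}$ if $\nu=0$. For this choice and all $0<\varepsilon\le\varepsilon_n$ one has $\|\Phi^{[n]}-\mathrm{id}\|\le c\,\varepsilon/\varepsilon_n\le c$ (so $(\Phi^{[n]}_0)^{-1}$ exists), $|A^{[n]}|\le(1+c)M$ and $|\varepsilon\int_0^\tau\delta^{[n]}_\sigma d\sigma|\le(\varepsilon/\varepsilon_n)^{n+1}$ for all $\tau\ge0$. *)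

(* Defs.v *)
From Stdlib Require Import Reals Lra Lia ZArith List.
From Stdlib Require Import ClassicalEpsilon FunctionalExtensionality.
From Stdlib Require Import PropExtensionality ProofIrrelevance.
From Stdlib Require Fin.
From Coquelicot Require Import Coquelicot.

Local Open Scope R_scope.

Lemma norm_small_zero (K : AbsRing) (V : NormedModule K) (x : V) (C : R) :
  (forall e : R, 0 < e -> norm x <= e * C) -> x = zero.
Proof.
  intros H. apply norm_eq_zero.
  destruct (Req_dec (norm x) 0) as [E | E]; [exact E|exfalso].
  assert (P : 0 < norm x) by (pose proof (norm_ge_0 x); lra).
  assert (PC : 0 < Rabs C + 1) by (pose proof (Rabs_pos C); lra).
  assert (Pe : 0 < norm x / (2 * (Rabs C + 1)))
    by (apply Rdiv_lt_0_compat; lra).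
  specialize (H _ Pe).
  assert (B : norm x / (2 * (Rabs C + 1)) * C
              <= norm x / (2 * (Rabs C + 1)) * (Rabs C + 1)).
  { apply Rmult_le_compat_l; [lra|]. pose proof (Rle_abs C); lra. }
  replace (norm x / (2 * (Rabs C + 1)) * (Rabs C + 1)) with (norm x / 2) in B
    by (field; lra).
  lra.
Qed.

Lemma minus_plus_plus (G : AbelianGroup) (a b c d : G) :
  minus (plus a b) (plus c d) = plus (minus a c) (minus b d).
Proof.
  unfold minus. rewrite opp_plus, <- !plus_assoc. f_equal.
  rewrite !plus_assoc. f_equal. apply plus_comm.
Qed.

Lemma minus_zero_eq (G : AbelianGroup) (a b : G) : minus a b = zero -> a = b.
Proof.
  intros H. transitivity (plus (minus a b) b).
  - unfold minus. rewrite <- plus_assoc, plus_opp_l, plus_zero_r. reflexivity.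
  - rewrite H. apply plus_zero_l.
Qed.

Lemma norm_minus_sym (K : AbsRing) (V : NormedModule K) (x y : V) :
  norm (minus x y) = norm (minus y x).
Proof. rewrite <- norm_opp, opp_minus. reflexivity. Qed.

Lemma norm_scal_minus (K : AbsRing) (V : NormedModule K) (k : K) (x y : V) :
  norm (minus (scal k x) (scal k y)) <= abs k * norm (minus x y).
Proof.
  eapply Rle_trans; [right|apply norm_scal].
  exact (f_equal norm (eq_sym (scal_minus_distr_l (V := V) k x y))).
Qed.

Lemma is_linear_closed (K : AbsRing) (V : NormedModule K) (f : V -> V) :
  (forall e : R, 0 < e -> exists g : V -> V,
     is_linear g /\ forall x, norm (minus (f x) (g x)) <= e * norm x) ->
  is_linear f.
Proof.
  intros H. split.
  - intros x y. apply minus_zero_eq.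
    apply (norm_small_zero _ _ _ (norm (plus x y) + norm x + norm y)).
    intros e Pe. destruct (H e Pe) as [g [Lg Hg]].
    rewrite (minus_trans (g (plus x y))), (linear_plus _ Lg), minus_plus_plus.
    pose proof (Hg (plus x y)) as B. rewrite (linear_plus _ Lg) in B.
    pose proof (Hg x) as Bx. pose proof (Hg y) as By.
    rewrite norm_minus_sym in Bx. rewrite norm_minus_sym in By.
    eapply Rle_trans; [apply norm_triangle|].
    eapply Rle_trans;
      [apply Rplus_le_compat; [exact B|apply norm_triangle]|]. lra.
  - intros k x. apply minus_zero_eq.
    apply (norm_small_zero _ _ _ (norm (scal k x) + abs k * norm x)).
    intros e Pe. destruct (H e Pe) as [g [Lg Hg]].
    rewrite (minus_trans (g (scal k x))), (linear_scal _ Lg).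
    pose proof (Hg (scal k x)) as B. rewrite (linear_scal _ Lg) in B.
    pose proof (Hg x) as Bx. rewrite norm_minus_sym in Bx.
    eapply Rle_trans; [apply norm_triangle|].
    eapply Rle_trans; [apply Rplus_le_compat; [exact B|apply norm_scal_minus]|].
    pose proof (Rmult_le_compat_l _ _ _ (abs_ge_0 k) Bx). lra.
  - destruct (H 1 Rlt_0_1) as [g [Lg Hg]].
    destruct (linear_norm _ Lg) as [M [PM HM]].
    exists (1 + M). split; [lra|]. intros x.
    replace (f x) with (plus (minus (f x) (g x)) (g x))
      by (unfold minus; rewrite <- plus_assoc, plus_opp_l; apply plus_zero_r).
    eapply Rle_trans; [apply norm_triangle|].
    pose proof (Hg x). pose proof (HM x). lra.
Qed.

Section Restriction.
Context (X : CompleteNormedModule C_AbsRing).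

Definition restr_scal (k : R) (x : X) : X := scal (RtoC k : C_AbsRing) x.

Definition restr_ModuleSpace_mixin : ModuleSpace.mixin_of R_Ring X.
Proof.
  apply (ModuleSpace.Mixin R_Ring X restr_scal).
  - intros x y u. unfold restr_scal. rewrite scal_assoc. f_equal.
    symmetry. apply RtoC_mult.
  - intros u. exact (scal_one u).
  - intros x u v. exact (scal_distr_l (K := C_Ring) (V := X) (RtoC x) u v).
  - intros x y u. eapply eq_trans;
      [|exact (scal_distr_r (K := C_Ring) (V := X) (RtoC x) (RtoC y) u)].
    unfold restr_scal. f_equal. apply RtoC_plus.
Defined.

Definition restr_NormedModuleAux : NormedModuleAux R_AbsRing :=
  NormedModuleAux.Pack R_AbsRing X
    (NormedModuleAux.Class R_AbsRing X
      (ModuleSpace.Class R_Ring X (AbelianGroup.class X)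
        restr_ModuleSpace_mixin)
      (UniformSpace.class X)) X.

Definition restr_NormedModule_mixin :
  NormedModule.mixin_of R_AbsRing restr_NormedModuleAux.
Proof.
  apply (NormedModule.Mixin R_AbsRing restr_NormedModuleAux
           (@norm C_AbsRing X) (@norm_factor C_AbsRing X)).
  - exact norm_triangle.
  - intros l x. eapply Rle_trans; [apply (norm_scal (RtoC l : C_AbsRing) x)|].
    right. f_equal. exact (Cmod_R l).
  - exact norm_compat1.
  - exact norm_compat2.
  - exact norm_eq_zero.
Defined.

Definition restrict : CompleteNormedModule R_AbsRing :=
  CompleteNormedModule.Pack R_AbsRing X
    (CompleteNormedModule.Class R_AbsRing X
      (NormedModule.Class R_AbsRing X
        (NormedModuleAux.class R_AbsRing restr_NormedModuleAux)
        restr_NormedModule_mixin)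
      (CompleteSpace.mixin X (CompleteSpace.class X))) X.
End Restriction.

Lemma polar_form (z : C) :
  exists psi : R, fst z = Cmod z * cos psi /\ snd z = Cmod z * sin psi.
Proof.
  destruct z as [a b]. set (m := Cmod (a, b)).
  assert (Hm : m * m = a * a + b * b).
  { unfold m, Cmod; simpl. rewrite sqrt_sqrt; nra. }
  assert (Pm : 0 <= m) by apply Cmod_ge_0. simpl.
  destruct (Req_dec m 0) as [E|E].
  - exists 0. rewrite E in Hm |- *. split; nra.
  - assert (Ha : -1 <= a / m <= 1).
    { split.
      - apply Rmult_le_reg_r with m; [lra|]. field_simplify; [nra|lra].
      - apply Rmult_le_reg_r with m; [lra|]. field_simplify; [nra|lra]. }
    assert (Hs : sqrt (1 - (a / m)²) = Rabs (b / m)).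
    { rewrite <- sqrt_Rsqr_abs. f_equal. unfold Rsqr.
      apply Rmult_eq_reg_r with (m * m); [|nra]. field_simplify; [nra|lra|lra]. }
    destruct (Rle_dec 0 (b / m)) as [Hb|Hb].
    + exists (acos (a / m)). rewrite cos_acos, sin_acos, Hs, Rabs_pos_eq by lra.
      split; field; lra.
    + exists (- acos (a / m)). rewrite cos_neg, sin_neg, cos_acos, sin_acos, Hs
        by lra.
      rewrite Rabs_left by lra. split; field; lra.
Qed.

Lemma scal_one_zero (K : Ring) (V : ModuleSpace K) (x y : V) :
  plus (scal one x) (scal zero y) = x.
Proof. rewrite scal_one, scal_zero_l. apply plus_zero_r. Qed.

Section ModuleIdentities.
Context (V : ModuleSpace R_Ring).
Implicit Types (a b c d : R) (x y u v : V).

Lemma scal_opp_l' a x : scal (- a : R_Ring) x = opp (scal a x).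
Proof. exact (scal_opp_l (K := R_Ring) a x). Qed.

Lemma scal_comb a b c d x y u v :
  u = plus (scal a x) (scal b y) -> v = plus (scal c x) (scal d y) ->
  forall s t : R, plus (scal s u) (scal t v)
    = plus (scal (s * a + t * c) x) (scal (s * b + t * d) y).
Proof.
  intros -> -> s t.
  rewrite !scal_distr_l, !scal_assoc.
  change (s * a + t * c) with (plus (mult s a : R_Ring) (mult t c)).
  change (s * b + t * d) with (plus (mult s b : R_Ring) (mult t d)).
  rewrite !scal_distr_r, <- !plus_assoc. f_equal.
  rewrite !plus_assoc. f_equal. apply plus_comm.
Qed.

Lemma minus_scal a b x y :
  minus (scal a x) (scal b y) = plus (scal a x) (scal (- b : R_Ring) y).
Proof. unfold minus. now rewrite scal_opp_l'. Qed.
Lemma plus_swap (G : AbelianMonoid) (p q r s : G) :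
  plus (plus p q) (plus r s) = plus (plus p r) (plus q s).
Proof.
  rewrite <- !plus_assoc. f_equal. rewrite !plus_assoc. f_equal.
  apply plus_comm.
Qed.

Lemma scal_comb_plus_r a b x y u v :
  plus (scal a (plus x u)) (scal b (plus y v))
  = plus (plus (scal a x) (scal b y)) (plus (scal a u) (scal b v)).
Proof. rewrite !scal_distr_l. apply plus_swap. Qed.

Lemma scal_comb_plus_l a b c d x y :
  plus (scal (a + c) x) (scal (b + d) y)
  = plus (plus (scal a x) (scal b y)) (plus (scal c x) (scal d y)).
Proof.
  change (a + c) with (plus (a : R_Ring) c).
  change (b + d) with (plus (b : R_Ring) d).
  rewrite !scal_distr_r. apply plus_swap.
Qed.
End ModuleIdentities.

Section Complexification.
Context (X : CompleteNormedModule R_AbsRing).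

Definition cplx : Type := (X * X)%type. (* (x, y) is x + i y *)

Definition cplx_scal (z : C) (p : cplx) : cplx :=
  (minus (scal (fst z) (fst p)) (scal (snd z) (snd p)),
   plus (scal (fst z) (snd p)) (scal (snd z) (fst p))).

(* Taylor norm: |x + i y| = sup over theta of |Re (e^{-i theta} (x + i y))|.
   Among the usual norms on the complexification, it makes x |-> x + i 0
   isometric and keeps the operator norm of every complexified operator. *)
Definition taylor_norm (p : cplx) : R :=
  real (Lub_Rbar (fun s => exists theta : R,
    s = norm (plus (scal (cos theta) (fst p)) (scal (sin theta) (snd p))))).

Lemma norm_rotation_le (p : cplx) (theta : R) :
  norm (plus (scal (cos theta) (fst p)) (scal (sin theta) (snd p)))
    <= norm (fst p) + norm (snd p).
Proof.
  refine (Rle_trans _ _ _ (norm_triangle (K := R_AbsRing) (V := X) _ _) _).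
  apply Rplus_le_compat;
    refine (Rle_trans _ _ _ (norm_scal (K := R_AbsRing) (V := X) _ _) _).
  - pose proof (COS_bound theta) as [H1 H2].
    assert (abs (K := R_AbsRing) (cos theta) <= 1) by (apply Rabs_le; lra).
    pose proof (norm_ge_0 (fst p)). nra.
  - pose proof (SIN_bound theta) as [H1 H2].
    assert (abs (K := R_AbsRing) (sin theta) <= 1) by (apply Rabs_le; lra).
    pose proof (norm_ge_0 (snd p)). nra.
Qed.

Lemma taylor_norm_ub (p : cplx) (theta : R) :
  norm (plus (scal (cos theta) (fst p)) (scal (sin theta) (snd p)))
    <= taylor_norm p.
Proof.
  unfold taylor_norm.
  match goal with |- context [Lub_Rbar ?E] =>
    destruct (Lub_Rbar_correct E) as [U L]; destruct (Lub_Rbar E) as [l| |]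
  end; simpl.
  - apply (U _ (ex_intro _ theta eq_refl)).
  - exfalso. refine (L (Finite (norm (fst p) + norm (snd p))) _).
    intros s [t ->]. apply norm_rotation_le.
  - destruct (U _ (ex_intro _ theta eq_refl)).
Qed.

Lemma taylor_norm_lub (p : cplx) (M : R) :
  (forall theta : R,
    norm (plus (scal (cos theta) (fst p)) (scal (sin theta) (snd p))) <= M) ->
  taylor_norm p <= M.
Proof.
  intros H. unfold taylor_norm.
  match goal with |- context [Lub_Rbar ?E] =>
    destruct (Lub_Rbar_correct E) as [U L]; destruct (Lub_Rbar E) as [l| |]
  end; simpl.
  - apply (L (Finite M)). intros s [t ->]. apply H.
  - exfalso. refine (L (Finite M) _). intros s [t ->]. apply H.
  - destruct (U _ (ex_intro _ 0 eq_refl)).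
Qed.

Lemma taylor_norm_fst (p : cplx) : norm (fst p) <= taylor_norm p.
Proof.
  pose proof (taylor_norm_ub p 0) as H. rewrite cos_0, sin_0 in H.
  refine (Rle_trans _ _ _ (Req_le _ _ (f_equal norm (eq_sym _))) H).
  exact (scal_one_zero R_Ring X (fst p) (snd p)).
Qed.

Lemma taylor_norm_snd (p : cplx) : norm (snd p) <= taylor_norm p.
Proof.
  pose proof (taylor_norm_ub p (PI / 2)) as H. rewrite cos_PI2, sin_PI2 in H.
  refine (Rle_trans _ _ _ (Req_le _ _ (f_equal norm (eq_sym _))) H).
  refine (eq_trans (plus_comm _ _) _).
  exact (scal_one_zero R_Ring X (snd p) (fst p)).
Qed.

Lemma cplx_scalE (z : C) (p : cplx) : cplx_scal z p =
  (plus (scal (fst z) (fst p)) (scal (- snd z) (snd p)),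
   plus (scal (snd z) (fst p)) (scal (fst z) (snd p))).
Proof.
  unfold cplx_scal. f_equal.
  - exact (minus_scal X _ _ _ _).
  - apply plus_comm.
Qed.

Definition cplx_ModuleSpace_mixin :
  ModuleSpace.mixin_of C_Ring (prod_AbelianGroup X X).
Proof.
  apply (ModuleSpace.Mixin C_Ring (prod_AbelianGroup X X) cplx_scal).
  - intros z w p. rewrite !cplx_scalE. cbn [fst snd].
    f_equal; (eapply eq_trans;
      [refine (scal_comb X _ _ _ _ _ _ _ _ eq_refl eq_refl _ _)|]);
      f_equal; f_equal; unfold mult; simpl; ring.
  - intros [x y]. rewrite cplx_scalE. simpl fst; simpl snd. f_equal.
    + rewrite Ropp_0. exact (scal_one_zero R_Ring X x y).
    + refine (eq_trans (plus_comm _ _) _). exact (scal_one_zero R_Ring X y x).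
  - intros z [x y] [x' y']. rewrite !cplx_scalE. simpl fst; simpl snd.
    exact (f_equal2 pair (scal_comb_plus_r X _ _ _ _ _ _)
                         (scal_comb_plus_r X _ _ _ _ _ _)).
  - intros z w [x y]. rewrite !cplx_scalE.
    eapply eq_trans;
      [|exact (f_equal2 pair (scal_comb_plus_l X _ _ _ _ _ _)
                             (scal_comb_plus_l X _ _ _ _ _ _))].
    simpl. now rewrite Ropp_plus_distr.
Defined.

Definition cplx_NormedModuleAux : NormedModuleAux C_AbsRing :=
  NormedModuleAux.Pack C_AbsRing cplx
    (NormedModuleAux.Class C_AbsRing cplx
      (ModuleSpace.Class C_Ring cplx
        (AbelianGroup.class (prod_AbelianGroup X X)) cplx_ModuleSpace_mixin)
      (UniformSpace.class (prod_UniformSpace X X))) cplx.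

Definition cplx_NormedModule_mixin :
  NormedModule.mixin_of C_AbsRing cplx_NormedModuleAux.
Proof.
  apply (NormedModule.Mixin C_AbsRing cplx_NormedModuleAux taylor_norm
           (2 * @norm_factor R_AbsRing X)).
  - intros [x y] [x' y']. apply taylor_norm_lub. intros theta.
    refine (Rle_trans _ _ _ (Req_le _ _ (f_equal norm
      (scal_comb_plus_r X (cos theta) (sin theta) x y x' y'))) _).
    refine (Rle_trans _ _ _ (norm_triangle (K := R_AbsRing) (V := X) _ _) _).
    apply Rplus_le_compat.
    + exact (taylor_norm_ub (x, y) theta).
    + exact (taylor_norm_ub (x', y') theta).
  - intros z p. apply taylor_norm_lub. intros theta.
    destruct (polar_form z) as [psi [Hc Hs]].
    assert (E : plus (scal (cos theta) (fst (cplx_scal z p)))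
                     (scal (sin theta) (snd (cplx_scal z p)))
      = scal (Cmod z : R_Ring)
          (plus (scal (cos (theta - psi)) (fst p))
                (scal (sin (theta - psi)) (snd p)))).
    { rewrite cplx_scalE. cbn [fst snd].
      eapply eq_trans;
        [exact (scal_comb X _ _ _ _ _ _ _ _ eq_refl eq_refl _ _)|].
      symmetry. eapply eq_trans;
        [exact (scal_distr_l (K := R_Ring) (V := X) _ _ _)|].
      rewrite (scal_assoc (K := R_Ring) (V := X)).
      rewrite (scal_assoc (K := R_Ring) (V := X)).
      rewrite Hc, Hs, cos_minus, sin_minus.
      f_equal; f_equal; unfold mult; simpl; ring. }
    refine (Rle_trans _ _ _ (Req_le _ _ (f_equal norm E)) _).
    refine (Rle_trans _ _ _ (norm_scal (K := R_AbsRing) (V := X) _ _) _).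
    change (abs (K := R_AbsRing) (Cmod z)) with (Rabs (Cmod z)).
    rewrite Rabs_pos_eq by apply Cmod_ge_0.
    apply Rmult_le_compat_l; [apply Cmod_ge_0|apply taylor_norm_ub].
  - intros p q eps H.
    split; apply (norm_compat1 (K := R_AbsRing) (V := X)).
    + exact (Rle_lt_trans _ _ _ (taylor_norm_fst (minus q p)) H).
    + exact (Rle_lt_trans _ _ _ (taylor_norm_snd (minus q p)) H).
  - intros p q eps [H1 H2].
    apply (norm_compat2 (K := R_AbsRing) (V := X)) in H1.
    apply (norm_compat2 (K := R_AbsRing) (V := X)) in H2.
    eapply Rle_lt_trans.
    + apply taylor_norm_lub. intros theta. apply norm_rotation_le.
    + eapply Rlt_le_trans;
        [exact (Rplus_lt_compat _ _ _ _ H1 H2)|right; ring].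
  - intros [x y] H.
    pose proof (taylor_norm_fst (x, y)) as H1.
    pose proof (taylor_norm_snd (x, y)) as H2.
    rewrite H in H1, H2. cbn [fst snd] in H1, H2.
    apply (f_equal2 pair); apply (norm_eq_zero (K := R_AbsRing) (V := X));
      apply Rle_antisym;
      solve [assumption | apply norm_ge_0].
Defined.

Definition cplx_lim (F : (cplx -> Prop) -> Prop) : cplx :=
  (lim (fun P : X -> Prop => F (fun p => P (fst p))),
   lim (fun P : X -> Prop => F (fun p => P (snd p)))).

Definition cplx_CompleteSpace_mixin :
  CompleteSpace.mixin_of (prod_UniformSpace X X).
Proof.
  apply (CompleteSpace.Mixin (prod_UniformSpace X X) cplx_lim).
  - intros F PF CF eps.
    assert (H1 := complete_cauchy (fun P : X -> Prop => F (fun p => P (fst p)))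
      (filtermap_proper_filter _ _ (@fst X X) F PF)).
    assert (H2 := complete_cauchy (fun P : X -> Prop => F (fun p => P (snd p)))
      (filtermap_proper_filter _ _ (@snd X X) F PF)).
    apply (filter_imp (fun p : X * X =>
      ball (fst (cplx_lim F)) eps (fst p) /\
      ball (snd (cplx_lim F)) eps (snd p))); [intros p Hp; exact Hp|].
    apply filter_and; [apply H1|apply H2].
    + intros d. destruct (CF d) as [p Hp]. exists (fst p).
      apply filter_imp with (2 := Hp). intros q Hq. apply Hq.
    + intros d. destruct (CF d) as [p Hp]. exists (snd p).
      apply filter_imp with (2 := Hp). intros q Hq. apply Hq.
  - intros F1 F2 H12 H21 eps.
    split; refine (close_lim (T := X) _ _ _ _ eps); intros P HP;
      first [exact (H12 _ HP) | exact (H21 _ HP)].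
Defined.

Definition complexification : CompleteNormedModule C_AbsRing :=
  CompleteNormedModule.Pack C_AbsRing cplx
    (CompleteNormedModule.Class C_AbsRing cplx
      (NormedModule.Class C_AbsRing cplx
        (NormedModuleAux.class C_AbsRing cplx_NormedModuleAux)
        cplx_NormedModule_mixin)
      cplx_CompleteSpace_mixin) cplx.
End Complexification.

(* Scalars are R or C; analysis (integrals, derivatives in time) only uses the
   underlying real Banach space, while linearity of operators and Fourier
   coefficients depend on the scalar field. *)
Inductive Banach : Type :=
| RealBanach (X : CompleteNormedModule R_AbsRing)
| ComplexBanach (X : CompleteNormedModule C_AbsRing).

Definition carrier (X : Banach) : CompleteNormedModule R_AbsRing :=
  match X with
  | RealBanach X => X
  | ComplexBanach X => restrict X
  end.
Coercion carrier : Banach >-> CompleteNormedModule.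

Definition bounded_linear (X : Banach) : (X -> X) -> Prop :=
  match X with
  | RealBanach X => fun f => is_linear (U := X) (V := X) f
  | ComplexBanach X => fun f => is_linear (U := X) (V := X) f
  end.

Lemma bounded_linear_R (X : Banach) (f : X -> X) :
  bounded_linear X f -> is_linear f.
Proof.
  destruct X as [X|X]; [exact (fun H => H)|]. intros [Hp Hs Hn]. split.
  - exact Hp.
  - intros k x. exact (Hs (RtoC k) x).
  - exact Hn.
Qed.

Lemma bounded_linear_zero (X : Banach) : bounded_linear X (fun _ => zero).
Proof.
  destruct X as [X|X].
  - exact (is_linear_zero (U := X) (V := X)).
  - exact (is_linear_zero (U := X) (V := X)).
Qed.

Lemma bounded_linear_id (X : Banach) : bounded_linear X (fun x => x).
Proof.
  destruct X as [X|X].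
  - exact (is_linear_id (V := X)).
  - exact (is_linear_id (V := X)).
Qed.

Lemma bounded_linear_comp (X : Banach) (f g : X -> X) :
  bounded_linear X f -> bounded_linear X g ->
  bounded_linear X (fun x => f (g x)).
Proof.
  destruct X as [X|X]; intros Hf Hg.
  - exact (is_linear_comp (U := X) (V := X) (W := X) g f Hg Hf).
  - exact (is_linear_comp (U := X) (V := X) (W := X) g f Hg Hf).
Qed.

Lemma is_linear_plus_fun (K : AbsRing) (V : NormedModule K) (f g : V -> V) :
  is_linear f -> is_linear g -> is_linear (fun x => plus (f x) (g x)).
Proof.
  intros Hf Hg. split.
  - intros x y. rewrite (linear_plus _ Hf), (linear_plus _ Hg). apply plus_swap.
  - intros k x. rewrite (linear_scal _ Hf), (linear_scal _ Hg).
    exact (eq_sym (scal_distr_l k (f x) (g x))).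
  - destruct (linear_norm _ Hf) as [M [PM HM]].
    destruct (linear_norm _ Hg) as [N [PN HN]].
    exists (M + N). split; [lra|]. intros x.
    refine (Rle_trans _ _ _ (norm_triangle _ _) _).
    specialize (HM x). specialize (HN x). lra.
Qed.

Lemma bounded_linear_plus (X : Banach) (f g : X -> X) :
  bounded_linear X f -> bounded_linear X g ->
  bounded_linear X (fun x => plus (f x) (g x)).
Proof.
  destruct X as [X|X]; intros Hf Hg.
  - exact (is_linear_plus_fun _ X f g Hf Hg).
  - exact (is_linear_plus_fun _ X f g Hf Hg).
Qed.

Lemma bounded_linear_opp (X : Banach) (f : X -> X) :
  bounded_linear X f -> bounded_linear X (fun x => opp (f x)).
Proof.
  destruct X as [X|X]; intros Hf.
  - exact (is_linear_comp (U := X) (V := X) (W := X) f _ Hf is_linear_opp).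
  - exact (is_linear_comp (U := X) (V := X) (W := X) f _ Hf is_linear_opp).
Qed.

Lemma bounded_linear_scal (X : Banach) (k : R) (f : X -> X) :
  bounded_linear X f -> bounded_linear X (fun x => scal (k : R_AbsRing) (f x)).
Proof.
  destruct X as [X|X]; intros Hf.
  - exact (is_linear_comp (U := X) (V := X) (W := X) f _ Hf
             (is_linear_scal_r (V := X) (k : R_AbsRing) Rmult_comm)).
  - exact (is_linear_comp (U := X) (V := X) (W := X) f _ Hf
             (is_linear_scal_r (V := X) (RtoC k : C_AbsRing) Cmult_comm)).
Qed.

Lemma bounded_linear_closed (X : Banach) (f : X -> X) :
  (forall e : R, 0 < e -> exists g : X -> X,
     bounded_linear X g /\ forall x, norm (minus (f x) (g x)) <= e * norm x) ->
  bounded_linear X f.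
Proof.
  destruct X as [X|X]; intros H.
  - exact (is_linear_closed _ X f H).
  - exact (is_linear_closed _ X f H).
Qed.

Record End (X : Banach) : Type := mkEnd {
  End_fun :> X -> X;
  End_linear : bounded_linear X End_fun }.
Arguments mkEnd {X} _ _.
Arguments End_fun {X} _ _.
Arguments End_linear {X} _.

Definition op_norm {X : Banach} (A : End X) : R :=
  real (Lub_Rbar (fun s => exists x : X, norm x <= 1 /\ s = norm (A x))).

Definition End_id {X : Banach} : End X := mkEnd _ (bounded_linear_id X).
Definition End_comp {X : Banach} (A B : End X) : End X :=
  mkEnd _ (bounded_linear_comp X A B (End_linear A) (End_linear B)).

Section EndBanach.
Context (X : Banach).
Implicit Types A B : End X.

Lemma End_ext A B : (forall x, A x = B x) -> A = B.
Proof.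
  destruct A as [f Hf], B as [g Hg]; simpl. intros H.
  assert (E : f = g) by (apply functional_extensionality; exact H).
  subst g. f_equal. apply proof_irrelevance.
Qed.

Lemma op_norm_bound A (x : X) : norm x <= 1 -> norm (A x) <= op_norm A.
Proof.
  intros Hx. destruct (linear_norm _ (bounded_linear_R X A (End_linear A)))
    as [M [PM HM]].
  unfold op_norm.
  match goal with |- context [Lub_Rbar ?E] =>
    destruct (Lub_Rbar_correct E) as [U L]; destruct (Lub_Rbar E) as [l| |]
  end; simpl.
  - apply (U _ (ex_intro _ x (conj Hx eq_refl))).
  - exfalso. refine (L (Finite M) _). intros s [y [Hy ->]].
    simpl. specialize (HM y). nra.
  - destruct (U _ (ex_intro _ x (conj Hx eq_refl))).
Qed.

Lemma op_norm_ge_0 A : 0 <= op_norm A.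
Proof.
  refine (Rle_trans _ _ _ (norm_ge_0 (A zero)) (op_norm_bound A zero _)).
  exact (Rle_trans _ _ _ (Req_le _ _ norm_zero) Rle_0_1).
Qed.

Lemma op_norm_apply A (x : X) : norm (A x) <= op_norm A * norm x.
Proof.
  pose proof (norm_ge_0 x) as P. pose proof (op_norm_ge_0 A) as PA.
  pose proof (bounded_linear_R X A (End_linear A)) as LA.
  destruct (linear_norm _ LA) as [M [PM HM]].
  destruct (Req_dec (norm x) 0) as [E|E].
  - specialize (HM x). rewrite E in HM |- *. lra.
  - assert (H := op_norm_bound A (scal (/ norm x : R_AbsRing) x)).
    rewrite (linear_scal _ LA) in H.
    assert (B : norm (scal (/ norm x : R_AbsRing) x) <= 1).
    { refine (Rle_trans _ _ _ (norm_scal _ _) _). right.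
      change (Rabs (/ norm x) * norm x = 1).
      rewrite Rabs_pos_eq; [field; exact E|].
      left; apply Rinv_0_lt_compat; lra. }
    specialize (H B).
    assert (A' : norm (A x)
                 <= norm x * norm (scal (/ norm x : R_AbsRing) (A x))).
    { assert (E2 : A x = scal (norm x : R_AbsRing)
                           (scal (/ norm x : R_AbsRing) (A x))).
      { rewrite scal_assoc.
        replace (mult (norm x : R_AbsRing) (/ norm x)) with (one : R_AbsRing)
          by (change (1 = norm x * / norm x); field; exact E).
        symmetry; exact (scal_one (A x)). }
      rewrite E2 at 1. refine (Rle_trans _ _ _ (norm_scal _ _) _).
      right. f_equal. exact (Rabs_pos_eq _ P). }
    refine (Rle_trans _ _ _ A' _). rewrite (Rmult_comm (op_norm A)).
    apply Rmult_le_compat_l; [exact P|exact H].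
Qed.

Lemma op_norm_le A (M : R) :
  0 <= M -> (forall x, norm (A x) <= M * norm x) -> op_norm A <= M.
Proof.
  intros PM H. unfold op_norm.
  match goal with |- context [Lub_Rbar ?E] =>
    destruct (Lub_Rbar_correct E) as [U L]; destruct (Lub_Rbar E) as [l| |]
  end; simpl.
  - apply (L (Finite M)). intros s [y [Hy ->]]. simpl. specialize (H y). nra.
  - lra.
  - lra.
Qed.

Definition End_zero : End X := mkEnd _ (bounded_linear_zero X).
Definition End_plus A B : End X :=
  mkEnd _ (bounded_linear_plus X A B (End_linear A) (End_linear B)).
Definition End_opp A : End X :=
  mkEnd _ (bounded_linear_opp X A (End_linear A)).
Definition End_scal (k : R) A : End X :=
  mkEnd _ (bounded_linear_scal X k A (End_linear A)).

Definition End_AbelianMonoid_mixin : AbelianMonoid.mixin_of (End X).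
Proof.
  apply (AbelianMonoid.Mixin (End X) End_plus End_zero);
    intros; apply End_ext; intros; simpl.
  - apply plus_comm.
  - apply plus_assoc.
  - apply plus_zero_r.
Defined.

Definition End_AbelianMonoid : AbelianMonoid :=
  AbelianMonoid.Pack (End X) End_AbelianMonoid_mixin (End X).

Definition End_AbelianGroup_mixin : AbelianGroup.mixin_of End_AbelianMonoid.
Proof.
  apply (AbelianGroup.Mixin End_AbelianMonoid End_opp).
  intros A. apply End_ext. intros x. exact (plus_opp_r (A x)).
Defined.

Definition End_AbelianGroup : AbelianGroup :=
  AbelianGroup.Pack (End X)
    (AbelianGroup.Class _ End_AbelianMonoid_mixin End_AbelianGroup_mixin)
    (End X).

Definition End_ModuleSpace_mixin :
  ModuleSpace.mixin_of R_Ring End_AbelianGroup.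
Proof.
  apply (ModuleSpace.Mixin R_Ring End_AbelianGroup End_scal);
    intros; apply End_ext; intros z.
  - exact (scal_assoc (V := X) _ _ _).
  - exact (scal_one (V := X) _).
  - exact (scal_distr_l (V := X) _ _ _).
  - exact (scal_distr_r (V := X) _ _ _).
Defined.

Lemma op_norm_triangle A B : op_norm (End_plus A B) <= op_norm A + op_norm B.
Proof.
  pose proof (op_norm_ge_0 A). pose proof (op_norm_ge_0 B).
  apply op_norm_le; [lra|]. intros x.
  refine (Rle_trans _ _ _ (norm_triangle (A x) (B x)) _).
  pose proof (op_norm_apply A x). pose proof (op_norm_apply B x). lra.
Qed.

Lemma op_norm_scal (k : R) A : op_norm (End_scal k A) <= Rabs k * op_norm A.
Proof.
  pose proof (op_norm_ge_0 A). pose proof (Rabs_pos k).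
  apply op_norm_le; [nra|]. intros x.
  refine (Rle_trans _ _ _ (norm_scal (K := R_AbsRing) k (A x)) _).
  change (abs (K := R_AbsRing) k) with (Rabs k). rewrite Rmult_assoc.
  apply Rmult_le_compat_l; [assumption|apply op_norm_apply].
Qed.

Lemma op_norm_eq_0 A : op_norm A = 0 -> A = End_zero.
Proof.
  intros H. apply End_ext. intros x.
  apply (norm_eq_zero (K := R_AbsRing) (V := X)). apply Rle_antisym.
  - refine (Rle_trans _ _ _ (op_norm_apply A x) _). rewrite H. lra.
  - apply norm_ge_0.
Qed.

Definition End_minus A B : End X := End_plus A (End_opp B).

Lemma op_norm_minus_sym A B :
  op_norm (End_minus A B) = op_norm (End_minus B A).
Proof.
  unfold op_norm. f_equal. f_equal. apply functional_extensionality.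
  intros s. apply propositional_extensionality.
  split; intros [x [Hx ->]]; exists x; (split; [exact Hx|]);
    exact (norm_minus_sym _ _ _ _).
Qed.

Definition End_UniformSpace_mixin : UniformSpace.mixin_of (End X).
Proof.
  apply (UniformSpace.Mixin (End X) End_zero
           (fun A e B => op_norm (End_minus B A) < e)).
  - intros A e. refine (Rle_lt_trans _ _ _ _ (cond_pos e)).
    apply op_norm_le; [lra|]. intros x. rewrite Rmult_0_l. right.
    refine (eq_trans (f_equal norm (plus_opp_r (A x))) norm_zero).
  - intros A B e H. now rewrite op_norm_minus_sym.
  - intros A B C e1 e2 H1 H2.
    assert (E : End_minus C A = End_plus (End_minus C B) (End_minus B A))
      by (apply End_ext; intros x; exact (minus_trans (B x) (C x) (A x))).
    rewrite E. pose proof (op_norm_triangle (End_minus C B) (End_minus B A)).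
    lra.
Defined.

Definition End_NormedModuleAux : NormedModuleAux R_AbsRing :=
  NormedModuleAux.Pack R_AbsRing (End X)
    (NormedModuleAux.Class R_AbsRing (End X)
      (ModuleSpace.Class R_Ring (End X) (AbelianGroup.class End_AbelianGroup)
        End_ModuleSpace_mixin)
      End_UniformSpace_mixin) (End X).

Definition End_NormedModule_mixin :
  NormedModule.mixin_of R_AbsRing End_NormedModuleAux.
Proof.
  apply (NormedModule.Mixin R_AbsRing End_NormedModuleAux (@op_norm X) 1).
  - exact op_norm_triangle.
  - exact op_norm_scal.
  - intros A B e H. exact H.
  - intros A B e H. rewrite Rmult_1_l. exact H.
  - exact op_norm_eq_0.
Defined.

Definition End_UniformSpace : UniformSpace :=
  UniformSpace.Pack (End X) End_UniformSpace_mixin (End X).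

Lemma End_complete (F : (End X -> Prop) -> Prop) :
  ProperFilter F -> cauchy (T := End_UniformSpace) F ->
  exists L : End X, forall e : posreal,
    F (fun B => op_norm (End_minus B L) < e).
Proof.
  intros PF CF.
  set (Fx := fun (x : X) (P : X -> Prop) => F (fun A => P (A x))).
  assert (PFx : forall x, ProperFilter (Fx x))
    by (intros x; exact (filtermap_proper_filter _ _ (fun A : End X => A x) F PF)).
  assert (bnd : forall (A : End X) (M : R), op_norm A < M ->
                forall x, norm (A x) <= M * norm x).
  { intros A M HM x. refine (Rle_trans _ _ _ (op_norm_apply A x) _).
    apply Rmult_le_compat_r; [apply norm_ge_0|lra]. }
  assert (CFx : forall x, cauchy (Fx x)).
  { intros x e.
    assert (P : 0 < norm x + 1) by (pose proof (norm_ge_0 x); lra).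
    assert (Pe : 0 < e / (norm x + 1))
      by (apply Rdiv_lt_0_compat; [apply cond_pos|exact P]).
    destruct (CF (mkposreal _ Pe)) as [A HA]. exists (A x).
    unfold Fx. apply filter_imp with (2 := HA). intros B HB.
    apply (norm_compat1 (K := R_AbsRing) (V := X)).
    refine (Rle_lt_trans _ _ _ (bnd _ _ HB x) _). simpl.
    apply Rlt_le_trans with (e / (norm x + 1) * (norm x + 1)).
    - apply Rmult_lt_compat_l; lra.
    - right. field. lra. }
  set (f := fun x : X => lim (Fx x)).
  assert (Hf : forall x (e : posreal), F (fun A => ball (f x) e (A x)))
    by (intros x e; exact (complete_cauchy (Fx x) (PFx x) (CFx x) e)).
  assert (key : forall e : posreal, exists A : End X,
    F (fun B => op_norm (End_minus B A) < e) /\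
    forall x, norm (minus (f x) (A x)) <= e * norm x).
  { intros e. destruct (CF e) as [A HA]. exists A. split; [exact HA|].
    intros x. apply le_epsilon. intros d Pd.
    pose proof (@norm_factor_gt_0 R_AbsRing X) as Pn.
    assert (Pd' : 0 < d / @norm_factor R_AbsRing X)
      by (apply Rdiv_lt_0_compat; assumption).
    destruct (filter_ex _ (filter_and _ _ HA (Hf x (mkposreal _ Pd'))))
      as [B [HB1 HB2]].
    apply (norm_compat2 (K := R_AbsRing) (V := X)) in HB2. simpl in HB2.
    pose proof (bnd _ _ HB1 x) as HB3.
    rewrite (minus_trans (B x)).
    refine (Rle_trans _ _ _ (norm_triangle _ _) _).
    rewrite (norm_minus_sym _ _ (f x)), Rplus_comm.
    apply Rplus_le_compat; [exact HB3|].
    left. refine (Rlt_le_trans _ _ _ HB2 _). right. field. lra. }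
  assert (Lf : bounded_linear X f).
  { apply bounded_linear_closed. intros e Pe.
    destruct (key (mkposreal e Pe)) as [A [_ HA]].
    exists A. split; [exact (End_linear A)|exact HA]. }
  exists (mkEnd f Lf). intros e.
  assert (Pe : 0 < e / 2) by (pose proof (cond_pos e); lra).
  destruct (key (mkposreal _ Pe)) as [A [HA1 HA2]].
  apply filter_imp with (2 := HA1). intros B HB.
  set (L := mkEnd f Lf).
  assert (E : End_minus B L = End_plus (End_minus B A) (End_minus A L))
    by (apply End_ext; intros x; exact (minus_trans (A x) (B x) (f x))).
  rewrite E. simpl in HB.
  assert (H : op_norm (End_minus A L) <= e / 2).
  { rewrite op_norm_minus_sym. apply op_norm_le; [lra|exact HA2]. }
  pose proof (op_norm_triangle (End_minus B A) (End_minus A L)). lra.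
Qed.

Definition End_lim (F : (End X -> Prop) -> Prop) : End X :=
  epsilon (inhabits End_zero)
    (fun L => forall e : posreal, F (fun B => op_norm (End_minus B L) < e)).

Definition End_CompleteSpace_mixin : CompleteSpace.mixin_of End_UniformSpace.
Proof.
  apply (CompleteSpace.Mixin End_UniformSpace End_lim).
  - intros F PF CF. unfold End_lim.
    exact (epsilon_spec (inhabits End_zero) _ (End_complete F PF CF)).
  - intros F1 F2 H12 H21.
    assert (E : F1 = F2).
    { apply functional_extensionality. intros P.
      apply propositional_extensionality. split; [apply H21|apply H12]. }
    rewrite E. intros e. apply ball_center.
Defined.

Definition End_NormedModule_class : NormedModule.class_of R_AbsRing (End X) :=
  NormedModule.Class R_AbsRing (End X)
    (NormedModuleAux.class R_AbsRing End_NormedModuleAux)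
    End_NormedModule_mixin.
End EndBanach.

Canonical End_AbelianMonoid.
Canonical End_AbelianGroup.
Canonical End_UniformSpace.
Canonical End_NormedModuleAux.
Canonical End_ModuleSpace (X : Banach) : ModuleSpace R_Ring :=
  ModuleSpace.Pack R_Ring (End X)
    (ModuleSpace.Class R_Ring (End X) (AbelianGroup.class (End_AbelianGroup X))
      (End_ModuleSpace_mixin X)) (End X).
Canonical End_NormedModule (X : Banach) : NormedModule R_AbsRing :=
  NormedModule.Pack R_AbsRing (End X) (End_NormedModule_class X) (End X).
Canonical End_CompleteSpace (X : Banach) : CompleteSpace :=
  CompleteSpace.Pack (End X)
    (CompleteSpace.Class (End X) (End_UniformSpace_mixin X)
      (End_CompleteSpace_mixin X)) (End X).
Canonical End_CompleteNormedModule (X : Banach) :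
    CompleteNormedModule R_AbsRing :=
  CompleteNormedModule.Pack R_AbsRing (End X)
    (CompleteNormedModule.Class R_AbsRing (End X) (End_NormedModule_class X)
      (End_CompleteSpace_mixin X)) (End X).

Section EndComplexification.
Context (X : CompleteNormedModule R_AbsRing) (A : End (RealBanach X)).

Definition cplx_fun (p : complexification X) : complexification X :=
  (A (fst p), A (snd p)).

Lemma cplx_fun_linear :
  bounded_linear (ComplexBanach (complexification X)) cplx_fun.
Proof.
  pose proof (End_linear A) as L. simpl in L. split.
  - intros p q. exact (f_equal2 pair (linear_plus _ L (fst p) (fst q))
                         (linear_plus _ L (snd p) (snd q))).
  - intros z p. unfold cplx_fun.
    assert (C : forall (s t : R) (x y : X),
      A (plus (scal s x) (scal t y)) = plus (scal s (A x)) (scal t (A y))).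
    { intros s t x y. refine (eq_trans (linear_plus _ L _ _) _).
      exact (f_equal2 plus (linear_scal _ L s x) (linear_scal _ L t y)). }
    change (scal z p) with (cplx_scal X z p).
    refine (eq_trans _ (eq_sym (cplx_scalE X z (A (fst p), A (snd p))))).
    rewrite cplx_scalE. exact (f_equal2 pair (C _ _ _ _) (C _ _ _ _)).
  - destruct (linear_norm _ L) as [M [PM HM]]. exists M. split; [exact PM|].
    intros p. apply taylor_norm_lub. intros theta.
    refine (Rle_trans _ _ _ (Req_le _ _ (f_equal norm (eq_sym _)))
      (Rle_trans _ _ _ (HM (plus (scal (cos theta) (fst p))
                                 (scal (sin theta) (snd p)))) _)).
    + refine (eq_trans (linear_plus _ L _ _) _).
      exact (f_equal2 plus (linear_scal _ L _ _) (linear_scal _ L _ _)).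
    + apply Rmult_le_compat_l; [lra|apply taylor_norm_ub].
Qed.
End EndComplexification.

Definition cplx_space (X : Banach) : CompleteNormedModule C_AbsRing :=
  match X with
  | RealBanach X => complexification X
  | ComplexBanach X => X
  end.

Definition End_cplx (X : Banach) : End X -> End (ComplexBanach (cplx_space X)) :=
  match X with
  | RealBanach X => fun A => mkEnd (X := ComplexBanach (complexification X))
                               (cplx_fun X A) (cplx_fun_linear X A)
  | ComplexBanach X => fun A => A
  end.
Arguments End_cplx {X} _.

Lemma bounded_linear_Cscal (Z : CompleteNormedModule C_AbsRing) (z : C)
    (A : End (ComplexBanach Z)) :
  bounded_linear (ComplexBanach Z) (fun x => scal (z : C_AbsRing) (A x : Z)).
Proof.
  exact (is_linear_comp (U := Z) (V := Z) (W := Z) A _ (End_linear A)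
           (is_linear_scal_r (V := Z) (z : C_AbsRing) Cmult_comm)).
Qed.

Definition End_Cscal {Z : CompleteNormedModule C_AbsRing} (z : C)
    (A : End (ComplexBanach Z)) : End (ComplexBanach Z) :=
  mkEnd _ (bounded_linear_Cscal Z z A).

(* Points of R^r and Z^r are functions on [Fin.t r]; a function on the torus
   is a function on R^r that is 2 pi-periodic in each coordinate. *)
Fixpoint fin_sum {r : nat} : (Fin.t r -> R) -> R :=
  match r with
  | O => fun _ => 0
  | S r => fun x => x Fin.F1 + fin_sum (fun i => x (Fin.FS i))
  end.

Definition fin_cons {r : nat} (s : R) (theta : Fin.t r -> R) (i : Fin.t (S r)) :
    R :=
  Fin.caseS' i (fun _ => R) s theta.

Definition Zdot {r : nat} (alpha : Fin.t r -> Z) (theta : Fin.t r -> R) : R :=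
  fin_sum (fun i => IZR (alpha i) * theta i).

Definition Zlength1 {r : nat} (alpha : Fin.t r -> Z) : R :=
  fin_sum (fun i => IZR (Z.abs (alpha i))).

Definition torus_periodic {r : nat} {E : Type} (phi : (Fin.t r -> R) -> E) :
    Prop :=
  forall (theta : Fin.t r -> R) (alpha : Fin.t r -> Z),
    phi (fun i => theta i + 2 * PI * IZR (alpha i)) = phi theta.

Fixpoint torus_mean {r : nat} {E : CompleteNormedModule R_AbsRing} :
    ((Fin.t r -> R) -> E) -> E :=
  match r with
  | O => fun f => f (fun _ => 0)
  | S r => fun f =>
      scal (/ (2 * PI))
        (RInt (fun s => torus_mean (fun theta => f (fin_cons s theta)))
           0 (2 * PI))
  end.

(* The mean of e^{-i alpha.theta} phi(theta), in End(X) for complex X and in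
   End of the complexified space for real X. *)
Definition fourier_coef {X : Banach} {r : nat} (phi : (Fin.t r -> R) -> End X)
    (alpha : Fin.t r -> Z) : End (ComplexBanach (cplx_space X)) :=
  torus_mean (fun theta =>
    End_Cscal (cos (Zdot alpha theta), - sin (Zdot alpha theta))
      (End_cplx (phi theta))).

(* phi is in T_kappa with norm N; the sum over Z^r of nonnegative terms is the
   supremum of the finite partial sums. *)
Definition is_T_norm {X : Banach} {r : nat} (kappa : R)
    (phi : (Fin.t r -> R) -> End X) (N : R) : Prop :=
  torus_periodic phi /\
  (forall theta, continuous (T := fct_UniformSpace (Fin.t r) R_UniformSpace)
                   phi theta) /\
  is_lub (fun s => exists l : list (Fin.t r -> Z), NoDup l /\
    s = fold_right Rplus 0
          (map (fun alpha => exp (kappa * Zlength1 alpha)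
                               * norm (fourier_coef phi alpha)) l)) N.

Definition Rnonneg (t : R) : Prop := 0 <= t.

Definition is_exp_norm {X : Banach} (phi : R -> End X) (N : R) : Prop :=
  continuous_on Rnonneg phi /\
  is_lub (fun s => exists tau, 0 <= tau /\ s = exp tau * norm (phi tau)) N.

(* phi is in E_kappa and N = N_kappa(phi): the splitting is unique as soon as
   omega is nonresonant. *)
Definition is_E_norm {X : Banach} {r : nat} (omega : Fin.t r -> R) (kappa : R)
    (phi : R -> End X) (N : R) : Prop :=
  exists (phis : (Fin.t r -> R) -> End X) (phif : R -> End X) (Ns Nf : R),
    is_T_norm kappa phis Ns /\ is_exp_norm phif Nf /\
    (forall tau, 0 <= tau ->
       phi tau = plus (phis (fun i => omega i * tau)) (phif tau)) /\
    N = Ns + Nf.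

(* For r = 1 the convention is nu = 0 and cD = |omega|. *)
Definition diophantine {r : nat} (omega : Fin.t r -> R) (cD nu : R) : Prop :=
  0 < cD /\ INR r - 1 <= nu /\
  (forall alpha : Fin.t r -> Z, alpha <> (fun _ => 0%Z) ->
     cD / Rpower (Zlength1 alpha) nu <= Rabs (Zdot alpha omega)) /\
  (r = 1%nat -> nu = 0 /\ cD = fin_sum (fun i => Rabs (omega i))).

Definition c_I (cD nu kappa : R) : R :=
  if Req_EM_T nu 0 then Rmax 1 (/ cD)
  else Rmax 1 (/ cD * Rpower (nu / (kappa * exp 1)) nu).

Definition eps_threshold (cD nu mu M c : R) (n : nat) : R :=
  c / (c_I cD nu (mu / (INR n + 1)) * ((2 + c) * (1 + c)) * M).

(* One-sided at boundary points of D. *)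
Definition is_derive_on {V : NormedModule R_AbsRing} (D : R -> Prop)
    (f : R -> V) (t : R) (l : V) : Prop :=
  filterdiff f (within D (locally t)) (fun h => scal h l).

Definition Derive_on {V : CompleteNormedModule R_AbsRing} (D : R -> Prop)
    (f : R -> V) (t : R) : V :=
  iota (is_derive_on D f t).

Fixpoint is_derive_n_on {V : NormedModule R_AbsRing} (D : R -> Prop)
    (f : R -> V) (p : nat) (g : R -> V) : Prop :=
  match p with
  | O => forall t, D t -> g t = f t
  | S p => exists h, is_derive_n_on D f p h /\
                     forall t, D t -> is_derive_on D h t (g t)
  end.

Definition class_C_on {V : NormedModule R_AbsRing} (D : R -> Prop) (q : nat)
    (f : R -> V) : Prop :=
  forall p, (p <= q)%nat ->
    exists g, is_derive_n_on D f p g /\ continuous_on D g.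

(* Total: meaningful when the limit exists, as [RInt] and [iota]. *)
Definition time_average {V : CompleteNormedModule R_AbsRing} (phi : R -> V) :
    V :=
  iota (fun L => filterlim (fun tau => scal (/ tau) (RInt phi 0 tau))
                   (Rbar_locally p_infty) (locally L)).

Definition End_inv {X : Banach} (A : End X) : End X :=
  iota (fun B => End_comp A B = End_id /\ End_comp B A = End_id).

Section MicroMacro.
Context {X : Banach} (a : R -> End X) (eps : R).

Definition Lambda (phi : R -> End X) (tau : R) : End X :=
  minus (End_comp (a tau) (phi tau))
        (End_comp (phi tau)
           (time_average (fun s => End_comp (a s) (phi s)))).

Fixpoint Phi (n : nat) : R -> End X :=
  match n with
  | O => fun _ => End_id
  | S n => fun tau =>
      minus (plus End_id (scal eps (RInt (Lambda (Phi n)) 0 tau)))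
            (scal eps (time_average (fun s => RInt (Lambda (Phi n)) 0 s)))
  end.

Definition Amac (n : nat) : End X :=
  time_average (fun s => End_comp (a s) (Phi n s)).

Definition defect (n : nat) (tau : R) : End X :=
  minus (scal (/ eps) (Derive_on Rnonneg (Phi n) tau))
        (minus (End_comp (a tau) (Phi n tau)) (End_comp (Phi n tau) (Amac n))).

Record micro_macro_solution (n : nat) (u0 : X) (v w : R -> X) : Prop := {
  macro_eq : forall t, 0 <= t -> is_derive_on Rnonneg v t (Amac n (v t));
  macro_init : v 0 = End_inv (Phi n 0) u0;
  micro_eq : forall t, 0 <= t -> is_derive_on Rnonneg w t
    (minus (a (t / eps) (w t)) (defect n (t / eps) (v t)));
  micro_init : w 0 = zero }.
End MicroMacro.

(* Main.v *)
(* The norm on E_kappa is submultiplicative, and taking the centered primitive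
   of a map with zero average costs a width delta and a factor c_I(delta). With
   delta = mu/(n+1) one can take n+1 steps of the iteration, and the choice of
   the threshold makes Phi^[k] - id of norm at most c eps/eps_n for k <= n+1,
   while D_k = Phi^[k] - Phi^[k-1] is O(eps^k). Since D_(k+1)' = eps
   (Lambda{Phi^[k]} - Lambda{Phi^[k-1]}), bounds on derivatives of D_k follow
   from those on a, without loss in eps; in particular the defect and its
   derivatives up to order q are O(eps^n).

   The macro part solves v' = A v with |A| <= 2 M and |v(0)| <= |u0|/(1-c), by a
   Neumann series. The defect is -D_(n+1)'/eps, so that z = w - D_(n+1)(t/eps) v
   solves z' = a z + O(eps^(n+1)) and Gronwall's lemma yields w = O(eps^(n+1)).
   Each derivative of w' = a w - defect v then costs a factor 1/eps.

   That a belongs to the class of absolutely convergent trigonometric series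
   rests on Fourier inversion for continuous operator-valued maps on the torus,
   hence on uniqueness of Fourier coefficients, which is proved one variable at
   a time. *)

Require Import Defs.
From Stdlib Require Import Reals Lra Lia ZArith List Cantor.
From Stdlib Require Import ClassicalEpsilon FunctionalExtensionality.
From Stdlib Require Fin.
From Coquelicot Require Import Coquelicot.

Local Open Scope R_scope.

(** * Identities in real vector spaces *)

(** The order min(n, q) + 1 has two separate causes. Each iterate is a primitive, so its derivative
    is read off from the recursion without differentiating [a]: q derivatives of [a] give q + 1
    derivatives of every D_k, and order p + 1 of D_(k+1) is eps times order p of an expression in
    D_k. The bound n + 1 keeps the exponent n + 1 - p nonnegative. The delicate point is uniformity:
    every constant has to be chosen before eps. [time_average] and [RInt] are total operators, so
    each use of an average comes with a proof that the limit exists. That proof needs a bounded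
    primitive, hence a loss of width as well. For real X the Fourier modes only exist in the
    complexified operators; averages and primitives computed there are brought back to End(X)
    because complexification is isometric and End(X) is complete. *)

Inductive mexp : Type :=
| Mvar (i : nat)
| Mzero
| Mplus (x y : mexp)
| Mopp (x : mexp)
| Mscal (k : R) (x : mexp).

Fixpoint meval {V : ModuleSpace R_Ring} (env : list V) (x : mexp) : V :=
  match x with
  | Mvar i => nth i env zero
  | Mzero => zero
  | Mplus x y => plus (meval env x) (meval env y)
  | Mopp x => opp (meval env x)
  | Mscal k x => scal k (meval env x)
  end.

Fixpoint mcoef (x : mexp) (i : nat) : R :=
  match x with
  | Mvar j => if Nat.eqb i j then 1 else 0
  | Mzero => 0
  | Mplus x y => mcoef x i + mcoef y i
  | Mopp x => - mcoef x i
  | Mscal k x => k * mcoef x i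
  end.

Fixpoint mcomb {V : ModuleSpace R_Ring} (env : list V) (c : nat -> R) (n : nat) :
    V :=
  match n with
  | O => zero
  | S n => plus (mcomb env c n) (scal (c n) (nth n env zero))
  end.

Fixpoint mcoef_eq (x y : mexp) (n : nat) : Prop :=
  match n with
  | O => True
  | S n => mcoef x n = mcoef y n /\ mcoef_eq x y n
  end.

Lemma mcomb_zero {V : ModuleSpace R_Ring} (env : list V) (n : nat) :
  mcomb env (fun _ => 0) n = zero.
Proof.
  induction n as [|n IH]; [reflexivity|].
  simpl. rewrite IH, plus_zero_l. exact (scal_zero_l _).
Qed.

Lemma mcomb_plus {V : ModuleSpace R_Ring} (env : list V) (c d : nat -> R)
    (n : nat) :
  mcomb env (fun i => c i + d i) n = plus (mcomb env c n) (mcomb env d n).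
Proof.
  induction n as [|n IH]; simpl; [now rewrite plus_zero_l|].
  rewrite IH. change (c n + d n) with (plus (c n : R_Ring) (d n)).
  rewrite scal_distr_r. apply plus_swap.
Qed.

Lemma mcomb_scal {V : ModuleSpace R_Ring} (env : list V) (k : R) (c : nat -> R)
    (n : nat) :
  mcomb env (fun i => k * c i) n = scal k (mcomb env c n).
Proof.
  induction n as [|n IH]; simpl; [now rewrite scal_zero_r|].
  rewrite IH, scal_distr_l, scal_assoc. reflexivity.
Qed.

Lemma mcomb_ext {V : ModuleSpace R_Ring} (env : list V) (c d : nat -> R)
    (n : nat) :
  (forall i, (i < n)%nat -> c i = d i) -> mcomb env c n = mcomb env d n.
Proof.
  induction n as [|n IH]; intros H; simpl; [reflexivity|].
  rewrite IH by (intros; apply H; lia). rewrite H by lia. reflexivity.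
Qed.

Lemma mcomb_var {V : ModuleSpace R_Ring} (env : list V) (j n : nat) :
  mcomb env (fun i => if Nat.eqb i j then 1 else 0) n
  = if Nat.ltb j n then nth j env zero else zero.
Proof.
  induction n as [|n IH]; [reflexivity|]. simpl. rewrite IH.
  destruct (Nat.eqb_spec n j) as [->|E].
  - rewrite (proj2 (Nat.ltb_ge j j)), (proj2 (Nat.ltb_lt j (S j))) by lia.
    rewrite plus_zero_l. exact (scal_one _).
  - change (scal 0 (nth n env zero)) with (scal (zero : R_Ring) (nth n env zero)).
    rewrite scal_zero_l, plus_zero_r.
    destruct (Nat.ltb_spec j n), (Nat.ltb_spec j (S n)); try reflexivity; lia.
Qed.

Lemma meval_comb {V : ModuleSpace R_Ring} (env : list V) (x : mexp) :
  meval env x = mcomb env (mcoef x) (length env).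
Proof.
  induction x as [j| |x IHx y IHy|x IH|k x IH]; simpl.
  - rewrite mcomb_var. destruct (Nat.ltb_spec j (length env)); [reflexivity|].
    now apply nth_overflow.
  - now rewrite mcomb_zero.
  - now rewrite IHx, IHy, mcomb_plus.
  - rewrite IH, <- scal_opp_one.
    change (opp one : R_Ring) with (- (1)). rewrite <- mcomb_scal.
    apply mcomb_ext. intros; ring.
  - now rewrite IH, mcomb_scal.
Qed.

(* Correctness of [module], which decides identities between linear
   combinations with coefficients in R by comparing coefficients. *)
Lemma meval_eq {V : ModuleSpace R_Ring} (env : list V) (x y : mexp) :
  mcoef_eq x y (length env) -> meval env x = meval env y.
Proof.
  rewrite !meval_comb. intros H. apply mcomb_ext. revert H.
  generalize (length env). induction n as [|n IH]; simpl; [lia|].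
  intros [H1 H2] i Hi. destruct (Nat.eq_dec i n) as [->|]; [exact H1|].
  apply IH; [exact H2|lia].
Qed.

Ltac mfind x env :=
  lazymatch env with
  | cons x _ => constr:(O)
  | cons _ ?env => let i := mfind x env in constr:(S i)
  end.

Ltac matoms x env :=
  lazymatch x with
  | plus ?a ?b => let env := matoms a env in matoms b env
  | minus ?a ?b => let env := matoms a env in matoms b env
  | opp ?a => matoms a env
  | scal _ ?a => matoms a env
  | zero => env
  | _ => match tt with
         | _ => let _ := mfind x env in env
         | _ => constr:(cons x env)
         end
  end.

Ltac mreify x env :=
  lazymatch x with
  | plus ?a ?b =>
      let a := mreify a env in let b := mreify b env in constr:(Mplus a b)
  | minus ?a ?b =>
      let a := mreify a env in let b := mreify b env in constr:(Mplus a (Mopp b))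
  | opp ?a => let a := mreify a env in constr:(Mopp a)
  | scal ?k ?a => let a := mreify a env in constr:(Mscal k a)
  | zero => constr:(Mzero)
  | _ => let i := mfind x env in constr:(Mvar i)
  end.

(** Coefficient identities that [ring] does not close, such as those with inverses, remain as goals;
    hence the calls of the form [module; field]. *)
Ltac module_coefs :=
  cbn [mcoef_eq mcoef length Nat.eqb];
  repeat split; try (unfold plus, mult, opp, one, zero; simpl; ring).

Ltac module :=
  lazymatch goal with
  | |- @eq ?T ?x ?y =>
      let env := matoms x (@nil T) in
      let env := matoms y env in
      let a := mreify x env in
      let b := mreify y env in
      refine (meval_eq env a b _); module_coefs
  end.

(** * Calculus on the half-line *)

Ltac norm_replace y :=
  lazymatch goal with
  | |- norm ?x <= _ => replace x with y
  | |- norm ?x < _ => replace x with y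
  end.

Lemma norm_zero_le {V : NormedModule R_AbsRing} (x : V) (a : R) :
  x = zero -> 0 <= a -> norm x <= a.
Proof. intros -> H. exact (Rle_trans _ _ _ (Req_le _ _ norm_zero) H). Qed.

Lemma norm_plus_le {V : NormedModule R_AbsRing} {x y : V} {a b : R} :
  norm x <= a -> norm y <= b -> norm (plus x y) <= a + b.
Proof.
  intros Hx Hy. refine (Rle_trans _ _ _ (norm_triangle x y) _). lra.
Qed.

Lemma norm_minus_le {V : NormedModule R_AbsRing} {x y : V} {a b : R} :
  norm x <= a -> norm y <= b -> norm (minus x y) <= a + b.
Proof.
  intros Hx Hy. apply norm_plus_le; [exact Hx|]. now rewrite norm_opp.
Qed.

Lemma norm_scal_le {V : NormedModule R_AbsRing} (k : R) {x : V} {a b : R} :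
  Rabs k <= a -> norm x <= b -> norm (scal k x) <= a * b.
Proof.
  intros Hk Hx. refine (Rle_trans _ _ _ (norm_scal k x) _).
  apply Rmult_le_compat; [apply Rabs_pos|apply norm_ge_0|exact Hk|exact Hx].
Qed.

(** * Continuity and one-sided derivatives in epsilon-delta form *)

Section NormedLimits.
Context {V : NormedModule R_AbsRing}.
Implicit Types (f g : R -> V).

Lemma filterlim_norm_iff {T : Type} (F : (T -> Prop) -> Prop) {FF : Filter F}
    (f : T -> V) (y : V) :
  filterlim f F (locally y) <->
  forall e : R, 0 < e -> F (fun x => norm (minus (f x) y) < e).
Proof.
  split.
  - intros H e Pe. exact (proj1 (filterlim_locally_ball_norm f y) H (mkposreal e Pe)).
  - intros H. apply filterlim_locally_ball_norm. intros e. apply H, cond_pos.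
Qed.

Lemma within_locally_iff (D P : R -> Prop) (t : R) :
  within D (locally t) P <->
  exists d, 0 < d /\ forall s, D s -> Rabs (s - t) < d -> P s.
Proof.
  split.
  - intros [d H]. exists d. split; [apply cond_pos|].
    intros s Ds Hs. exact (H s Hs Ds).
  - intros [d [Pd H]]. exists (mkposreal d Pd). intros s Hs Ds. exact (H s Ds Hs).
Qed.

Lemma locally_iff (P : R -> Prop) (t : R) :
  locally t P <-> exists d, 0 < d /\ forall s, Rabs (s - t) < d -> P s.
Proof.
  split.
  - intros [d H]. exists d. split; [apply cond_pos|exact H].
  - intros [d [Pd H]]. exists (mkposreal d Pd). exact H.
Qed.

Lemma continuous_on_iff f :
  continuous_on Rnonneg f <->
  forall t, 0 <= t -> forall e, 0 < e ->
    exists d, 0 < d /\ forall s, 0 <= s -> Rabs (s - t) < d ->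
      norm (minus (f s) (f t)) < e.
Proof.
  split.
  - intros H t Pt e Pe. apply within_locally_iff.
    exact (proj1 (filterlim_norm_iff _ f (f t)) (H t Pt) e Pe).
  - intros H t Pt. apply filterlim_norm_iff; [typeclasses eauto|].
    intros e Pe. apply within_locally_iff. exact (H t Pt e Pe).
Qed.

Lemma continuous_R_iff f t :
  continuous f t <->
  forall e, 0 < e ->
    exists d, 0 < d /\ forall s, Rabs (s - t) < d -> norm (minus (f s) (f t)) < e.
Proof.
  split.
  - intros H e Pe. apply locally_iff.
    exact (proj1 (filterlim_norm_iff _ f (f t)) H e Pe).
  - intros H. apply filterlim_norm_iff; [typeclasses eauto|].
    intros e Pe. apply locally_iff. exact (H e Pe).
Qed.

(** The map s -> max(0, s) is 1-Lipschitz with values in the half-line, so the composite is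
    continuous on all of R and two-sided integration theorems apply to it. *)
Lemma continuous_clamp f :
  continuous_on Rnonneg f -> forall t, continuous (fun s => f (Rmax 0 s)) t.
Proof.
  intros H t. apply continuous_R_iff. intros e Pe.
  destruct (proj1 (continuous_on_iff f) H (Rmax 0 t) (Rmax_l _ _) e Pe)
    as [d [Pd Hd]].
  exists d. split; [exact Pd|]. intros s Hs. apply Hd; [apply Rmax_l|].
  eapply Rle_lt_trans; [|exact Hs].
  unfold Rmax. destruct (Rle_dec 0 s), (Rle_dec 0 t); try lra;
    unfold Rabs; repeat destruct Rcase_abs; lra.
Qed.

Lemma continuous_on_of_continuous f :
  (forall t, 0 <= t -> continuous f t) -> continuous_on Rnonneg f.
Proof.
  intros H. apply continuous_on_iff. intros t Pt e Pe.
  destruct (proj1 (continuous_R_iff f t) (H t Pt) e Pe) as [d [Pd Hd]].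
  exists d. split; [exact Pd|]. intros s _. apply Hd.
Qed.

Lemma continuous_on_ext_nonneg f g :
  (forall t, 0 <= t -> f t = g t) ->
  continuous_on Rnonneg f -> continuous_on Rnonneg g.
Proof.
  intros E H. apply continuous_on_iff. intros t Pt e Pe.
  destruct (proj1 (continuous_on_iff f) H t Pt e Pe) as [d [Pd Hd]].
  exists d. split; [exact Pd|]. intros s Ps Hs.
  rewrite <- !E by assumption. now apply Hd.
Qed.

(** [filterdiff] quantifies over all limit points of the filter; here t is the only one, which
    reduces the notion to a single estimate at t. *)
Lemma is_derive_on_iff f t (l : V) :
  0 <= t ->
  (is_derive_on Rnonneg f t l <->
   forall e, 0 < e -> exists d, 0 < d /\ forall s, 0 <= s -> Rabs (s - t) < d ->
     norm (minus (minus (f s) (f t)) (scal (s - t) l)) <= e * Rabs (s - t)).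
Proof.
  intros Pt. split.
  - intros [_ H] e Pe.
    assert (Lt : is_filter_lim (within Rnonneg (locally t)) t).
    { intros P HP. now apply filter_le_within. }
    specialize (H t Lt (mkposreal e Pe)). apply within_locally_iff in H.
    exact H.
  - intros H. split; [exact (is_linear_scal_l l)|].
    intros x Lx.
    (* The point t belongs to the half-line, so it would lie in every neighbourhood of x; a ball of
       radius |x - t| / 2 around x gives the contradiction. *)
    assert (E : x = t).
    { destruct (Req_dec x t) as [E|E]; [exact E|exfalso].
      assert (P : 0 < Rabs (x - t) / 2)
        by (pose proof (Rabs_pos_lt (x - t)); lra).
      assert (HP : locally x (fun y => Rabs (y - x) < Rabs (x - t) / 2)).
      { apply locally_iff. exists (Rabs (x - t) / 2). auto. }
      apply Lx in HP. apply within_locally_iff in HP.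
      destruct HP as [d [Pd Hd]].
      assert (H0 := Hd t Pt). rewrite Rminus_diag, Rabs_R0 in H0.
      specialize (H0 Pd). rewrite Rabs_minus_sym in H0. lra. }
    subst x. intros e. apply within_locally_iff. exact (H e (cond_pos e)).
Qed.

Lemma is_derive_iff f t (l : V) :
  is_derive f t l <->
  forall e, 0 < e -> exists d, 0 < d /\ forall s, Rabs (s - t) < d ->
     norm (minus (minus (f s) (f t)) (scal (s - t) l)) <= e * Rabs (s - t).
Proof.
  split.
  - intros [_ H] e Pe.
    specialize (H t (fun P HP => HP) (mkposreal e Pe)).
    apply locally_iff in H. exact H.
  - intros H. split; [exact (is_linear_scal_l l)|].
    intros x Lx.
    assert (E : t = x)
      by exact (is_filter_lim_locally_unique (V := AbsRing_NormedModule R_AbsRing) t x Lx).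
    subst x.
    intros e. apply locally_iff. exact (H e (cond_pos e)).
Qed.

Lemma is_derive_on_of_is_derive f t l :
  0 <= t -> is_derive f t l -> is_derive_on Rnonneg f t l.
Proof.
  intros Pt H. apply is_derive_on_iff; [exact Pt|]. intros e Pe.
  destruct (proj1 (is_derive_iff f t l) H e Pe) as [d [Pd Hd]].
  exists d. split; [exact Pd|]. intros s _. apply Hd.
Qed.

Lemma is_derive_on_ext_nonneg f g t l :
  0 <= t -> (forall s, 0 <= s -> f s = g s) ->
  is_derive_on Rnonneg f t l -> is_derive_on Rnonneg g t l.
Proof.
  intros Pt E H. apply is_derive_on_iff; [exact Pt|]. intros e Pe.
  destruct (proj1 (is_derive_on_iff f t l Pt) H e Pe) as [d [Pd Hd]].
  exists d. split; [exact Pd|]. intros s Ps Hs.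
  rewrite <- !E by assumption. now apply Hd.
Qed.

(** A single increment t + h to the right suffices, and it is available at t = 0 too: the difference
    of the two remainders, divided by h, is the difference of the slopes. *)
Lemma is_derive_on_unique f t l1 l2 :
  0 <= t -> is_derive_on Rnonneg f t l1 -> is_derive_on Rnonneg f t l2 ->
  l1 = l2.
Proof.
  intros Pt H1 H2. apply minus_zero_eq.
  apply (norm_small_zero _ _ _ 2). intros e Pe.
  destruct (proj1 (is_derive_on_iff f t l1 Pt) H1 e Pe) as [d1 [Pd1 Hd1]].
  destruct (proj1 (is_derive_on_iff f t l2 Pt) H2 e Pe) as [d2 [Pd2 Hd2]].
  set (h := Rmin d1 d2 / 2).
  assert (Ph : 0 < h) by (unfold h; pose proof (Rmin_pos d1 d2 Pd1 Pd2); lra).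
  assert (B1 : Rabs (t + h - t) < d1).
  { replace (t + h - t) with h by ring. rewrite Rabs_pos_eq by lra.
    unfold h. pose proof (Rmin_l d1 d2). lra. }
  assert (B2 : Rabs (t + h - t) < d2).
  { replace (t + h - t) with h by ring. rewrite Rabs_pos_eq by lra.
    unfold h. pose proof (Rmin_r d1 d2). lra. }
  specialize (Hd1 (t + h) ltac:(lra) B1).
  specialize (Hd2 (t + h) ltac:(lra) B2).
  replace (t + h - t) with h in Hd1, Hd2 by ring.
  rewrite (Rabs_pos_eq h) in Hd1, Hd2 by lra.
  assert (E : minus l1 l2 = scal (/ h)
    (minus (minus (minus (f (t + h)) (f t)) (scal h l2))
           (minus (minus (f (t + h)) (f t)) (scal h l1)))).
  { module; field; lra. }
  rewrite E. refine (Rle_trans _ _ _ (norm_scal _ _) _).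
  change (abs (/ h)) with (Rabs (/ h)).
  rewrite Rabs_pos_eq by (left; now apply Rinv_0_lt_compat).
  refine (Rle_trans _ _ _ (Rmult_le_compat_l _ _ (e * h + e * h) _ _) _).
  - left; now apply Rinv_0_lt_compat.
  - unfold minus at 1. refine (Rle_trans _ _ _ (norm_triangle _ _) _).
    rewrite norm_opp. lra.
  - right. field. lra.
Qed.

Lemma is_derive_on_continuous f (g : R -> V) :
  (forall t, 0 <= t -> is_derive_on Rnonneg f t (g t)) ->
  continuous_on Rnonneg f.
Proof.
  intros H. apply continuous_on_iff. intros t Pt e Pe.
  destruct (proj1 (is_derive_on_iff f t _ Pt) (H t Pt) 1 Rlt_0_1)
    as [d [Pd Hd]].
  pose proof (norm_ge_0 (g t)) as Pg.
  assert (Pe' : 0 < e / (2 + norm (g t))) by (apply Rdiv_lt_0_compat; lra).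
  exists (Rmin d (e / (2 + norm (g t)))).
  split; [now apply Rmin_pos|]. intros s Ps Hs.
  assert (Hs1 := Rlt_le_trans _ _ _ Hs (Rmin_l _ _)).
  assert (Hs2 := Rlt_le_trans _ _ _ Hs (Rmin_r _ _)).
  specialize (Hd s Ps Hs1).
  replace (minus (f s) (f t)) with
    (plus (minus (minus (f s) (f t)) (scal (s - t) (g t))) (scal (s - t) (g t)))
    by module.
  refine (Rle_lt_trans _ _ _ (norm_triangle _ _) _).
  pose proof (norm_scal (s - t) (g t)) as N.
  change (abs (s - t)) with (Rabs (s - t)) in N.
  apply (Rmult_lt_compat_r (2 + norm (g t))) in Hs2; [|lra].
  replace (e / (2 + norm (g t)) * (2 + norm (g t))) with e in Hs2 by (field; lra).
  pose proof (Rabs_pos (s - t)).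
  apply Rle_lt_trans with (1 * Rabs (s - t) + Rabs (s - t) * norm (g t));
    [apply Rplus_le_compat; assumption|lra].
Qed.

Lemma is_derive_on_const (x : V) t : 0 <= t -> is_derive_on Rnonneg (fun _ => x) t zero.
Proof.
  intros Pt. apply is_derive_on_of_is_derive; [exact Pt|]. apply is_derive_const.
Qed.

Lemma is_derive_on_plus f g t l m :
  is_derive_on Rnonneg f t l -> is_derive_on Rnonneg g t m ->
  is_derive_on Rnonneg (fun s => plus (f s) (g s)) t (plus l m).
Proof.
  intros H1 H2.
  refine (filterdiff_ext_lin _ _ _ (filterdiff_plus_fct f g _ _ H1 H2) _).
  intros y. cbn beta. module.
Qed.

Lemma is_derive_on_scal (k : R) f t l :
  is_derive_on Rnonneg f t l ->
  is_derive_on Rnonneg (fun s => scal k (f s)) t (scal k l).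
Proof.
  intros H.
  refine (filterdiff_ext_lin _ _ _ (filterdiff_scal_r_fct k f _ Rmult_comm H) _).
  intros y. cbn beta. module.
Qed.

Lemma is_derive_on_opp f t l :
  is_derive_on Rnonneg f t l ->
  is_derive_on Rnonneg (fun s => opp (f s)) t (opp l).
Proof.
  intros H.
  refine (filterdiff_ext_lin _ _ _ (filterdiff_opp_fct f _ H) _).
  intros y. cbn beta. module.
Qed.

Lemma is_derive_on_minus f g t l m :
  is_derive_on Rnonneg f t l -> is_derive_on Rnonneg g t m ->
  is_derive_on Rnonneg (fun s => minus (f s) (g s)) t (minus l m).
Proof.
  intros H1 H2. apply is_derive_on_plus; [exact H1|]. now apply is_derive_on_opp.
Qed.

Lemma is_derive_on_rescale f (k t : R) l :
  0 < k -> 0 <= t -> is_derive_on Rnonneg f (t / k) l ->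
  is_derive_on Rnonneg (fun s => f (s / k)) t (scal (/ k) l).
Proof.
  intros Pk Pt H.
  assert (Pik : 0 < / k) by now apply Rinv_0_lt_compat.
  assert (Ptk : 0 <= t / k) by (apply Rmult_le_pos; lra).
  apply is_derive_on_iff; [exact Pt|]. intros e Pe.
  destruct (proj1 (is_derive_on_iff f _ l Ptk) H (e * k) (Rmult_lt_0_compat _ _ Pe Pk))
    as [d [Pd Hd]].
  exists (d * k). split; [now apply Rmult_lt_0_compat|]. intros s Ps Hs.
  assert (E : s / k - t / k = (s - t) * / k) by (field; lra).
  assert (A : Rabs (s / k - t / k) = Rabs (s - t) * / k).
  { rewrite E, Rabs_mult, (Rabs_pos_eq (/ k)) by lra. reflexivity. }
  assert (L : Rabs (s / k - t / k) < d).
  { rewrite A. apply Rmult_lt_reg_r with k; [exact Pk|].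
    rewrite Rmult_assoc, Rinv_l by lra. lra. }
  specialize (Hd (s / k) ltac:(apply Rmult_le_pos; lra) L).
  rewrite A in Hd.
  replace (scal (s - t) (scal (/ k) l)) with (scal (s / k - t / k) l)
    by (rewrite E; module).
  refine (Rle_trans _ _ _ Hd _). right. field. lra.
Qed.

End NormedLimits.

(** Common to composition of operators, evaluation of an operator at a vector and scalar
    multiplication, so that continuity and the product rule are proved once. *)
Record bilinear_le1 {U V W : NormedModule R_AbsRing} (B : U -> V -> W) : Prop := {
  bil_plus_l : forall x x' y, B (plus x x') y = plus (B x y) (B x' y);
  bil_plus_r : forall x y y', B x (plus y y') = plus (B x y) (B x y');
  bil_scal_l : forall (k : R) x y, B (scal k x) y = scal k (B x y);
  bil_scal_r : forall (k : R) x y, B x (scal k y) = scal k (B x y);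
  bil_norm : forall x y, norm (B x y) <= norm x * norm y }.

Section Bilinear.
Context {U V W : NormedModule R_AbsRing} (B : U -> V -> W) (HB : bilinear_le1 B).

Lemma bil_opp_l x y : B (opp x) y = opp (B x y).
Proof.
  replace (opp x) with (scal (-1) x) by module.
  rewrite (bil_scal_l B HB). module.
Qed.

Lemma bil_opp_r x y : B x (opp y) = opp (B x y).
Proof.
  replace (opp y) with (scal (-1) y) by module.
  rewrite (bil_scal_r B HB). module.
Qed.

Lemma bil_minus_l x x' y : B (minus x x') y = minus (B x y) (B x' y).
Proof. unfold minus. now rewrite (bil_plus_l B HB), bil_opp_l. Qed.

Lemma bil_minus_r x y y' : B x (minus y y') = minus (B x y) (B x y').
Proof. unfold minus. now rewrite (bil_plus_r B HB), bil_opp_r. Qed.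

Lemma bil_norm_le {x : U} {y : V} {p q : R} :
  norm x <= p -> norm y <= q -> norm (B x y) <= p * q.
Proof.
  intros Hx Hy. refine (Rle_trans _ _ _ (bil_norm B HB x y) _).
  apply Rmult_le_compat; [apply norm_ge_0|apply norm_ge_0|exact Hx|exact Hy].
Qed.

Lemma continuous_on_bilinear (f : R -> U) (g : R -> V) :
  continuous_on Rnonneg f -> continuous_on Rnonneg g ->
  continuous_on Rnonneg (fun t => B (f t) (g t)).
Proof.
  intros Hf Hg. apply continuous_on_iff. intros t Pt e Pe.
  pose proof (norm_ge_0 (f t)) as Pf. pose proof (norm_ge_0 (g t)) as Pg.
  set (c := norm (f t) + norm (g t) + 1).
  set (e' := Rmin 1 (e / (2 * c))).
  assert (Pe' : 0 < e')
    by (apply Rmin_pos; [lra|apply Rdiv_lt_0_compat; unfold c; lra]).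
  assert (M1 : e' <= 1) by apply Rmin_l.
  assert (M2 : e' * c <= e / 2).
  { replace (e / 2) with (e / (2 * c) * c) by (unfold c; field; lra).
    apply Rmult_le_compat_r; [unfold c; lra|apply Rmin_r]. }
  destruct (proj1 (continuous_on_iff f) Hf t Pt _ Pe') as [d1 [Pd1 Hd1]].
  destruct (proj1 (continuous_on_iff g) Hg t Pt _ Pe') as [d2 [Pd2 Hd2]].
  exists (Rmin d1 d2). split; [now apply Rmin_pos|]. intros s Ps Hs.
  specialize (Hd1 s Ps (Rlt_le_trans _ _ _ Hs (Rmin_l _ _))).
  specialize (Hd2 s Ps (Rlt_le_trans _ _ _ Hs (Rmin_r _ _))).
  replace (minus (B (f s) (g s)) (B (f t) (g t))) with
    (plus (plus (B (minus (f s) (f t)) (minus (g s) (g t)))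
                (B (minus (f s) (f t)) (g t)))
          (B (f t) (minus (g s) (g t))))
    by (rewrite !bil_minus_l, !bil_minus_r; module).
  refine (Rle_lt_trans _ _ _ (norm_plus_le (norm_plus_le
    (bil_norm_le (Rlt_le _ _ Hd1) (Rlt_le _ _ Hd2))
    (bil_norm_le (Rlt_le _ _ Hd1) (Rle_refl _)))
    (bil_norm_le (Rle_refl _) (Rlt_le _ _ Hd2))) _).
  unfold c in M2. nra.
Qed.

Lemma is_derive_on_bilinear (f : R -> U) (g : R -> V) t l m :
  0 <= t -> is_derive_on Rnonneg f t l -> is_derive_on Rnonneg g t m ->
  is_derive_on Rnonneg (fun s => B (f s) (g s)) t (plus (B l (g t)) (B (f t) m)).
Proof.
  intros Pt Hf Hg. apply is_derive_on_iff; [exact Pt|]. intros e Pe.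
  pose proof (norm_ge_0 (f t)) as Pf. pose proof (norm_ge_0 (g t)) as Pg.
  pose proof (norm_ge_0 l) as Pl. pose proof (norm_ge_0 m) as Pm.
  set (c := norm (f t) + norm (g t) + norm l + 1).
  set (e' := Rmin 1 (e / c)).
  assert (Pe' : 0 < e')
    by (apply Rmin_pos; [lra|apply Rdiv_lt_0_compat; unfold c; lra]).
  assert (M1 : e' <= 1) by apply Rmin_l.
  assert (M2 : e' * c <= e).
  { apply Rle_trans with (e / c * c); [|right; unfold c; field; unfold c; lra].
    apply Rmult_le_compat_r; [unfold c; lra|apply Rmin_r]. }
  destruct (proj1 (is_derive_on_iff f t l Pt) Hf _ Pe') as [d1 [Pd1 Hd1]].
  destruct (proj1 (is_derive_on_iff g t m Pt) Hg _ Pe') as [d2 [Pd2 Hd2]].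
  (* For |h| < d3 the increment of [g], at most (e' + |m|) |h|, stays below e'. This controls the
     second-order term h B(l, g(s) - g(t)). *)
  set (d3 := e' / (e' + norm m)).
  assert (Pd3 : 0 < d3) by (apply Rdiv_lt_0_compat; lra).
  exists (Rmin (Rmin d1 d2) d3). split; [now repeat apply Rmin_pos|].
  intros s Ps Hs.
  assert (Hs' := Rlt_le_trans _ _ _ Hs (Rmin_l _ _)).
  assert (Hs3 := Rlt_le_trans _ _ _ Hs (Rmin_r _ _)).
  specialize (Hd1 s Ps (Rlt_le_trans _ _ _ Hs' (Rmin_l _ _))).
  specialize (Hd2 s Ps (Rlt_le_trans _ _ _ Hs' (Rmin_r _ _))).
  set (h := s - t) in *. pose proof (Rabs_pos h) as Ph.
  assert (Hdg : norm (minus (g s) (g t)) <= e').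
  { replace (minus (g s) (g t))
      with (plus (minus (minus (g s) (g t)) (scal h m)) (scal h m)) by module.
    refine (Rle_trans _ _ _ (norm_plus_le Hd2
      (norm_scal_le h (Rle_refl _) (Rle_refl _))) _).
    apply (Rmult_lt_compat_r (e' + norm m)) in Hs3; [|lra].
    replace (d3 * (e' + norm m)) with e' in Hs3 by (unfold d3; field; lra). lra. }
  assert (Ng : norm (g s) <= norm (g t) + 1).
  { replace (g s) with (plus (g t) (minus (g s) (g t))) by module.
    refine (norm_plus_le (Rle_refl _) _). lra. }
  norm_replace
    (plus (plus (B (minus (minus (f s) (f t)) (scal h l)) (g s))
                (scal h (B l (minus (g s) (g t)))))
          (B (f t) (minus (minus (g s) (g t)) (scal h m)))).
  2: { rewrite !bil_minus_l, !bil_minus_r, (bil_scal_l B HB), (bil_scal_r B HB).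
       module. }
  refine (Rle_trans _ _ _ (norm_plus_le (norm_plus_le (bil_norm_le Hd1 Ng)
    (norm_scal_le h (Rle_refl _) (bil_norm_le (Rle_refl _) Hdg)))
    (bil_norm_le (Rle_refl _) Hd2)) _).
  fold h. apply Rle_trans with (e' * c * Rabs h);
    [right; unfold c; ring|now apply Rmult_le_compat_r].
Qed.
End Bilinear.

(** * Integration, Gronwall's lemma and time averages on the half-line *)

Section IntegralsOnHalfLine.
Context {V : CompleteNormedModule R_AbsRing}.
Implicit Types f g : R -> V.

Lemma ex_RInt_nonneg f a b :
  continuous_on Rnonneg f -> 0 <= a -> 0 <= b -> ex_RInt f a b.
Proof.
  intros Hf Pa Pb. apply (ex_RInt_ext (fun s => f (Rmax 0 s))).
  - intros x [Hx _]. rewrite Rmax_right; [reflexivity|].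
    pose proof (Rmin_glb _ _ _ Pa Pb). lra.
  - apply ex_RInt_continuous. intros z _. exact (continuous_clamp f Hf z).
Qed.

Lemma is_RInt_nonneg f a b :
  continuous_on Rnonneg f -> 0 <= a -> 0 <= b -> is_RInt f a b (RInt f a b).
Proof. intros Hf Pa Pb. apply RInt_correct. now apply ex_RInt_nonneg. Qed.

Lemma RInt_ext_nonneg f g b :
  0 <= b -> (forall t, 0 <= t -> f t = g t) -> RInt f 0 b = RInt g 0 b.
Proof.
  intros Pb E. apply RInt_ext. intros x [Hx _]. apply E.
  rewrite Rmin_left in Hx; lra.
Qed.

(* Extending f affinely to negative times makes two-sided calculus available. *)
Lemma is_derive_clamp_affine f g t :
  (forall s, 0 <= s -> is_derive_on Rnonneg f s (g s)) ->
  is_derive (fun s => plus (f (Rmax 0 s)) (scal (Rmin 0 s) (g 0))) t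
    (g (Rmax 0 t)).
Proof.
  intros H. apply is_derive_iff. intros e Pe.
  destruct (Rlt_le_dec t 0) as [Ht|Ht].
  - exists (- t). split; [lra|]. intros s Hs.
    assert (Hs0 : s < 0) by (unfold Rabs in Hs; destruct Rcase_abs; lra).
    rewrite !Rmax_left, !Rmin_right by lra.
        apply norm_zero_le; [module|]. pose proof (Rabs_pos (s - t)). nra.
  - destruct (proj1 (is_derive_on_iff f t _ Ht) (H t Ht) e Pe) as [d [Pd Hd]].
    rewrite (Rmax_right 0 t) by lra. rewrite (Rmin_left 0 t) by lra.
    destruct (Req_dec t 0) as [E|E].
    + exists d. split; [exact Pd|]. intros s Hs.
      destruct (Rle_lt_dec 0 s) as [Ps|Ps].
      * rewrite Rmax_right, Rmin_left by lra.
        norm_replace (minus (minus (f s) (f t)) (scal (s - t) (g t))); [|module].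
        now apply Hd.
      * rewrite Rmax_left, Rmin_right by lra. rewrite E.
                apply norm_zero_le; [module|]. pose proof (Rabs_pos (s - 0)). nra.
    + exists (Rmin d t). split; [apply Rmin_pos; lra|]. intros s Hs.
      assert (Ps : 0 < s).
      { pose proof (Rlt_le_trans _ _ _ Hs (Rmin_r _ _)) as Hs'.
        unfold Rabs in Hs'; destruct Rcase_abs; lra. }
      rewrite Rmax_right, Rmin_left by lra.
      norm_replace (minus (minus (f s) (f t)) (scal (s - t) (g t))); [|module].
      apply Hd; [lra|]. exact (Rlt_le_trans _ _ _ Hs (Rmin_l _ _)).
Qed.

Lemma is_RInt_derive_on f g a b :
  (forall t, 0 <= t -> is_derive_on Rnonneg f t (g t)) ->
  continuous_on Rnonneg g -> 0 <= a -> 0 <= b ->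
  is_RInt g a b (minus (f b) (f a)).
Proof.
  intros H Hg Pa Pb.
  assert (I := is_RInt_derive
    (fun s => plus (f (Rmax 0 s)) (scal (Rmin 0 s) (g 0)))
    (fun s => g (Rmax 0 s)) a b
    (fun t _ => is_derive_clamp_affine f g t H)
    (fun t _ => continuous_clamp g Hg t)).
  cbv beta in I. rewrite !Rmax_right, !Rmin_left in I by assumption.
  replace (minus (f b) (f a)) with
    (minus (plus (f b) (scal 0 (g 0))) (plus (f a) (scal 0 (g 0)))) by module.
  refine (is_RInt_ext _ _ _ _ _ _ I).
  intros x [Hx _]. rewrite Rmax_right; [reflexivity|].
  pose proof (Rmin_glb _ _ _ Pa Pb). lra.
Qed.

Lemma RInt_derive_on f g b :
  (forall t, 0 <= t -> is_derive_on Rnonneg f t (g t)) ->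
  continuous_on Rnonneg g -> 0 <= b -> RInt g 0 b = minus (f b) (f 0).
Proof.
  intros H Hg Pb. apply is_RInt_unique. apply is_RInt_derive_on; auto; lra.
Qed.

Lemma is_derive_on_RInt g t :
  continuous_on Rnonneg g -> 0 <= t ->
  is_derive_on Rnonneg (fun s => RInt g 0 s) t (g t).
Proof.
  intros Hg Pt.
  apply is_derive_on_ext_nonneg with (fun s => RInt (fun u => g (Rmax 0 u)) 0 s);
    [exact Pt| |].
  - intros s Ps. apply RInt_ext_nonneg; [exact Ps|].
    intros u Pu. now rewrite Rmax_right.
  - apply is_derive_on_of_is_derive; [exact Pt|].
    replace (g t) with (g (Rmax 0 t)) by now rewrite Rmax_right.
    apply (is_derive_RInt (fun u => g (Rmax 0 u)) _ 0).
    + apply filter_forall. intros s. apply RInt_correct.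
      apply ex_RInt_continuous. intros z _. exact (continuous_clamp g Hg z).
    + exact (continuous_clamp g Hg t).
Qed.

Lemma continuous_on_RInt g :
  continuous_on Rnonneg g -> continuous_on Rnonneg (fun s => RInt g 0 s).
Proof.
  intros Hg. apply (is_derive_on_continuous _ g).
  intros t Pt. now apply is_derive_on_RInt.
Qed.

Lemma norm_RInt_le_nonneg f (N a b : R) :
  continuous_on Rnonneg f -> 0 <= a <= b ->
  (forall t, a <= t <= b -> norm (f t) <= N) -> norm (RInt f a b) <= (b - a) * N.
Proof.
  intros Hf Hab H. apply (norm_RInt_le_const f a b); [lra|exact H|].
  apply is_RInt_nonneg; [exact Hf|lra|lra].
Qed.

Lemma RInt_minus_nonneg f a b :
  continuous_on Rnonneg f -> 0 <= a -> 0 <= b ->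
  minus (RInt f 0 b) (RInt f 0 a) = RInt f a b.
Proof.
  intros Hf Pa Pb.
  rewrite <- (RInt_Chasles f 0 a b);
    [module|apply ex_RInt_nonneg|apply ex_RInt_nonneg]; auto; lra.
Qed.

Lemma RInt_plus_nonneg f g b :
  continuous_on Rnonneg f -> continuous_on Rnonneg g -> 0 <= b ->
  RInt (fun t => plus (f t) (g t)) 0 b = plus (RInt f 0 b) (RInt g 0 b).
Proof.
  intros Hf Hg Pb. apply is_RInt_unique.
  apply (is_RInt_plus f g); apply is_RInt_nonneg; auto; lra.
Qed.

Lemma RInt_minus_fun_nonneg f g b :
  continuous_on Rnonneg f -> continuous_on Rnonneg g -> 0 <= b ->
  RInt (fun t => minus (f t) (g t)) 0 b = minus (RInt f 0 b) (RInt g 0 b).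
Proof.
  intros Hf Hg Pb. apply is_RInt_unique.
  apply (is_RInt_minus f g); apply is_RInt_nonneg; auto; lra.
Qed.

Lemma RInt_scal_nonneg (k : R) f b :
  continuous_on Rnonneg f -> 0 <= b ->
  RInt (fun t => scal k (f t)) 0 b = scal k (RInt f 0 b).
Proof.
  intros Hf Pb. apply is_RInt_unique.
  apply (is_RInt_scal f); apply is_RInt_nonneg; auto; lra.
Qed.

Lemma RInt_const_nonneg (x : V) b : RInt (fun _ => x) 0 b = scal b x.
Proof.
  apply is_RInt_unique. rewrite <- (Rminus_0_r b) at 2.
  exact (is_RInt_const 0 b x).
Qed.

Lemma continuous_on_plus f g :
  continuous_on Rnonneg f -> continuous_on Rnonneg g ->
  continuous_on Rnonneg (fun t => plus (f t) (g t)).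
Proof.
  intros Hf Hg t Pt.
  refine (filterlim_comp_2 _ _ _ (Hf t Pt) (Hg t Pt) (filterlim_plus _ _)).
Qed.

Lemma continuous_on_scal (k : R) f :
  continuous_on Rnonneg f -> continuous_on Rnonneg (fun t => scal k (f t)).
Proof.
  intros Hf t Pt. exact (filterlim_comp _ _ _ _ _ _ _ _ (Hf t Pt) (filterlim_scal_r k (f t))).
Qed.

Lemma continuous_on_minus f g :
  continuous_on Rnonneg f -> continuous_on Rnonneg g ->
  continuous_on Rnonneg (fun t => minus (f t) (g t)).
Proof.
  intros Hf Hg.
  apply (continuous_on_ext_nonneg (fun t => plus (f t) (scal (-1) (g t)))).
  - intros t _. module.
  - apply continuous_on_plus; [exact Hf|now apply continuous_on_scal].
Qed.

Lemma continuous_on_cst (x : V) : continuous_on Rnonneg (fun _ => x).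
Proof. intros t Pt. apply filterlim_const. Qed.

Lemma continuous_on_rescale f (k : R) :
  0 < k -> continuous_on Rnonneg f -> continuous_on Rnonneg (fun t => f (t / k)).
Proof.
  intros Pk Hf. apply (continuous_on_iff (fun t => f (t / k))). intros t Pt e Pe.
  assert (Pik : 0 < / k) by now apply Rinv_0_lt_compat.
  destruct (proj1 (continuous_on_iff f) Hf (t / k) ltac:(apply Rmult_le_pos; lra)
    e Pe) as [d [Pd Hd]].
  exists (d * k). split; [now apply Rmult_lt_0_compat|]. intros s Ps Hs.
  apply Hd; [apply Rmult_le_pos; lra|].
  replace (s / k - t / k) with ((s - t) * / k) by (field; lra).
  rewrite Rabs_mult, (Rabs_pos_eq (/ k)) by lra.
  apply Rmult_lt_reg_r with k; [exact Pk|]. rewrite Rmult_assoc, Rinv_l; lra.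
Qed.

(** The norm of f need not be differentiable, but it is dominated by u(s) = |f(0)| + int_0^s (L |f|
    + B), which is; the comparison argument is run on u. *)
Lemma gronwall f g (L B T : R) :
  0 <= L -> 0 <= B ->
  (forall t, 0 <= t -> is_derive_on Rnonneg f t (g t)) ->
  continuous_on Rnonneg g ->
  (forall t, 0 <= t <= T -> norm (g t) <= L * norm (f t) + B) ->
  forall t, 0 <= t <= T -> norm (f t) <= exp (L * T) * (norm (f 0) + B * T).
Proof.
  intros PL PB Hf Hg HB t Ht.
  assert (Cf := is_derive_on_continuous f g Hf).
  set (h := fun s => L * norm (f (Rmax 0 s)) + B).
  assert (Ch : forall s, continuous h s).
  { intros s. apply (continuous_plus (V := R_NormedModule)
      (fun s => L * norm (f (Rmax 0 s))) (fun _ => B)); [|apply continuous_const].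
    apply (continuous_scal_r (V := R_NormedModule) L
      (fun s => norm (f (Rmax 0 s)))).
    exact (filterlim_comp _ _ _ _ _ _ _ _ (continuous_clamp f Cf s)
      (filterlim_norm _)). }
  set (u := fun s => norm (f 0) + RInt h 0 s).
  assert (Du : forall s, is_derive u s (h s)).
  { intros s. replace (h s) with (0 + h s) by ring.
    apply (is_derive_plus (V := R_NormedModule) (fun _ => norm (f 0))
      (fun s => RInt h 0 s)); [apply (is_derive_const (V := R_NormedModule))|].
    apply (is_derive_RInt (V := R_NormedModule) h (RInt h 0) 0); [|apply Ch].
    apply filter_forall. intros x. apply (RInt_correct (V := R_CompleteNormedModule)).
    apply (ex_RInt_continuous (V := R_CompleteNormedModule)). intros z _. apply Ch. }
  assert (fu : forall s, 0 <= s <= T -> norm (f s) <= u s).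
  { intros s Hs.
    replace (f s) with (plus (f 0) (minus (f s) (f 0))) by module.
    refine (Rle_trans _ _ _ (norm_triangle _ _) _). unfold u.
    apply Rplus_le_compat_l.
    apply (norm_RInt_le g h 0 s); [lra| | |].
    - intros x Hx. unfold h. rewrite Rmax_right by lra. apply HB. lra.
    - apply is_RInt_derive_on; auto; lra.
    - apply (RInt_correct (V := R_CompleteNormedModule)).
      apply (ex_RInt_continuous (V := R_CompleteNormedModule)). intros z _. apply Ch. }
  (* This is nonincreasing on [0, T]: its derivative is exp(-L s) (h - L u) - B, where h - L u <= B
     and exp(-L s) <= 1. *)
  set (y := fun s => exp (- L * s) * u s - B * s).
  set (dy := fun s => exp (- L * s) * (h s - L * u s) - B).
  assert (Dy : forall s, is_derive y s (dy s)).
  { intros s. unfold y, dy. assert (Du' := Du s).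
    assert (X : ex_derive u s) by (eexists; exact Du').
    auto_derive; [exact X|].
    rewrite (is_derive_unique (fun x : R => u x) s (h s) (Du s)). ring. }
  assert (ymon : y t <= y 0).
  { destruct (Req_dec t 0) as [->|E]; [lra|].
    destruct (MVT_gen y 0 t dy) as [x [Hx Ex]].
    - intros; apply Dy.
    - intros x _. apply (continuity_pt_filterlim y x).
      apply (ex_derive_continuous (V := R_NormedModule) y).
      eexists; apply Dy.
    - rewrite Rmin_left, Rmax_right in Hx by lra.
      assert (dy x <= 0).
      { unfold dy. assert (E1 : exp (- L * x) <= 1).
        { rewrite <- exp_0. assert (- L * x <= 0) by nra.
          destruct (Req_dec (- L * x) 0) as [->|]; [lra|].
          left. apply exp_increasing. lra. }
        pose proof (exp_pos (- L * x)).
        assert (h x - L * u x <= B).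
        { unfold h. rewrite Rmax_right by lra.
          pose proof (fu x ltac:(lra)). nra. }
        assert (exp (- L * x) * (h x - L * u x) <= exp (- L * x) * B)
          by (apply Rmult_le_compat_l; lra).
        nra. }
      nra. }
  unfold y in ymon. rewrite Rmult_0_r, exp_0 in ymon.
  assert (u0 : u 0 = norm (f 0)) by (unfold u; rewrite RInt_point; exact (Rplus_0_r _)).
  rewrite u0 in ymon.
  assert (Et : exp (L * t) * exp (- L * t) = 1).
  { rewrite <- exp_plus. replace (L * t + - L * t) with 0 by ring. apply exp_0. }
  assert (Eu : u t <= exp (L * t) * (norm (f 0) + B * t)).
  { replace (u t) with (exp (L * t) * (exp (- L * t) * u t))
      by (rewrite <- Rmult_assoc, Et; ring).
    pose proof (exp_pos (L * t)). apply Rmult_le_compat_l; lra. }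
  refine (Rle_trans _ _ _ (fu t Ht) (Rle_trans _ _ _ Eu _)).
  pose proof (norm_ge_0 (f 0)).
  apply Rmult_le_compat; [left; apply exp_pos|nra| |nra].
  destruct (Req_dec (L * t) (L * T)) as [->|]; [lra|].
  left. apply exp_increasing. nra.
Qed.

(** The relational form of [time_average]: it records that the limit exists, which the total
    operator does not. *)
Definition is_avg f (L : V) : Prop :=
  filterlim (fun tau => scal (/ tau) (RInt f 0 tau)) (Rbar_locally p_infty)
    (locally L).

Lemma is_avg_iff f L :
  is_avg f L <-> forall e, 0 < e -> exists A, 0 < A /\ forall t, A < t ->
    norm (minus (scal (/ t) (RInt f 0 t)) L) < e.
Proof.
  unfold is_avg. split.
  - intros H e Pe.
    destruct (proj1 (filterlim_norm_iff (Rbar_locally p_infty) _ L) H e Pe)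
      as [A HA].
    exists (Rmax 1 A). split; [pose proof (Rmax_l 1 A); lra|].
    intros t Ht. apply HA. pose proof (Rmax_r 1 A). lra.
  - intros H.
    apply (filterlim_norm_iff (Rbar_locally p_infty)
      (fun tau => scal (/ tau) (RInt f 0 tau)) L).
    intros e Pe. destruct (H e Pe) as [A HA]. exists A. exact (proj2 HA).
Qed.

Lemma time_average_is_avg f L : is_avg f L -> time_average f = L.
Proof.
  intros H. exact (iota_filterlim_locally _ L H).
Qed.

Lemma is_avg_unique f L L' : is_avg f L -> is_avg f L' -> L = L'.
Proof.
  intros H H'. apply time_average_is_avg in H, H'. now rewrite <- H, <- H'.
Qed.

Lemma is_avg_ext f g L :
  (forall t, 0 <= t -> f t = g t) -> is_avg f L -> is_avg g L.
Proof.
  intros E H. apply is_avg_iff. intros e Pe.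
  destruct (proj1 (is_avg_iff f L) H e Pe) as [A [PA HA]].
  exists A. split; [exact PA|]. intros t Ht.
  rewrite <- (RInt_ext_nonneg f g t ltac:(lra) E). now apply HA.
Qed.

Lemma is_avg_plus f g L M :
  continuous_on Rnonneg f -> continuous_on Rnonneg g ->
  is_avg f L -> is_avg g M -> is_avg (fun t => plus (f t) (g t)) (plus L M).
Proof.
  intros Cf Cg Hf Hg. apply is_avg_iff. intros e Pe.
  destruct (proj1 (is_avg_iff f L) Hf (e / 2) ltac:(lra)) as [A [PA HA]].
  destruct (proj1 (is_avg_iff g M) Hg (e / 2) ltac:(lra)) as [A' [PA' HA']].
  exists (Rmax A A'). split; [pose proof (Rmax_l A A'); lra|].
  intros t Ht. specialize (HA t (Rle_lt_trans _ _ _ (Rmax_l _ _) Ht)).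
  specialize (HA' t (Rle_lt_trans _ _ _ (Rmax_r _ _) Ht)).
  pose proof (Rmax_l A A').
  rewrite RInt_plus_nonneg by (auto; lra).
  norm_replace (plus (minus (scal (/ t) (RInt f 0 t)) L)
    (minus (scal (/ t) (RInt g 0 t)) M)); [|module].
  refine (Rle_lt_trans _ _ _ (norm_triangle _ _) _). lra.
Qed.

Lemma is_avg_scal (k : R) f L :
  continuous_on Rnonneg f -> is_avg f L ->
  is_avg (fun t => scal k (f t)) (scal k L).
Proof.
  intros Cf Hf. apply is_avg_iff. intros e Pe. pose proof (Rabs_pos k).
  destruct (proj1 (is_avg_iff f L) Hf (e / (Rabs k + 1))
    ltac:(apply Rdiv_lt_0_compat; lra)) as [A [PA HA]].
  exists A. split; [exact PA|]. intros t Ht. specialize (HA t Ht).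
  rewrite RInt_scal_nonneg by (auto; lra).
  norm_replace (scal k (minus (scal (/ t) (RInt f 0 t)) L)); [|module].
  refine (Rle_lt_trans _ _ _ (norm_scal _ _) _).
  change (abs k) with (Rabs k).
  apply (Rmult_lt_compat_r (Rabs k + 1)) in HA; [|lra].
  replace (e / (Rabs k + 1) * (Rabs k + 1)) with e in HA by (field; lra).
  pose proof (norm_ge_0 (minus (scal (/ t) (RInt f 0 t)) L)). nra.
Qed.

Lemma is_avg_minus f g L M :
  continuous_on Rnonneg f -> continuous_on Rnonneg g ->
  is_avg f L -> is_avg g M -> is_avg (fun t => minus (f t) (g t)) (minus L M).
Proof.
  intros Cf Cg Hf Hg.
  apply (is_avg_ext (fun t => plus (f t) (scal (-1) (g t)))).
  - intros t _. module.
  - replace (minus L M) with (plus L (scal (-1) M)) by module.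
    apply is_avg_plus; auto using continuous_on_scal, is_avg_scal.
Qed.

(** A bounded F contributes at most 2 N / t to the mean over [0, t]. The averages of modes, of flat
    maps and of constants all come from this. *)
Lemma is_avg_primitive f (F : R -> V) (L : V) (N : R) :
  (forall t, 0 <= t ->
     RInt f 0 t = plus (minus (F t) (F 0)) (scal t L)) ->
  (forall t, 0 <= t -> norm (F t) <= N) -> is_avg f L.
Proof.
  intros HF HN. apply is_avg_iff. intros e Pe.
  assert (PN : 0 <= N) by (refine (Rle_trans _ _ _ (norm_ge_0 _) (HN 0 _)); lra).
  (* Beyond this time 2 N / t < e; the added 1 keeps the threshold positive when N = 0. *)
  exists ((2 * N + 1) / e). split; [apply Rdiv_lt_0_compat; lra|].
  intros t Ht.
  assert (Pt : 0 < t).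
  { refine (Rlt_trans _ _ _ _ Ht). apply Rdiv_lt_0_compat; lra. }
  rewrite HF by lra.
  norm_replace (scal (/ t) (minus (F t) (F 0))); [|module; field; lra].
  refine (Rle_lt_trans _ _ _ (norm_scal_le (/ t) (Rle_refl _)
    (norm_minus_le (HN t _) (HN 0 _))) _); [lra|lra|].
  rewrite Rabs_pos_eq by (left; now apply Rinv_0_lt_compat).
  apply Rmult_lt_reg_l with t; [exact Pt|].
  rewrite <- Rmult_assoc, Rinv_r, Rmult_1_l by lra.
  apply (Rmult_lt_compat_r e) in Ht; [|exact Pe].
  replace ((2 * N + 1) / e * e) with (2 * N + 1) in Ht by (field; lra). lra.
Qed.

Lemma is_avg_const (x : V) : is_avg (fun _ => x) x.
Proof.
  apply (is_avg_primitive _ (fun _ => zero) x 0).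
  - intros t Pt. rewrite RInt_const_nonneg. module.
  - intros t Pt. apply norm_zero_le; [module|]. lra.
Qed.

(** The mean of f - g is bounded by its supremum, so a zero average passes to uniform limits. This
    centers the sum of a series of centered primitives. *)
Lemma is_avg_zero_uniform f :
  continuous_on Rnonneg f ->
  (forall e, 0 < e -> exists g, continuous_on Rnonneg g /\ is_avg g zero /\
     forall t, 0 <= t -> norm (minus (f t) (g t)) <= e) ->
  is_avg f zero.
Proof.
  intros Cf H. apply is_avg_iff. intros e Pe.
  destruct (H (e / 2) ltac:(lra)) as [g [Cg [Hg Hfg]]].
  destruct (proj1 (is_avg_iff g _) Hg (e / 2) ltac:(lra)) as [A [PA HA]].
  exists A. split; [exact PA|]. intros t Ht. specialize (HA t Ht).
  norm_replace
    (plus (scal (/ t) (minus (RInt f 0 t) (RInt g 0 t)))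
          (minus (scal (/ t) (RInt g 0 t)) zero)); [|module].
  refine (Rle_lt_trans _ _ _ (norm_plus_le (a := e / 2) _ (Rle_refl _)) _);
    [|now apply (Rplus_lt_compat_l (e / 2)) in HA;
      refine (Rlt_le_trans _ _ _ HA _); lra].
  rewrite <- RInt_minus_fun_nonneg by (auto; lra).
  refine (Rle_trans _ _ _ (norm_scal_le (/ t) (Rle_refl _)
    (norm_RInt_le_nonneg _ (e / 2) 0 t _ _ _)) _).
  - now apply continuous_on_minus.
  - lra.
  - intros s Hs. apply Hfg. lra.
  - rewrite Rabs_pos_eq by (left; apply Rinv_0_lt_compat; lra). right. field. lra.
Qed.

End IntegralsOnHalfLine.

Section LinearMaps.
Context {V W : CompleteNormedModule R_AbsRing} (i : V -> W) (Hi : is_linear i).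

Lemma is_derive_on_linear (f : R -> V) t l :
  0 <= t -> is_derive_on Rnonneg f t l ->
  is_derive_on Rnonneg (fun s => i (f s)) t (i l).
Proof.
  intros Pt H. apply is_derive_on_iff; [exact Pt|]. intros e Pe.
  destruct (linear_norm i Hi) as [M [PM HM]].
  destruct (proj1 (is_derive_on_iff f t l Pt) H (e / M)
    ltac:(apply Rdiv_lt_0_compat; lra)) as [d [Pd Hd]].
  exists d. split; [exact Pd|]. intros s Ps Hs. specialize (Hd s Ps Hs).
  norm_replace (i (minus (minus (f s) (f t)) (scal (s - t) l))).
  - refine (Rle_trans _ _ _ (HM _) _).
    apply (Rmult_le_compat_l M) in Hd; [|lra].
    refine (Rle_trans _ _ _ Hd _). right. field. lra.
  - refine (eq_trans (linear_minus i _ _ Hi) _).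
    exact (f_equal2 minus (linear_minus i _ _ Hi) (linear_scal i Hi _ _)).
Qed.

Lemma continuous_on_linear (f : R -> V) :
  continuous_on Rnonneg f -> continuous_on Rnonneg (fun t => i (f t)).
Proof.
  intros Hf t Pt.
  exact (filterlim_comp _ _ _ _ _ _ _ _ (Hf t Pt) (linear_cont i (f t) Hi)).
Qed.

(** Both sides vanish at t = 0 and have derivative i(f(t)), so Riemann sums are avoided. *)
Lemma RInt_linear (f : R -> V) t :
  continuous_on Rnonneg f -> 0 <= t -> RInt (fun s => i (f s)) 0 t = i (RInt f 0 t).
Proof.
  intros Hf Pt.
  rewrite (RInt_derive_on (fun s => i (RInt f 0 s)) (fun s => i (f s)) t).
  - rewrite RInt_point. refine (eq_trans (f_equal (minus _) (linear_zero i Hi)) _).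
    exact (minus_zero_r _).
  - intros s Ps. apply is_derive_on_linear; [exact Ps|].
    now apply is_derive_on_RInt.
  - now apply continuous_on_linear.
  - exact Pt.
Qed.
End LinearMaps.

(** * Operators and complexification *)

Section EndAlgebra.
Context {X : Banach}.
Implicit Types A B : End X.

Lemma norm_End_comp A B : norm (End_comp A B) <= norm A * norm B.
Proof.
  apply op_norm_le.
  - apply Rmult_le_pos; apply op_norm_ge_0.
  - intros x. simpl.
    refine (Rle_trans _ _ _ (op_norm_apply X A (B x)) _).
    rewrite Rmult_assoc. apply Rmult_le_compat_l; [apply op_norm_ge_0|].
    apply op_norm_apply.
Qed.

Lemma bilinear_End_comp :
  bilinear_le1 (U := End_NormedModule X) (V := End_NormedModule X)
    (W := End_NormedModule X) (@End_comp X).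
Proof.
  split.
  - intros A A' B. apply End_ext. reflexivity.
  - intros A B B'. apply End_ext. intros x.
    exact (linear_plus _ (bounded_linear_R X A (End_linear A)) (B x) (B' x)).
  - intros k A B. apply End_ext. reflexivity.
  - intros k A B. apply End_ext. intros x.
    exact (linear_scal _ (bounded_linear_R X A (End_linear A)) k (B x)).
  - exact norm_End_comp.
Qed.

Lemma bilinear_End_apply :
  bilinear_le1 (U := End_NormedModule X) (V := X) (W := X) (@End_fun X).
Proof.
  split.
  - reflexivity.
  - intros A. exact (linear_plus _ (bounded_linear_R X A (End_linear A))).
  - reflexivity.
  - intros k A. exact (linear_scal _ (bounded_linear_R X A (End_linear A)) k).
  - exact (op_norm_apply X).
Qed.

Lemma End_comp_assoc A B (C : End X) :
  End_comp A (End_comp B C) = End_comp (End_comp A B) C.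
Proof. now apply End_ext. Qed.

Lemma End_comp_id_l A : End_comp End_id A = A.
Proof. now apply End_ext. Qed.

Lemma End_comp_id_r A : End_comp A End_id = A.
Proof. now apply End_ext. Qed.

Lemma norm_End_id : norm (End_id (X := X)) <= 1.
Proof. apply op_norm_le; [lra|]. intros x. simpl. lra. Qed.

Lemma is_linear_End_comp_l A :
  is_linear (U := End_NormedModule X) (V := End_NormedModule X) (End_comp A).
Proof.
  split.
  - exact (bil_plus_r _ bilinear_End_comp A).
  - exact (fun k => bil_scal_r _ bilinear_End_comp k A).
  - exists (norm A + 1). split; [pose proof (op_norm_ge_0 X A) as P|].
    + change (0 < op_norm A + 1). lra.
    + intros B. refine (Rle_trans _ _ _ (norm_End_comp A B) _).
      apply Rmult_le_compat_r; [apply norm_ge_0|lra].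
Qed.

Lemma is_linear_End_comp_r B :
  is_linear (U := End_NormedModule X) (V := End_NormedModule X)
    (fun A => End_comp A B).
Proof.
  split.
  - exact (fun A A' => bil_plus_l _ bilinear_End_comp A A' B).
  - exact (fun k A => bil_scal_l _ bilinear_End_comp k A B).
  - exists (norm B + 1). split; [pose proof (op_norm_ge_0 X B) as P|].
    + change (0 < op_norm B + 1). lra.
    + intros A. refine (Rle_trans _ _ _ (norm_End_comp A B) _).
      rewrite Rmult_comm. apply Rmult_le_compat_r; [apply norm_ge_0|lra].
Qed.
End EndAlgebra.

(** * Complex multiples of operators and the exponentials e^(it) *)

Section ComplexScalars.
Context {Z : CompleteNormedModule C_AbsRing}.
Implicit Types A B : End (ComplexBanach Z).

Lemma End_Cscal_comp_l (z : C) A B :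
  End_comp (End_Cscal z A) B = End_Cscal z (End_comp A B).
Proof. now apply End_ext. Qed.

Lemma End_Cscal_comp_r (z : C) A B :
  End_comp A (End_Cscal z B) = End_Cscal z (End_comp A B).
Proof. apply End_ext. intros x. exact (linear_scal _ (End_linear A) z (B x)). Qed.

Lemma End_Cscal_assoc (z w : C) A :
  End_Cscal z (End_Cscal w A) = End_Cscal (z * w)%C A.
Proof.
  apply End_ext. intros x.
  exact (scal_assoc (K := C_Ring) (V := Z) z w (A x)).
Qed.

Lemma End_Cscal_plus_r (z : C) A B :
  End_Cscal z (plus A B) = plus (End_Cscal z A) (End_Cscal z B).
Proof.
  apply End_ext. intros x.
  exact (scal_distr_l (K := C_Ring) (V := Z) z (A x) (B x)).
Qed.

Lemma End_Cscal_plus_l (z w : C) A :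
  End_Cscal (z + w)%C A = plus (End_Cscal z A) (End_Cscal w A).
Proof.
  apply End_ext. intros x.
  exact (scal_distr_r (K := C_Ring) (V := Z) z w (A x)).
Qed.

Lemma End_Cscal_real (k : R) A : End_Cscal (RtoC k) A = scal k A.
Proof. now apply End_ext. Qed.

Lemma End_Cscal_one A : End_Cscal (RtoC 1) A = A.
Proof. apply End_ext. intros x. exact (scal_one (A x)). Qed.

Lemma End_Cscal_scal (z : C) (k : R) A :
  End_Cscal z (scal k A) = scal k (End_Cscal z A).
Proof.
  rewrite <- !End_Cscal_real, !End_Cscal_assoc. now rewrite Cmult_comm.
Qed.

Lemma norm_End_Cscal (z : C) A : norm (End_Cscal z A) <= Cmod z * norm A.
Proof.
  apply op_norm_le.
  - apply Rmult_le_pos; [apply Cmod_ge_0|apply op_norm_ge_0].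
  - intros x.
    refine (Rle_trans _ _ _ (norm_scal (K := C_AbsRing) (V := Z) z (A x)) _).
    rewrite Rmult_assoc. apply Rmult_le_compat_l; [apply Cmod_ge_0|].
    exact (op_norm_apply _ A x).
Qed.

Lemma is_linear_End_Cscal (z : C) :
  is_linear (U := End_NormedModule (ComplexBanach Z))
    (V := End_NormedModule (ComplexBanach Z)) (End_Cscal z).
Proof.
  split.
  - apply End_Cscal_plus_r.
  - apply End_Cscal_scal.
  - exists (Cmod z + 1). split; [pose proof (Cmod_ge_0 z); lra|].
    intros A. refine (Rle_trans _ _ _ (norm_End_Cscal z A) _).
    apply Rmult_le_compat_r; [apply norm_ge_0|lra].
Qed.

Definition cis (t : R) : C := (cos t, sin t).

Lemma cis_plus (s t : R) : cis (s + t) = (cis s * cis t)%C.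
Proof.
  unfold cis, Cmult. simpl. rewrite cos_plus, sin_plus. f_equal; ring.
Qed.

Lemma cis_0 : cis 0 = RtoC 1.
Proof. unfold cis. now rewrite cos_0, sin_0. Qed.

Lemma Cmod_cis (t : R) : Cmod (cis t) = 1.
Proof.
  unfold Cmod, cis. simpl. refine (eq_trans (f_equal sqrt _) sqrt_1).
  pose proof (sin2_cos2 t) as H. unfold Rsqr in H. lra.
Qed.

Lemma norm_End_cis (t : R) A : norm (End_Cscal (cis t) A) <= norm A.
Proof.
  refine (Rle_trans _ _ _ (norm_End_Cscal _ A) _). rewrite Cmod_cis. lra.
Qed.

(** Over the underlying real space, t -> e^(it) A becomes a combination of the fixed operators A and
    iA with coefficients cos t and sin t, which reduces its calculus to real functions. *)
Lemma End_cis_decomp (t : R) A :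
  End_Cscal (cis t) A = plus (scal (cos t) A) (scal (sin t) (End_Cscal Ci A)).
Proof.
  rewrite <- End_Cscal_real, <- (End_Cscal_real (sin t)), End_Cscal_assoc,
    <- End_Cscal_plus_l.
  f_equal. unfold cis, Ci, RtoC, Cmult, Cplus. simpl. f_equal; ring.
Qed.

Lemma is_derive_End_cis (k t : R) A :
  is_derive (fun s => End_Cscal (cis (k * s)) A) t
    (End_Cscal (0, k)%C (End_Cscal (cis (k * t)) A)).
Proof.
  apply (is_derive_ext (fun s => plus (scal (cos (k * s)) A)
                                   (scal (sin (k * s)) (End_Cscal Ci A)))).
  { intros s. symmetry. apply End_cis_decomp. }
  assert (E : End_Cscal (0, k)%C (End_Cscal (cis (k * t)) A)
    = plus (scal (- k * sin (k * t)) A) (scal (k * cos (k * t)) (End_Cscal Ci A))).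
  { rewrite End_Cscal_assoc, <- End_Cscal_real,
      <- (End_Cscal_real (k * cos (k * t))), End_Cscal_assoc, <- End_Cscal_plus_l.
    f_equal. unfold cis, Ci, RtoC, Cmult, Cplus. simpl. f_equal; ring. }
  rewrite E. clear E.
  apply (is_derive_plus (V := End_NormedModule (ComplexBanach Z))).
  - apply (is_derive_scal_l (V := End_NormedModule (ComplexBanach Z))
      (fun s => cos (k * s)) t (- k * sin (k * t)) A).
    auto_derive; [exact I|ring].
  - apply (is_derive_scal_l (V := End_NormedModule (ComplexBanach Z))
      (fun s => sin (k * s)) t (k * cos (k * t)) (End_Cscal Ci A)).
    auto_derive; [exact I|ring].
Qed.

(** The factor 2 comes from treating cos and sin separately by the mean value theorem; all that
    matters later is a Lipschitz bound. *)
Lemma norm_End_cis_minus_le (s t : R) A :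
  norm (minus (End_Cscal (cis s) A) (End_Cscal (cis t) A))
    <= 2 * Rabs (s - t) * norm A.
Proof.
  assert (lip : forall f df : R -> R, (forall u, is_derive f u (df u)) ->
    (forall u, Rabs (df u) <= 1) -> Rabs (f s - f t) <= Rabs (s - t)).
  { intros f df Hf Hdf.
    destruct (MVT_gen f t s df) as [u [_ Eu]].
    - intros; apply Hf.
    - intros u _. apply (continuity_pt_filterlim f u).
      apply (ex_derive_continuous (V := R_NormedModule) f).
      eexists; apply Hf.
    - rewrite Eu, Rabs_mult. pose proof (Hdf u). pose proof (Rabs_pos (s - t)). nra. }
  rewrite !End_cis_decomp.
  norm_replace (plus (scal (cos s - cos t) A)
    (scal (sin s - sin t) (End_Cscal Ci A))); [|module].
  assert (Hi : norm (End_Cscal Ci A) <= norm A).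
  { replace Ci with (cis (PI / 2)); [apply norm_End_cis|].
    unfold cis. now rewrite cos_PI2, sin_PI2. }
  refine (Rle_trans _ _ _ (norm_plus_le (norm_scal_le _ _ (Rle_refl _))
    (norm_scal_le _ _ Hi)) _).
  - apply (lip cos (fun u => - sin u)); [apply is_derive_cos|].
    intros u. rewrite Rabs_Ropp. apply Rabs_le, SIN_bound.
  - apply (lip sin cos); [apply is_derive_sin|].
    intros u. apply Rabs_le, COS_bound.
  - right. ring.
Qed.
End ComplexScalars.

(** * Complexification of operators *)

Section ComplexifiedOperators.
Context {X : Banach}.
Implicit Types A B : End X.

Lemma End_cplx_plus A B : End_cplx (plus A B) = plus (End_cplx A) (End_cplx B).
Proof. destruct X as [Y|Y]; now apply End_ext. Qed.

Lemma End_cplx_scal (k : R) A : End_cplx (scal k A) = scal k (End_cplx A).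
Proof.
  destruct X as [Y|Y]; apply End_ext; [|reflexivity]. intros p.
  refine (eq_trans _ (eq_sym (cplx_scalE Y (RtoC k) (A (fst p), A (snd p))))).
  simpl. unfold cplx_fun. simpl. f_equal.
  - assert (E : scal (- 0 : R_Ring) (A (snd p)) = zero)
      by (rewrite Ropp_0; exact (scal_zero_l _)).
    refine (eq_trans (eq_sym (plus_zero_r _)) _).
    exact (f_equal (plus _) (eq_sym E)).
  - refine (eq_trans (eq_sym (plus_zero_l _)) _).
    refine (f_equal (fun x => plus x _) _). exact (eq_sym (scal_zero_l _)).
Qed.

Lemma End_cplx_comp A B :
  End_cplx (End_comp A B) = End_comp (End_cplx A) (End_cplx B).
Proof. destruct X as [Y|Y]; now apply End_ext. Qed.

(** In the real case the Taylor norm makes this work: the real part of a rotation of A p is A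
    applied to that of the same rotation of p. Conversely, one restricts to the vectors (x, 0),
    whose Taylor norm is at most |x|. *)
Lemma norm_End_cplx A : norm (End_cplx A) = norm A.
Proof.
  destruct X as [Y|Y]; [|reflexivity]. apply Rle_antisym.
  - apply op_norm_le; [apply op_norm_ge_0|]. intros p.
    apply taylor_norm_lub. intros theta. simpl.
    pose proof (End_linear A) as L.
    refine (Rle_trans _ _ _ (Req_le _ _ (f_equal norm (eq_sym _)))
      (Rle_trans _ _ _ (op_norm_apply (RealBanach Y) A
         (plus (scal (cos theta) (fst p)) (scal (sin theta) (snd p)))) _)).
    + refine (eq_trans (linear_plus _ L _ _) _).
      exact (f_equal2 plus (linear_scal _ L _ _) (linear_scal _ L _ _)).
    + apply Rmult_le_compat_l; [apply op_norm_ge_0|]. apply taylor_norm_ub.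
  - apply op_norm_le; [apply op_norm_ge_0|]. intros x.
    refine (Rle_trans _ _ _ (taylor_norm_fst Y (A x, A zero)) _).
    refine (Rle_trans _ _ _ (op_norm_apply _ (End_cplx A) (x, zero)) _).
    apply Rmult_le_compat_l; [apply op_norm_ge_0|].
    apply taylor_norm_lub. intros theta. simpl.
    refine (Rle_trans _ _ _ (Req_le _ _ (f_equal norm (y := scal (cos theta) x) _)) _).
    + refine (eq_trans (f_equal (plus _) (scal_zero_r _)) _). apply plus_zero_r.
    + refine (Rle_trans _ _ _ (norm_scal _ _) _).
      pose proof (COS_bound theta) as [H1 H2].
      assert (abs (K := R_AbsRing) (cos theta) <= 1) by (apply Rabs_le; lra).
      refine (Rle_trans _ _ _ (Rmult_le_compat_r _ _ _ (norm_ge_0 x) H) _).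
      right. apply Rmult_1_l.
Qed.

Lemma is_linear_End_cplx :
  is_linear (U := End_NormedModule X)
    (V := End_NormedModule (ComplexBanach (cplx_space X))) End_cplx.
Proof.
  split; [exact End_cplx_plus|exact End_cplx_scal|].
  exists 1. split; [lra|]. intros A. rewrite norm_End_cplx. lra.
Qed.

Lemma End_cplx_minus A B : End_cplx (minus A B) = minus (End_cplx A) (End_cplx B).
Proof. exact (linear_minus End_cplx A B is_linear_End_cplx). Qed.
End ComplexifiedOperators.

(** * Absolutely convergent quasi-periodic maps *)

Lemma choice_function {A B : Type} (P : A -> B -> Prop) :
  (forall x, exists y, P x y) -> exists f, forall x, P x (f x).
Proof.
  intros H. exists (fun x => proj1_sig (constructive_indefinite_description _ (H x))).
  intros x. apply proj2_sig.
Qed.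

(** * Series dominated by a convergent majorant *)

Section DominatedSeries.
Context {V : CompleteNormedModule R_AbsRing}.

Lemma is_series_norm_iff (v_ : nat -> V) (v : V) :
  is_series v_ v <->
  forall e, 0 < e -> exists m0, forall m, (m0 <= m)%nat ->
    norm (minus (sum_n v_ m) v) < e.
Proof.
  split.
  - intros H e Pe. exact (proj1 (filterlim_norm_iff eventually _ v) H e Pe).
  - intros H. apply (filterlim_norm_iff eventually (sum_n v_) v). exact H.
Qed.

Lemma sum_n_diff_le (v_ : nat -> V) (N_ : nat -> R) (m M : nat) :
  (forall j, norm (v_ j) <= N_ j) -> (m <= M)%nat ->
  norm (minus (sum_n v_ M) (sum_n v_ m)) <= sum_n N_ M - sum_n N_ m.
Proof.
  intros H. induction 1 as [|M HM IH].
  - apply norm_zero_le; [module|lra].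
  - rewrite !sum_Sn.
    norm_replace (plus (minus (sum_n v_ M) (sum_n v_ m)) (v_ (S M))); [|module].
    change (plus (sum_n N_ M) (N_ (S M))) with (sum_n N_ M + N_ (S M)).
    refine (Rle_trans _ _ _ (norm_plus_le IH (H (S M))) _). lra.
Qed.

Lemma norm_sum_n_le (v_ : nat -> V) (N_ : nat -> R) (m : nat) :
  (forall j, norm (v_ j) <= N_ j) -> norm (sum_n v_ m) <= sum_n N_ m.
Proof.
  intros H. induction m as [|m IH]; [rewrite !sum_O; apply H|].
  rewrite !sum_Sn. exact (norm_plus_le IH (H (S m))).
Qed.

Context (N_ : nat -> R) (N : R) (PN : forall j, 0 <= N_ j)
  (HN : forall m, sum_n N_ m <= N).

Lemma ex_series_bounded : ex_series N_.
Proof.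
  assert (E : ex_finite_lim_seq (sum_n N_)).
  { apply (ex_finite_lim_seq_incr _ N); [|exact HN]. intros m.
    rewrite sum_Sn. pose proof (PN (S m)).
    change (sum_n N_ m <= sum_n N_ m + N_ (S m)). lra. }
  destruct E as [l Hl]. exists l. exact Hl.
Qed.

Lemma ex_series_dominated (v_ : nat -> V) :
  (forall j, norm (v_ j) <= N_ j) -> exists v, is_series v_ v.
Proof. intros H. exact (ex_series_le v_ N_ H ex_series_bounded). Qed.

(* The rank [m0] depends on the majorant only, so that the convergence is
   uniform with respect to parameters. *)
Lemma dominated_series_tail (e : R) :
  0 < e -> exists m0, forall m, (m0 <= m)%nat ->
  forall (v_ : nat -> V) (v : V), (forall j, norm (v_ j) <= N_ j) ->
    is_series v_ v -> norm (minus v (sum_n v_ m)) <= e.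
Proof.
  intros Pe. destruct ex_series_bounded as [l Hl].
  destruct (proj1 (filterlim_norm_iff eventually _ l) Hl e Pe) as [m0 Hm0].
  exists m0. intros m Hm v_ v Hv Sv. apply le_epsilon. intros d Pd.
  destruct (proj1 (is_series_norm_iff v_ v) Sv d Pd) as [m1 Hm1].
  specialize (Hm1 (Nat.max m m1) ltac:(lia)).
  specialize (Hm0 m Hm).
  change (norm (minus (sum_n N_ m) l)) with (Rabs (sum_n N_ m - l)) in Hm0.
  assert (Hl' : sum_n N_ (Nat.max m m1) <= l).
  { apply (is_lim_seq_incr_compare (sum_n N_)); [exact Hl|].
    intros k. rewrite sum_Sn. pose proof (PN (S k)).
    change (sum_n N_ k <= sum_n N_ k + N_ (S k)). lra. }
  norm_replace (plus (minus (sum_n v_ (Nat.max m m1)) (sum_n v_ m))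
    (opp (minus (sum_n v_ (Nat.max m m1)) v))); [|module].
  refine (norm_plus_le _ _).
  - refine (Rle_trans _ _ _ (sum_n_diff_le v_ N_ m _ Hv _) _); [lia|].
    unfold Rabs in Hm0. destruct Rcase_abs; lra.
  - refine (Rle_trans _ _ _ (Req_le _ _ (norm_opp _)) (Rlt_le _ _ Hm1)).
Qed.

Lemma norm_dominated_series (v_ : nat -> V) (v : V) :
  (forall j, norm (v_ j) <= N_ j) -> is_series v_ v -> norm v <= N.
Proof.
  intros Hv Sv. apply le_epsilon. intros e Pe.
  destruct (dominated_series_tail e Pe) as [m Hm].
  specialize (Hm m (le_n m) v_ v Hv Sv).
  replace v with (plus (sum_n v_ m) (minus v (sum_n v_ m))) by module.
  refine (norm_plus_le _ Hm).
  exact (Rle_trans _ _ _ (norm_sum_n_le v_ N_ m Hv) (HN m)).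
Qed.
End DominatedSeries.

Lemma is_series_linear {V W : CompleteNormedModule R_AbsRing} (i : V -> W)
    (v_ : nat -> V) (v : V) :
  is_linear i -> is_series v_ v -> is_series (fun j => i (v_ j)) (i v).
Proof.
  intros Hi Hv.
  apply (filterlim_ext (fun m => i (sum_n v_ m))).
  - induction x as [|m IH]; [now rewrite !sum_O|].
    rewrite !sum_Sn, <- IH. exact (linear_plus i Hi _ _).
  - exact (filterlim_comp _ _ _ _ _ _ _ _ Hv (linear_cont i v Hi)).
Qed.

(** Presents a sum of two terms as a series, so that closure of the class under series contains
    closure under addition. *)
Lemma is_series_two {V : CompleteNormedModule R_AbsRing} (x y : V) :
  is_series (fun j => match j with O => x | S O => y | _ => zero end) (plus x y).
Proof.
  apply is_series_norm_iff. intros e Pe. exists 1%nat. intros m Hm.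
  match goal with |- norm (minus (sum_n ?v _) _) < _ => set (v_ := v) end.
  assert (E : sum_n v_ m = plus x y).
  { induction Hm as [|m Hm IH].
    - now rewrite sum_Sn, sum_O.
    - rewrite sum_Sn, IH. destruct m; [lia|]. apply plus_zero_r. }
  refine (Rle_lt_trans _ _ _ (norm_zero_le _ 0 _ (Rle_refl 0)) Pe).
  refine (eq_trans (f_equal (fun z => minus z (plus x y)) E) _). module.
Qed.

Lemma exp_le (x y : R) : x <= y -> exp x <= exp y.
Proof.
  intros [H| ->]; [left; now apply exp_increasing|apply Rle_refl].
Qed.

(** * Finite sums and integer frequency vectors *)

Lemma fin_sum_ge_0 {r : nat} (x : Fin.t r -> R) :
  (forall i, 0 <= x i) -> 0 <= fin_sum x.
Proof.
  induction r as [|r IH]; intros H; simpl; [lra|].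
  specialize (IH (fun i => x (Fin.FS i)) (fun i => H _)).
  pose proof (H Fin.F1). lra.
Qed.

Lemma fin_sum_le {r : nat} (x y : Fin.t r -> R) :
  (forall i, x i <= y i) -> fin_sum x <= fin_sum y.
Proof.
  induction r as [|r IH]; intros H; simpl; [lra|].
  specialize (IH (fun i => x (Fin.FS i)) (fun i => y (Fin.FS i)) (fun i => H _)).
  pose proof (H Fin.F1). lra.
Qed.

Lemma fin_sum_plus {r : nat} (x y : Fin.t r -> R) :
  fin_sum (fun i => x i + y i) = fin_sum x + fin_sum y.
Proof.
  induction r as [|r IH]; simpl; [ring|].
  rewrite (IH (fun i => x (Fin.FS i)) (fun i => y (Fin.FS i))). ring.
Qed.

Lemma fin_sum_scal {r : nat} (k : R) (x : Fin.t r -> R) :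
  fin_sum (fun i => k * x i) = k * fin_sum x.
Proof.
  induction r as [|r IH]; simpl; [ring|].
  rewrite (IH (fun i => x (Fin.FS i))). ring.
Qed.

Lemma fin_sum_ext {r : nat} (x y : Fin.t r -> R) :
  (forall i, x i = y i) -> fin_sum x = fin_sum y.
Proof. intros H. f_equal. now apply functional_extensionality. Qed.

Lemma fin_sum_zero (r : nat) : fin_sum (fun _ : Fin.t r => 0) = 0.
Proof. induction r as [|r IH]; simpl; [reflexivity|]. rewrite IH. ring. Qed.

Lemma Zlength1_ge_0 {r : nat} (alpha : Fin.t r -> Z) : 0 <= Zlength1 alpha.
Proof. apply fin_sum_ge_0. intros i. apply IZR_le. lia. Qed.

Lemma Zlength1_plus_le {r : nat} (alpha beta : Fin.t r -> Z) :
  Zlength1 (fun i => (alpha i + beta i)%Z) <= Zlength1 alpha + Zlength1 beta.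
Proof.
  unfold Zlength1. rewrite <- fin_sum_plus. apply fin_sum_le. intros i.
  rewrite <- plus_IZR. apply IZR_le. lia.
Qed.

Lemma Zdot_plus {r : nat} (alpha beta : Fin.t r -> Z) (theta : Fin.t r -> R) :
  Zdot (fun i => (alpha i + beta i)%Z) theta
  = Zdot alpha theta + Zdot beta theta.
Proof.
  unfold Zdot. rewrite <- fin_sum_plus. apply fin_sum_ext. intros i.
  rewrite plus_IZR. ring.
Qed.

Lemma Zdot_zero {r : nat} (theta : Fin.t r -> R) :
  Zdot (fun _ => 0%Z) theta = 0.
Proof.
  unfold Zdot. rewrite (fin_sum_scal 0 theta). ring.
Qed.

Lemma Zdot_scal {r : nat} (alpha : Fin.t r -> Z) (theta : Fin.t r -> R) (k : R) :
  Zdot alpha (fun i => theta i * k) = Zdot alpha theta * k.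
Proof.
  unfold Zdot. rewrite Rmult_comm, <- fin_sum_scal. apply fin_sum_ext.
  intros i. ring.
Qed.

Lemma Zlength1_ge_1 {r : nat} (alpha : Fin.t r -> Z) :
  alpha <> (fun _ => 0%Z) -> 1 <= Zlength1 alpha.
Proof.
  intros H. apply Rnot_lt_le. intros L. apply H.
  apply functional_extensionality. clear H. revert L. unfold Zlength1.
  induction r as [|r IH]; intros L i; [now apply Fin.case0|].
  cbn [fin_sum] in L.
  pose proof (fin_sum_ge_0 (fun i => IZR (Z.abs (alpha (Fin.FS i))))
    ltac:(intros j; apply IZR_le; lia)) as P.
  assert (P0 : 0 <= IZR (Z.abs (alpha Fin.F1))) by (apply IZR_le; lia).
  assert (L' : fin_sum (fun i => IZR (Z.abs (alpha (Fin.FS i)))) < 1) by lra.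
  specialize (IH (fun i => alpha (Fin.FS i)) L').
  refine (Fin.caseS' i (fun i => alpha i = 0%Z) _ IH).
  assert (H : IZR (Z.abs (alpha Fin.F1)) < 1) by lra.
  apply lt_IZR in H. lia.
Qed.

(** * The algebra of absolutely convergent quasi-periodic maps *)

Section WienerClass.
Context {Z : CompleteNormedModule C_AbsRing} {r : nat} (omega : Fin.t r -> R).
Notation A := (End (ComplexBanach Z)).
Notation AN := (End_NormedModule (ComplexBanach Z)).
Notation AC := (End_CompleteNormedModule (ComplexBanach Z)).

(* [wiener kappa f N] says that f lies in E_kappa with norm at most N. Closing
   under series instead of recording Fourier coefficients spares unique
   decompositions, and products and primitives are handled by induction. *)
Inductive wiener (kappa : R) : (R -> A) -> R -> Prop :=
| wiener_mode (c : A) (alpha : Fin.t r -> BinInt.Z) (N : R) :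
    exp (kappa * Zlength1 alpha) * norm c <= N ->
    wiener kappa (fun t => End_Cscal (cis (Zdot alpha omega * t)) c) N
| wiener_flat (f : R -> A) (N : R) :
    continuous_on Rnonneg f -> (forall t, 0 <= t -> norm (f t) <= N * exp (- t)) ->
    wiener kappa f N
| wiener_series (f_ : nat -> R -> A) (N_ : nat -> R) (f : R -> A) (N : R) :
    (forall j, wiener kappa (f_ j) (N_ j)) -> (forall m, sum_n N_ m <= N) ->
    (forall t, 0 <= t -> is_series (fun j => f_ j t) (f t)) ->
    wiener kappa f N.

Lemma wiener_bound kappa f N :
  0 <= kappa -> wiener kappa f N ->
  0 <= N /\ forall t, 0 <= t -> norm (f t) <= N.
Proof.
  intros Pk. induction 1 as [c alpha N H|f N Cf H|f_ N_ f N _ IH HN Hf].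
  - assert (E : 1 <= exp (kappa * Zlength1 alpha)).
    { rewrite <- exp_0. apply exp_le.
      apply Rmult_le_pos; [exact Pk|apply Zlength1_ge_0]. }
    pose proof (norm_ge_0 c). split; [nra|].
    intros t _. refine (Rle_trans _ _ _ (norm_End_cis _ c) _). nra.
  - assert (PN : 0 <= N).
    { pose proof (H 0 (Rle_refl 0)) as H0. rewrite Ropp_0, exp_0 in H0.
      pose proof (norm_ge_0 (f 0)). lra. }
    split; [exact PN|]. intros t Pt. refine (Rle_trans _ _ _ (H t Pt) _).
    assert (exp (- t) <= 1) by (rewrite <- exp_0; apply exp_le; lra). nra.
  - split.
    + pose proof (HN 0%nat) as H0. rewrite sum_O in H0.
      pose proof (proj1 (IH 0%nat)). lra.
    + intros t Pt. apply (norm_dominated_series N_ N (fun j => proj1 (IH j)) HN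
        (fun j => f_ j t) (f t)); [|now apply Hf].
      intros j. now apply IH.
Qed.

Lemma continuous_on_mode (k : R) (c : A) :
  continuous_on Rnonneg (fun t => End_Cscal (cis (k * t)) c).
Proof.
  apply (continuous_on_of_continuous (V := AN)
    (fun t => End_Cscal (cis (k * t)) c)). intros t _.
  apply (ex_derive_continuous (V := AN)
    (fun t => End_Cscal (cis (k * t)) c)).
  eexists. apply is_derive_End_cis.
Qed.

Lemma continuous_on_uniform_limit {V : CompleteNormedModule R_AbsRing} (f : R -> V) :
  (forall e, 0 < e -> exists g, continuous_on Rnonneg g /\
     forall t, 0 <= t -> norm (minus (f t) (g t)) <= e) ->
  continuous_on Rnonneg f.
Proof.
  intros H. apply (continuous_on_iff f). intros t Pt e Pe.
  destruct (H (e / 4) ltac:(lra)) as [g [Cg Hg]].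
  destruct (proj1 (continuous_on_iff g) Cg t Pt (e / 4) ltac:(lra))
    as [d [Pd Hd]].
  exists d. split; [exact Pd|]. intros s Ps Hs.
  norm_replace (plus (minus (minus (f s) (g s)) (minus (f t) (g t)))
    (minus (g s) (g t))); [|module].
  refine (Rle_lt_trans _ _ _ (norm_plus_le (norm_minus_le (Hg s Ps) (Hg t Pt))
    (Rlt_le _ _ (Hd s Ps Hs))) _). lra.
Qed.

Lemma continuous_on_sum_n {V : CompleteNormedModule R_AbsRing}
    (f_ : nat -> R -> V) (m : nat) :
  (forall j, continuous_on Rnonneg (f_ j)) ->
  continuous_on Rnonneg (fun t => sum_n (fun j => f_ j t) m).
Proof.
  intros H. induction m as [|m IH].
  - apply (continuous_on_ext_nonneg (f_ 0%nat)); [|apply H].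
    intros t _. now rewrite sum_O.
  - apply (continuous_on_ext_nonneg
      (fun t => plus (sum_n (fun j => f_ j t) m) (f_ (S m) t))).
    + intros t _. now rewrite sum_Sn.
    + exact (continuous_on_plus (fun t => sum_n (fun j => f_ j t) m) (f_ (S m)) IH (H (S m))).
Qed.

Lemma wiener_continuous kappa f N :
  0 <= kappa -> wiener kappa f N -> continuous_on Rnonneg f.
Proof.
  intros Pk. induction 1 as [c alpha N H|f N Cf H|f_ N_ f N Wf IH HN Hf].
  - apply continuous_on_mode.
  - exact Cf.
  - assert (B : forall j, 0 <= N_ j /\ forall t, 0 <= t -> norm (f_ j t) <= N_ j)
      by (intros j; exact (wiener_bound kappa _ _ Pk (Wf j))).
    apply (continuous_on_uniform_limit f). intros e Pe.
    destruct (dominated_series_tail (V := AC)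
      N_ N (fun j => proj1 (B j)) HN e Pe) as [m Hm].
    exists (fun t => sum_n (fun j => f_ j t) m). split.
    + exact (continuous_on_sum_n (V := AC) f_ m IH).
    + intros t Pt. apply (Hm m (le_n m) (fun j => f_ j t)); [|now apply Hf].
      intros j. now apply B.
Qed.

Lemma wiener_zero kappa : wiener kappa (fun _ => zero) 0.
Proof.
  apply wiener_flat; [exact (continuous_on_cst (V := AC) zero)|].
  intros t Pt. apply norm_zero_le; [reflexivity|lra].
Qed.

Lemma wiener_plus kappa f g N M :
  0 <= kappa -> wiener kappa f N -> wiener kappa g M ->
  wiener kappa (fun t => plus (f t) (g t)) (N + M).
Proof.
  intros Pk Hf Hg.
  apply (wiener_series kappa
    (fun j => match j with O => f | S O => g | _ => fun _ => zero end)
    (fun j => match j with O => N | S O => M | _ => 0 end)).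
  - intros [|[|j]]; [exact Hf|exact Hg|apply wiener_zero].
  - pose proof (proj1 (wiener_bound _ _ _ Pk Hf)).
    pose proof (proj1 (wiener_bound _ _ _ Pk Hg)).
    assert (S1 : forall m, sum_n (fun j => match j with O => N | S O => M | _ => 0 end)
      (S m) = N + M).
    { induction m as [|m IHm]; [rewrite sum_Sn, sum_O; reflexivity|].
      rewrite sum_Sn, IHm. exact (Rplus_0_r _). }
    intros [|m]; [rewrite sum_O; lra|rewrite S1; lra].
  - intros t _.
    apply (is_series_ext (fun j => match j with O => f t | S O => g t | _ => zero end)).
    + now intros [|[|j]].
    + apply (is_series_two (V := AC)).
Qed.

(** [wiener_series] constrains its sum only for t >= 0 and its partial sums of bounds only from
    above. A series with f as its only nonzero term therefore allows f to change at negative times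
    and N to grow. *)
Lemma wiener_ext_le kappa f g N M :
  0 <= kappa ->
  (forall t, 0 <= t -> f t = g t) -> N <= M -> wiener kappa f N -> wiener kappa g M.
Proof.
  intros Pk E L Hf.
  apply (wiener_series kappa
    (fun j => match j with O => f | _ => fun _ => zero end)
    (fun j => match j with O => N | _ => 0 end)).
  - intros [|j]; [exact Hf|apply wiener_zero].
  - pose proof (proj1 (wiener_bound _ _ _ Pk Hf)).
    assert (S1 : forall m, sum_n (fun j => match j with O => N | _ => 0 end) m = N).
    { induction m as [|m IHm]; [apply sum_O|]. rewrite sum_Sn, IHm.
      exact (Rplus_0_r _). }
    intros m. rewrite S1. lra.
  - intros t Pt.
    apply (is_series_ext (fun j => match j with O => f t | S O => zero | _ => zero end)).
    + now intros [|[|j]].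
    + rewrite <- E by exact Pt.
      exact (eq_rect _ (is_series (V := AC) _)
        (is_series_two (V := AC) (f t) zero) _ (plus_zero_r (f t : AC))).
Qed.

Lemma wiener_const kappa (c : A) N :
  0 <= kappa -> norm c <= N -> wiener kappa (fun _ => c) N.
Proof.
  intros Pk H.
  apply (wiener_ext_le kappa (fun t => End_Cscal (cis (Zdot (fun _ => 0%Z) omega * t)) c)
    _ N); [exact Pk| |apply Rle_refl|].
  - intros t _. rewrite Zdot_zero, Rmult_0_l, cis_0. apply End_Cscal_one.
  - apply wiener_mode. unfold Zlength1. simpl.
    rewrite fin_sum_zero, Rmult_0_r, exp_0. lra.
Qed.

Lemma wiener_weaken kappa kappa' f N :
  0 <= kappa' <= kappa -> wiener kappa f N -> wiener kappa' f N.
Proof.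
  intros Hk. induction 1 as [c alpha N H|f N Cf H|f_ N_ f N _ IH HN Hf].
  - apply wiener_mode. refine (Rle_trans _ _ _ _ H).
    apply Rmult_le_compat_r; [apply norm_ge_0|]. apply exp_le.
    apply Rmult_le_compat_r; [apply Zlength1_ge_0|lra].
  - now apply wiener_flat.
  - now apply (wiener_series kappa' f_ N_).
Qed.

(** Frequencies of modes add up, and |alpha + beta| <= |alpha| + |beta| makes the exponential
    weights submultiplicative. A mode is bounded, so it preserves the decay of a flat map. *)
Lemma wiener_mult_mode kappa (c : A) alpha (g : R -> A) M :
  0 <= kappa -> wiener kappa g M ->
  wiener kappa (fun t => End_comp (End_Cscal (cis (Zdot alpha omega * t)) c) (g t))
    (exp (kappa * Zlength1 alpha) * norm c * M).
Proof.
  intros Pk.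
  assert (E : 1 <= exp (kappa * Zlength1 alpha)).
  { rewrite <- exp_0. apply exp_le.
    apply Rmult_le_pos; [exact Pk|apply Zlength1_ge_0]. }
  pose proof (norm_ge_0 c) as Pc.
  set (K := exp (kappa * Zlength1 alpha) * norm c).
  assert (PK : 0 <= K) by (unfold K; nra).
  induction 1 as [d beta M H|g M Cg H|g_ M_ g M Wg IH HM Hg].
  - apply (wiener_ext_le kappa (fun t => End_Cscal
      (cis (Zdot (fun i => (alpha i + beta i)%Z) omega * t)) (End_comp c d)) _ (K * M));
      [exact Pk| |apply Rle_refl|].
    + intros t _. rewrite End_Cscal_comp_l, End_Cscal_comp_r, End_Cscal_assoc.
      rewrite Zdot_plus, Rmult_plus_distr_r, cis_plus. reflexivity.
    + apply wiener_mode.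
      refine (Rle_trans _ (exp (kappa * (Zlength1 alpha + Zlength1 beta))
        * (norm c * norm d)) _ _ _).
      * apply Rmult_le_compat; [left; apply exp_pos|apply norm_ge_0| |apply norm_End_comp].
        apply exp_le, Rmult_le_compat_l; [exact Pk|apply Zlength1_plus_le].
      * rewrite Rmult_plus_distr_l, exp_plus.
        replace (exp (kappa * Zlength1 alpha) * exp (kappa * Zlength1 beta)
          * (norm c * norm d)) with (K * (exp (kappa * Zlength1 beta) * norm d))
          by (unfold K; ring).
        now apply Rmult_le_compat_l.
  - apply wiener_flat.
    + exact (continuous_on_bilinear _ bilinear_End_comp _ _
        (continuous_on_mode _ c) Cg).
    + intros t Pt. refine (Rle_trans _ _ _ (norm_End_comp _ _) _).
      rewrite Rmult_assoc. apply Rmult_le_compat;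
        [apply norm_ge_0|apply norm_ge_0| |now apply H].
      refine (Rle_trans _ _ _ (norm_End_cis _ c) _). unfold K. nra.
  - apply (wiener_series kappa
      (fun j t => End_comp (End_Cscal (cis (Zdot alpha omega * t)) c) (g_ j t))
      (fun j => K * M_ j)).
    + exact IH.
    + intros m.
      refine (Rle_trans _ _ _ (Req_le _ _ (sum_n_mult_l (K := R_Ring) K M_ m)) _).
      now apply Rmult_le_compat_l.
    + intros t Pt. apply (is_series_linear
        (V := AC)
        (W := AC)
        (End_comp (End_Cscal (cis (Zdot alpha omega * t)) c))).
      * apply is_linear_End_comp_l.
      * now apply Hg.
Qed.

(** Only the left factor is decomposed: a mode is the previous case, and a flat factor absorbs the
    bounded map g whatever its structure. *)
Lemma wiener_mult kappa (f g : R -> A) N M :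
  0 <= kappa -> wiener kappa f N -> wiener kappa g M ->
  wiener kappa (fun t => End_comp (f t) (g t)) (N * M).
Proof.
  intros Pk Hf Hg.
  destruct (wiener_bound _ _ _ Pk Hg) as [PM Bg].
  induction Hf as [c alpha N H|f N Cf H|f_ N_ f N Wf IH HN Hf].
  - apply (wiener_ext_le kappa _ _ _ _ Pk (fun t _ => eq_refl)
      (Rmult_le_compat_r _ _ _ PM H)).
    now apply wiener_mult_mode.
  - apply wiener_flat.
    + exact (continuous_on_bilinear _ bilinear_End_comp _ _ Cf
        (wiener_continuous _ _ _ Pk Hg)).
    + intros t Pt. refine (Rle_trans _ _ _ (norm_End_comp _ _) _).
      replace (N * M * exp (- t)) with (N * exp (- t) * M) by ring.
      apply Rmult_le_compat; [apply norm_ge_0|apply norm_ge_0|now apply H|now apply Bg].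
  - apply (wiener_series kappa (fun j t => End_comp (f_ j t) (g t))
      (fun j => N_ j * M)).
    + exact IH.
    + intros m.
      refine (Rle_trans _ _ _ (Req_le _ _ (sum_n_mult_r (K := R_Ring) M N_ m)) _).
      now apply Rmult_le_compat_r.
    + intros t Pt. apply (is_series_linear
        (V := AC)
        (W := AC)
        (fun B => End_comp B (g t))).
      * apply is_linear_End_comp_r.
      * now apply Hf.
Qed.

(** The scalar [(0, - / k)] is 1 / (ik). *)
Lemma is_derive_on_mode (k t : R) (c : A) :
  k <> 0 -> 0 <= t ->
  is_derive_on (V := AN) Rnonneg
    (fun t => End_Cscal (cis (k * t)) (End_Cscal (0, - / k) c)) t
    (End_Cscal (cis (k * t)) c).
Proof.
  intros Hk Pt. apply is_derive_on_of_is_derive; [exact Pt|].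
  assert (E : End_Cscal (cis (k * t)) c
    = End_Cscal (0, k)%C (End_Cscal (cis (k * t)) (End_Cscal (0, - / k) c))).
  { rewrite !End_Cscal_assoc. f_equal. unfold cis, Cmult. simpl.
    f_equal; field; exact Hk. }
  rewrite E. apply is_derive_End_cis.
Qed.

Lemma RInt_mode (k t : R) (c : A) :
  k <> 0 -> 0 <= t ->
  RInt (V := AC) (fun t => End_Cscal (cis (k * t)) c) 0 t
  = minus (End_Cscal (cis (k * t)) (End_Cscal (0, - / k) c))
          (End_Cscal (cis (k * 0)) (End_Cscal (0, - / k) c)).
Proof.
  intros Hk Pt.
  refine (RInt_derive_on (V := AC)
    (fun t => End_Cscal (cis (k * t)) (End_Cscal (0, - / k) c)) _ t _ _ Pt).
  - intros s Ps. now apply is_derive_on_mode.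
  - apply continuous_on_mode.
Qed.

Lemma is_avg_mode (k : R) (c : A) :
  k <> 0 -> is_avg (V := AC) (fun t => End_Cscal (cis (k * t)) c) zero.
Proof.
  intros Hk.
  apply (is_avg_primitive (V := AC) _
    (fun t => End_Cscal (cis (k * t)) (End_Cscal (0, - / k) c)) zero
    (norm (End_Cscal (0, - / k) c))).
  - intros t Pt. rewrite RInt_mode by assumption.
    refine (eq_sym (eq_trans (f_equal (plus _) (scal_zero_r (V := AC) t)) _)).
    apply plus_zero_r.
  - intros t _. apply norm_End_cis.
Qed.
End WienerClass.

(** * Primitives of exponentially decaying maps *)

Section FlatPrimitive.
Context {V : CompleteNormedModule R_AbsRing}.

Lemma norm_RInt_exp_le (f : R -> V) (N a b : R) :
  continuous_on Rnonneg f -> 0 <= a <= b ->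
  (forall t, 0 <= t -> norm (f t) <= N * exp (- t)) ->
  norm (RInt f a b) <= N * (exp (- a) - exp (- b)).
Proof.
  intros Cf Hab Hf.
  apply (norm_RInt_le f (fun t => N * exp (- t)) a b); [lra| | |].
  - intros x Hx. apply Hf. lra.
  - apply is_RInt_nonneg; [exact Cf|lra|lra].
  - replace (N * (exp (- a) - exp (- b)))
      with (minus (- N * exp (- b)) (- N * exp (- a)))
      by (unfold minus, plus, opp; simpl; ring).
    apply (is_RInt_derive (V := R_CompleteNormedModule) (fun t => - N * exp (- t))).
    + intros x _. auto_derive; [exact I|ring].
    + intros x _. apply (ex_derive_continuous (V := R_NormedModule)
        (fun t => N * exp (- t))). auto_derive. exact I.
Qed.

(** F(t) is minus the integral of f over [t, infinity), the primitive that decays. The rate of decay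
    being 1, the constant N is not worsened. *)
Lemma flat_primitive (f : R -> V) (N : R) :
  continuous_on Rnonneg f ->
  (forall t, 0 <= t -> norm (f t) <= N * exp (- t)) ->
  exists F : R -> V, continuous_on Rnonneg F /\
    (forall t, 0 <= t -> norm (F t) <= N * exp (- t)) /\
    (forall t, 0 <= t -> RInt f 0 t = minus (F t) (F 0)).
Proof.
  intros Cf Hf.
  assert (PN : 0 <= N).
  { pose proof (Hf 0 (Rle_refl 0)) as H0. rewrite Ropp_0, exp_0 in H0.
    pose proof (norm_ge_0 (f 0)). lra. }
  assert (small : forall a b, 0 <= a -> 0 <= b ->
    norm (minus (RInt f 0 b) (RInt f 0 a)) <= N * exp (- Rmin a b)).
  { assert (L : forall a b, 0 <= a <= b ->
      norm (minus (RInt f 0 b) (RInt f 0 a)) <= N * exp (- a)).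
    { intros a b Hab. rewrite RInt_minus_nonneg by (auto; lra).
      refine (Rle_trans _ _ _ (norm_RInt_exp_le f N a b Cf Hab Hf) _).
      apply Rmult_le_compat_l; [exact PN|]. pose proof (exp_pos (- b)). lra. }
    intros a b Pa Pb. unfold Rmin. destruct (Rle_dec a b).
    - apply L. lra.
    - rewrite norm_minus_sym. apply L. lra. }
  assert (lim0 : forall e, 0 < e -> exists A, 0 < A /\
    forall t, A <= t -> N * exp (- t) < e).
  { intros e Pe. exists ((N + 1) / e). split; [apply Rdiv_lt_0_compat; lra|].
    intros t Ht.
    assert (Pt : 0 < t).
    { refine (Rlt_le_trans _ _ _ _ Ht). apply Rdiv_lt_0_compat; lra. }
    apply (Rmult_le_compat_r e) in Ht; [|lra].
    replace ((N + 1) / e * e) with (N + 1) in Ht by (field; lra).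
    pose proof (exp_ineq1_le t). pose proof (exp_pos t).
    rewrite exp_Ropp. apply Rmult_lt_reg_r with (exp t); [apply exp_pos|].
    rewrite Rmult_assoc, Rinv_l by lra. nra. }
  (* The improper integral over the half-line, by the Cauchy criterion: [small] bounds the integral
     between two large times by N times the exponential at the smaller one. *)
  assert (EI : exists I : V, filterlim (fun t => RInt f 0 t)
    (Rbar_locally p_infty) (locally I)).
  { apply (filterlim_locally_cauchy (U := V) (F := Rbar_locally p_infty)
      (fun t => RInt f 0 t)). intros e.
    destruct (lim0 e (cond_pos e)) as [A [PA HA]].
    exists (fun t => A < t). split; [now exists A|].
    intros u v Hu Hv. apply (norm_compat1 (V := V)).
    refine (Rle_lt_trans _ _ _ (small u v _ _) (HA _ _)); try lra.
    apply Rmin_glb; lra. }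
  destruct EI as [I HI].
  exists (fun t => minus (RInt f 0 t) I). split; [|split].
  - apply (continuous_on_minus (fun t => RInt f 0 t) (fun _ => I)).
    + now apply continuous_on_RInt.
    + apply continuous_on_cst.
  - intros t Pt. apply le_epsilon. intros e Pe.
    destruct (proj1 (filterlim_norm_iff (Rbar_locally p_infty) _ I) HI e Pe)
      as [A HA].
    specialize (HA (Rmax t A + 1) ltac:(pose proof (Rmax_r t A); lra)).
    set (s := Rmax t A + 1) in *.
    assert (Hs : t <= s) by (unfold s; pose proof (Rmax_l t A); lra).
    norm_replace (plus (opp (minus (RInt f 0 s) (RInt f 0 t)))
      (minus (RInt f 0 s) I)); [|module].
    refine (norm_plus_le _ (Rlt_le _ _ HA)).
    refine (Rle_trans _ _ _ (Req_le _ _ (norm_opp _)) _).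
    refine (Rle_trans _ _ _ (small t s Pt _) _); [lra|].
    rewrite Rmin_left by lra. apply Rle_refl.
  - intros t Pt. rewrite RInt_point. symmetry.
    refine (eq_trans (y := minus (RInt f 0 t) zero) _ (minus_zero_r _)). module.
Qed.

Lemma is_avg_flat (f : R -> V) (N : R) :
  continuous_on Rnonneg f ->
  (forall t, 0 <= t -> norm (f t) <= N * exp (- t)) -> is_avg f zero.
Proof.
  intros Cf Hf. destruct (flat_primitive f N Cf Hf) as [F [_ [HF EF]]].
  apply (is_avg_primitive f F zero N).
  - intros t Pt. rewrite EF by exact Pt.
    refine (eq_sym (eq_trans (f_equal (plus _) (scal_zero_r t)) _)).
    apply plus_zero_r.
  - intros t Pt. refine (Rle_trans _ _ _ (HF t Pt) _).
    assert (PN : 0 <= N).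
    { pose proof (Hf 0 (Rle_refl 0)) as H0. rewrite Ropp_0, exp_0 in H0.
      pose proof (norm_ge_0 (f 0)). lra. }
    assert (exp (- t) <= 1) by (rewrite <- exp_0; apply exp_le; lra). nra.
Qed.
End FlatPrimitive.

(** What a primitive requires of omega: giving up the width delta pays for a division by
    alpha.omega, at the price of K. The part 1 <= K covers flat maps, whose primitive involves no
    divisor and keeps its bound. *)
Definition small_divisors {r : nat} (omega : Fin.t r -> R) (delta K : R) : Prop :=
  1 <= K /\ forall alpha : Fin.t r -> Z, alpha <> (fun _ => 0%Z) ->
    Zdot alpha omega <> 0 /\
    exp (- (delta * Zlength1 alpha)) <= K * Rabs (Zdot alpha omega).

(** * Averages and centered primitives in the algebra *)

Section WienerPrimitive.
Context {Z : CompleteNormedModule C_AbsRing} {r : nat} (omega : Fin.t r -> R).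
Notation A := (End (ComplexBanach Z)).
Notation AN := (End_NormedModule (ComplexBanach Z)).
Notation AC := (End_CompleteNormedModule (ComplexBanach Z)).

Lemma is_avg_sum_n {V : CompleteNormedModule R_AbsRing} (f_ : nat -> R -> V) (m : nat) :
  (forall j, continuous_on Rnonneg (f_ j)) -> (forall j, is_avg (f_ j) zero) ->
  is_avg (fun t => sum_n (fun j => f_ j t) m) zero.
Proof.
  intros Cf H. induction m as [|m IH].
  - apply (is_avg_ext (f_ 0%nat)); [|apply H]. intros t _. now rewrite sum_O.
  - apply (is_avg_ext (fun t => plus (sum_n (fun j => f_ j t) m) (f_ (S m) t))).
    + intros t _. now rewrite sum_Sn.
    + replace (zero : V) with (plus zero zero : V) by exact (plus_zero_r zero).
      exact (is_avg_plus (fun t => sum_n (fun j => f_ j t) m) (f_ (S m)) _ _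
        (continuous_on_sum_n f_ m Cf) (Cf (S m)) IH (H (S m))).
Qed.

Lemma RInt_sum_n {V : CompleteNormedModule R_AbsRing} (f_ : nat -> R -> V)
    (m : nat) (t : R) :
  (forall j, continuous_on Rnonneg (f_ j)) -> 0 <= t ->
  RInt (fun s => sum_n (fun j => f_ j s) m) 0 t
  = sum_n (fun j => RInt (f_ j) 0 t) m.
Proof.
  intros Cf Pt. induction m as [|m IH].
  - rewrite sum_O. apply RInt_ext. intros. now rewrite sum_O.
  - rewrite sum_Sn, <- IH.
    refine (eq_trans _ (RInt_plus_nonneg (fun s => sum_n (fun j => f_ j s) m)
      (f_ (S m)) t (continuous_on_sum_n f_ m Cf) (Cf (S m)) Pt)).
    apply RInt_ext. intros. now rewrite sum_Sn.
Qed.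

(** Convergence is uniform on [0, t] because the tail of the majorant does not involve s;
    integrating it costs a factor t. *)
Lemma is_series_RInt {V : CompleteNormedModule R_AbsRing} (f_ : nat -> R -> V)
    (N_ : nat -> R) (N : R) (f : R -> V) (t : R) :
  (forall j, 0 <= N_ j) -> (forall m, sum_n N_ m <= N) ->
  (forall j, continuous_on Rnonneg (f_ j)) ->
  (forall j s, 0 <= s -> norm (f_ j s) <= N_ j) ->
  (forall s, 0 <= s -> is_series (fun j => f_ j s) (f s)) ->
  continuous_on Rnonneg f -> 0 <= t ->
  is_series (fun j => RInt (f_ j) 0 t) (RInt f 0 t).
Proof.
  intros PN HN Cf_ Bf Hf Cf Pt. apply is_series_norm_iff. intros e Pe.
  destruct (dominated_series_tail (V := V) N_ N PN HN (e / (t + 1))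
    ltac:(apply Rdiv_lt_0_compat; lra)) as [m0 Hm0].
  exists m0. intros m Hm. rewrite norm_minus_sym.
  assert (Cs := continuous_on_sum_n f_ m Cf_).
  refine (Rle_lt_trans _ _ _ (Req_le _ _ (f_equal norm (eq_sym
    (eq_trans (RInt_minus_fun_nonneg f _ t Cf Cs Pt)
      (f_equal (minus (RInt f 0 t)) (RInt_sum_n f_ m t Cf_ Pt)))))) _).
  refine (Rle_lt_trans _ _ _ (norm_RInt_le_nonneg _ (e / (t + 1)) 0 t _ _ _) _).
  - now apply continuous_on_minus.
  - lra.
  - intros s Hs. apply (Hm0 m Hm (fun j => f_ j s)).
    + intros j. apply Bf. lra.
    + apply Hf. lra.
  - rewrite Rminus_0_r. apply Rmult_lt_reg_r with (t + 1); [lra|].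
    replace (t * (e / (t + 1)) * (t + 1)) with (t * e) by (field; lra). nra.
Qed.

(** The average L and the centered primitive F of f - L are built together along the structure of f.
    Only the zero frequency contributes to L; F is estimated term by term by K N_j, so that both
    series are dominated and every identity passes to the sum. *)
Lemma wiener_primitive kappa delta K (f : R -> A) N :
  0 <= kappa -> 0 < delta -> small_divisors omega delta K ->
  wiener omega (kappa + delta) f N ->
  exists (L : A) (F : R -> A), norm L <= N /\ wiener omega kappa F (K * N) /\
    is_avg (V := AC) F zero /\
    forall t, 0 <= t ->
      RInt (V := AC) f 0 t = plus (minus (F t) (F 0)) (scal t L).
Proof.
  intros Pk Pd [PK HK].
  assert (Pkd : 0 <= kappa + delta) by lra.
  induction 1 as [c alpha N H|f N Cf H|f_ N_ f N Wf IH HN Hf].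
  - assert (PN : norm c <= N).
    { refine (Rle_trans _ _ _ _ H). pose proof (norm_ge_0 c).
      assert (1 <= exp ((kappa + delta) * Zlength1 alpha)).
      { rewrite <- exp_0. apply exp_le.
        apply Rmult_le_pos; [exact Pkd|apply Zlength1_ge_0]. }
      nra. }
    destruct (excluded_middle_informative (alpha = fun _ => 0%Z)) as [E|E].
    + exists c, (fun _ => zero). split; [exact PN|split; [|split]].
      * apply wiener_const; [exact Pk|]. apply norm_zero_le; [reflexivity|].
        pose proof (norm_ge_0 c). nra.
      * apply (is_avg_const (V := AC)).
      * intros t Pt. subst alpha.
        rewrite (RInt_ext_nonneg (V := AC) _ (fun _ => c) t Pt).
        -- rewrite (RInt_const_nonneg (V := AC)). module.
        -- intros s _. rewrite Zdot_zero, Rmult_0_l, cis_0. apply End_Cscal_one.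
    + destruct (HK alpha E) as [Hk He]. set (k := Zdot alpha omega) in *.
      exists zero, (fun t => End_Cscal (cis (k * t)) (End_Cscal (0, - / k) c)).
      split; [|split; [|split]].
      * apply norm_zero_le; [reflexivity|]. pose proof (norm_ge_0 c). lra.
      * apply wiener_mode.
        assert (Hm : norm (End_Cscal (0, - / k) c) <= / Rabs k * norm c).
        { refine (Rle_trans _ _ _ (norm_End_Cscal _ c) _). right. f_equal.
          unfold Cmod. simpl. rewrite <- Rabs_inv, <- (Rabs_Ropp (/ k)),
            <- sqrt_Rsqr_abs. f_equal. unfold Rsqr. ring. }
        assert (Pak : 0 < Rabs k) by now apply Rabs_pos_lt.
        set (e1 := exp (kappa * Zlength1 alpha)) in *.
        assert (E1 : e1 = exp ((kappa + delta) * Zlength1 alpha)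
                          * exp (- (delta * Zlength1 alpha))).
        { unfold e1. rewrite <- exp_plus. f_equal. ring. }
        pose proof (exp_pos ((kappa + delta) * Zlength1 alpha)) as Pe2.
        set (e2 := exp ((kappa + delta) * Zlength1 alpha)) in *.
        pose proof (norm_ge_0 c) as Pc.
        refine (Rle_trans _ _ _ (Rmult_le_compat_l e1 _ _ _ Hm) _);
          [left; apply exp_pos|].
        apply Rle_trans with (e2 * (K * Rabs k) * (/ Rabs k * norm c)).
        -- apply Rmult_le_compat_r.
           ++ apply Rmult_le_pos; [left; now apply Rinv_0_lt_compat|exact Pc].
           ++ rewrite E1. apply Rmult_le_compat_l; lra.
        -- replace (e2 * (K * Rabs k) * (/ Rabs k * norm c))
             with (K * (e2 * norm c)) by (field; lra).
           apply Rmult_le_compat_l; lra.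
      * now apply is_avg_mode.
      * intros t Pt. rewrite (RInt_mode k t c Hk Pt). module.
  - destruct (flat_primitive (V := AC) f N Cf H) as [F [CF [HF EF]]].
    assert (PN : 0 <= N).
    { pose proof (H 0 (Rle_refl 0)) as H0. rewrite Ropp_0, exp_0 in H0.
      pose proof (norm_ge_0 (f 0)). lra. }
    exists zero, F. split; [|split; [|split]].
    + apply norm_zero_le; [reflexivity|exact PN].
    + apply (wiener_ext_le omega kappa F F N); [exact Pk|reflexivity|nra|].
      now apply wiener_flat.
    + exact (is_avg_flat (V := AC) F N CF HF).
    + intros t Pt. rewrite EF by exact Pt. module.
  - assert (B : forall j, 0 <= N_ j /\ forall t, 0 <= t -> norm (f_ j t) <= N_ j)
      by (intros j; exact (wiener_bound omega _ _ _ Pkd (Wf j))).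
    assert (PN : forall j, 0 <= N_ j) by (intros j; apply B).
    assert (Cf : continuous_on Rnonneg f)
      by (apply (wiener_continuous omega (kappa + delta) f N Pkd);
          now apply (wiener_series omega _ f_ N_)).
    destruct (choice_function _ IH) as [L_ HL].
    destruct (choice_function _ HL) as [F_ HF]. clear HL IH.
    assert (PKN : forall j, 0 <= K * N_ j)
      by (intros j; pose proof (PN j); nra).
    assert (HKN : forall m, sum_n (fun j => K * N_ j) m <= K * N).
    { intros m.
      refine (Rle_trans _ _ _ (Req_le _ _ (sum_n_mult_l (K := R_Ring) K N_ m)) _).
      apply Rmult_le_compat_l; [lra|apply HN]. }
    assert (BF : forall j t, 0 <= t -> norm (F_ j t) <= K * N_ j)
      by (intros j t Pt; apply (wiener_bound omega kappa (F_ j) _ Pk);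
          [apply HF|exact Pt]).
    destruct (ex_series_dominated (V := AC) N_ N PN HN L_) as [L SL];
      [intros j; apply HF|].
    (* The series is controlled only for t >= 0; at negative times any value will do. *)
    assert (EF : forall t, exists v : AC, 0 <= t -> is_series (fun j => F_ j t : AC) v).
    { intros t. destruct (Rle_dec 0 t) as [Pt|Nt].
      - destruct (ex_series_dominated (V := AC) _ _ PKN HKN (fun j => F_ j t))
          as [v Hv]; [intros j; now apply BF|]. now exists v.
      - exists zero. intros Pt. contradiction. }
    destruct (choice_function _ EF) as [F SF]. clear EF.
    assert (WF : wiener omega kappa F (K * N)).
    { apply (wiener_series omega kappa F_ (fun j => K * N_ j)).
      - intros j. apply HF.
      - exact HKN.
      - exact SF. }
    assert (CF_ : forall j, continuous_on Rnonneg (F_ j)).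
    { intros j. apply (wiener_continuous omega kappa _ (K * N_ j) Pk). apply HF. }
    exists L, F. split; [|split; [exact WF|split]].
    + apply (norm_dominated_series (V := AC) N_ N PN HN L_); [|exact SL].
      intros j. apply HF.
    + apply (is_avg_zero_uniform (V := AC)).
      * exact (wiener_continuous omega _ _ _ Pk WF).
      * intros e Pe.
        destruct (dominated_series_tail (V := AC) _ _ PKN HKN e Pe) as [m Hm].
        exists (fun t => sum_n (fun j => F_ j t) m). split; [|split].
        -- exact (continuous_on_sum_n (V := AC) F_ m CF_).
        -- apply (is_avg_sum_n (V := AC) F_ m CF_). intros j. apply HF.
        -- intros t Pt. apply (Hm m (le_n m) (fun j => F_ j t)).
           ++ intros j. now apply BF.
           ++ now apply SF.
    + intros t Pt.
      assert (S1 : is_series (V := AC) (fun j => RInt (V := AC) (f_ j) 0 t)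
                     (RInt (V := AC) f 0 t)).
      { apply (is_series_RInt (V := AC) f_ N_ N f t PN HN); try assumption.
        - intros j. exact (wiener_continuous omega _ _ _ Pkd (Wf j)).
        - intros j. apply B. }
      assert (S2 : is_series (V := AC)
        (fun j => plus (minus (F_ j t) (F_ j 0)) (scal t (L_ j)))
        (plus (minus (F t) (F 0)) (scal t L))).
      { apply (is_series_plus (V := AC) (fun j => minus (F_ j t) (F_ j 0))
          (fun j => scal t (L_ j))).
        - apply (is_series_minus (V := AC)); apply SF; [exact Pt|apply Rle_refl].
        - apply (is_series_scal (V := AC) t L_ L SL). }
      (* The series of integrals has two expressions for its sum: the integral of f, and the
         combination of F and L obtained by summing the identities for the [f_ j]. *)
      apply (filterlim_locally_unique (F := eventually) (V := AN)
        (sum_n (fun j => RInt (V := AC) (f_ j) 0 t))); [exact S1|].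
      apply (is_series_ext (V := AC)
        (fun j => plus (minus (F_ j t) (F_ j 0)) (scal t (L_ j)))); [|exact S2].
      intros j. symmetry. apply HF. exact Pt.
Qed.
End WienerPrimitive.

(** * Fourier series on the torus *)

Lemma bilinear_scal {V : CompleteNormedModule R_AbsRing} :
  bilinear_le1 (U := R_NormedModule) (V := V) (W := V) (fun k x => scal k x).
Proof.
  split.
  - intros k k' x. exact (scal_distr_r k k' x).
  - intros k x x'. exact (scal_distr_l k x x').
  - intros k k' x. exact (eq_sym (scal_assoc k k' x)).
  - intros k k' x. module.
  - intros k x. exact (norm_scal k x).
Qed.

Section FourierUniquenessCircle.
Context {Z : CompleteNormedModule C_AbsRing}.
Notation A := (End (ComplexBanach Z)).
Notation AN := (End_NormedModule (ComplexBanach Z)).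
Notation AC := (End_CompleteNormedModule (ComplexBanach Z)).
Context (g : R -> A) (Cg : continuous_on Rnonneg g) (B : R)
  (Bg : forall s, 0 <= s -> norm (g s) <= B)
  (Hg : forall k : BinInt.Z,
     RInt (V := AC) (fun s => End_Cscal (cis (IZR k * s)) (g s)) 0 (2 * PI) = zero).

(* A trigonometric polynomial that concentrates at s0 as n grows. *)
Let kernel (s0 : R) (n : nat) (s : R) : R := ((1 + cos (s - s0)) / 2) ^ n.

Lemma continuous_kernel s0 n s : continuous (kernel s0 n) s.
Proof.
  apply (ex_derive_continuous (V := R_NormedModule)). unfold kernel.
  auto_derive. exact I.
Qed.

Lemma continuous_on_cis_mult (k : R) (h : R -> A) :
  continuous_on Rnonneg h ->
  continuous_on Rnonneg (fun s => End_Cscal (cis (k * s)) (h s)).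
Proof.
  intros Ch.
  apply (continuous_on_ext_nonneg (V := AN)
    (fun s => End_comp (End_Cscal (cis (k * s)) End_id) (h s))).
  - intros s _. now rewrite End_Cscal_comp_l, End_comp_id_l.
  - exact (continuous_on_bilinear _ bilinear_End_comp _ _
      (continuous_on_mode _ _) Ch).
Qed.

Lemma continuous_on_kernel_mult s0 n (h : R -> A) :
  continuous_on Rnonneg h ->
  continuous_on Rnonneg (fun s => scal (kernel s0 n s) (h s)).
Proof.
  intros Ch.
  refine (continuous_on_bilinear (U := R_NormedModule) (V := AC) (W := AC) _
    bilinear_scal (kernel s0 n) h _ Ch).
  apply (continuous_on_of_continuous (V := R_NormedModule)).
  intros t _. apply continuous_kernel.
Qed.

(** Writing the cosine with exponentials, one factor of the kernel sends frequency k to k, k + 1 and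
    k - 1. *)
Lemma kernel_shift s0 s (k : R) (c : A) :
  scal ((1 + cos (s - s0)) / 2) (End_Cscal (cis (k * s)) c)
  = plus (scal (1/2) (End_Cscal (cis (k * s)) c))
      (plus (scal (1/4) (End_Cscal (cis (- s0)) (End_Cscal (cis ((k + 1) * s)) c)))
            (scal (1/4) (End_Cscal (cis s0) (End_Cscal (cis ((k - 1) * s)) c)))).
Proof.
  rewrite <- !End_Cscal_real, !End_Cscal_assoc.
  assert (E : (RtoC ((1 + cos (s - s0)) / 2) * cis (k * s)
    = RtoC (1/2) * cis (k * s) + (RtoC (1/4) * cis (- s0) * cis ((k + 1) * s)
      + RtoC (1/4) * cis s0 * cis ((k - 1) * s)))%C).
  { rewrite <- !Cmult_assoc, <- !cis_plus.
    replace (- s0 + (k + 1) * s) with (k * s + (s - s0)) by ring.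
    replace (s0 + (k - 1) * s) with (k * s + - (s - s0)) by ring.
    unfold cis. rewrite !cos_plus, !sin_plus, cos_neg, sin_neg.
    unfold RtoC, Cmult, Cplus. simpl. f_equal; field. }
  rewrite E, <- !Cmult_assoc.
  exact (eq_trans (End_Cscal_plus_l _ _ c)
    (f_equal (plus _) (End_Cscal_plus_l _ _ c))).
Qed.

(** The induction on n needs all frequencies k at once, since each kernel factor shifts k; at n = 0
    all the integrals vanish by assumption on g. *)
Lemma RInt_kernel_mult (s0 : R) (n : nat) (k : BinInt.Z) :
  RInt (V := AC)
    (fun s => scal (kernel s0 n s) (End_Cscal (cis (IZR k * s)) (g s))) 0 (2 * PI)
  = zero.
Proof.
  assert (PP : 0 <= 2 * PI) by (pose proof PI_RGT_0; lra).
  revert k. induction n as [|n IH]; intros k.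
  - rewrite <- (Hg k). apply (RInt_ext (V := AC)). intros s _. exact (scal_one _).
  - set (J := fun (j : BinInt.Z) s =>
      scal (kernel s0 n s) (End_Cscal (cis (IZR j * s)) (g s)) : A).
    assert (CJ : forall j, continuous_on Rnonneg (J j)).
    { intros j. apply continuous_on_kernel_mult. now apply continuous_on_cis_mult. }
    assert (CC : forall (z : C) j,
      continuous_on Rnonneg (fun s => End_Cscal z (J j s))).
    { intros z j. exact (continuous_on_linear (V := AC) (W := AC) (End_Cscal z)
        (is_linear_End_Cscal z) (J j) (CJ j)). }
    assert (Hz : forall j, is_RInt (V := AN) (J j) 0 (2 * PI) zero).
    { intros j. refine (eq_rect _ (is_RInt (V := AN) (J j) 0 (2 * PI))
        (is_RInt_nonneg (V := AC) (J j) 0 (2 * PI) (CJ j) (Rle_refl 0) PP) _ (IH j)). }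
    assert (HC : forall (z : C) j,
      is_RInt (V := AN) (fun s => End_Cscal z (J j s)) 0 (2 * PI) zero).
    { intros z j. refine (eq_rect _ (is_RInt (V := AN) _ 0 (2 * PI))
        (is_RInt_nonneg (V := AC) _ 0 (2 * PI) (CC z j) (Rle_refl 0) PP) _ _).
      refine (eq_trans (RInt_linear (V := AC) (W := AC) (End_Cscal z)
        (is_linear_End_Cscal z) (J j) _ (CJ j) PP) _).
      refine (eq_trans (f_equal (End_Cscal z) (IH j)) _).
      exact (linear_zero (U := AN) (V := AN) (End_Cscal z) (is_linear_End_Cscal z)). }
    apply (is_RInt_unique (V := AC)).
    assert (HS := is_RInt_plus (V := AN) _ _ _ _ _ _
      (is_RInt_scal (V := AN) _ _ _ (1/2) _ (Hz k))
      (is_RInt_plus (V := AN) _ _ _ _ _ _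
        (is_RInt_scal (V := AN) _ _ _ (1/4) _ (HC (cis (- s0)) (k + 1)%Z))
        (is_RInt_scal (V := AN) _ _ _ (1/4) _ (HC (cis s0) (k - 1)%Z)))).
    refine (eq_rect _ (is_RInt (V := AN) _ 0 (2 * PI))
      (is_RInt_ext (V := AN) _ _ _ _ _ _ HS) _ _); [|module].
    intros s _. cbv beta. unfold J, kernel. simpl pow.
    rewrite plus_IZR, minus_IZR, !End_Cscal_scal.
    set (p := ((1 + cos (s - s0)) / 2) ^ n).
    symmetry.
    replace (scal ((1 + cos (s - s0)) / 2 * p) (End_Cscal (cis (IZR k * s)) (g s)))
      with (scal p (scal ((1 + cos (s - s0)) / 2)
        (End_Cscal (cis (IZR k * s)) (g s)))) by module.
    rewrite kernel_shift. module.
Qed.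

(** Only the window of half-width d/2 around s0, of length d, is kept. Taking d/2 rather than d
    makes the base of this power larger than the bound of the kernel outside the window of
    half-width d. *)
Lemma RInt_kernel_ge (s0 d : R) (n : nat) :
  0 < d -> d <= s0 -> s0 + d <= 2 * PI -> d <= 1 ->
  d * ((1 + cos (d / 2)) / 2) ^ n <= RInt (kernel s0 n) 0 (2 * PI).
Proof.
  intros Pd H1 H2 H3.
  assert (ex : forall a b, ex_RInt (kernel s0 n) a b).
  { intros a b. apply (ex_RInt_continuous (V := R_CompleteNormedModule)).
    intros z _. apply continuous_kernel. }
  assert (P0 : forall s, 0 <= kernel s0 n s).
  { intros s. apply pow_le. pose proof (COS_bound (s - s0)). lra. }
  rewrite <- (RInt_Chasles (kernel s0 n) 0 (s0 - d / 2) (2 * PI) (ex _ _) (ex _ _)).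
  rewrite <- (RInt_Chasles (kernel s0 n) (s0 - d / 2) (s0 + d / 2) (2 * PI)
    (ex _ _) (ex _ _)).
  assert (I1 : 0 <= RInt (kernel s0 n) 0 (s0 - d / 2))
    by (apply RInt_ge_0; [lra|apply ex|intros; apply P0]).
  assert (I3 : 0 <= RInt (kernel s0 n) (s0 + d / 2) (2 * PI))
    by (apply RInt_ge_0; [lra|apply ex|intros; apply P0]).
  assert (I2 : d * ((1 + cos (d / 2)) / 2) ^ n
      <= RInt (kernel s0 n) (s0 - d / 2) (s0 + d / 2)).
  { replace (d * ((1 + cos (d / 2)) / 2) ^ n)
      with (RInt (fun _ => ((1 + cos (d / 2)) / 2) ^ n) (s0 - d / 2) (s0 + d / 2)).
    - apply RInt_le; [lra|apply ex_RInt_const|apply ex|].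
      intros s Hs. unfold kernel. apply pow_incr.
      pose proof (COS_bound (d / 2)). split; [lra|].
      assert (cos (d / 2) <= cos (s - s0)); [|lra].
      replace (cos (s - s0)) with (cos (Rabs (s - s0)))
        by (unfold Rabs; destruct Rcase_abs; [apply cos_neg|reflexivity]).
      pose proof PI2_1. pose proof (Rabs_pos (s - s0)).
      assert (Rabs (s - s0) <= d / 2)
        by (unfold Rabs; destruct Rcase_abs; lra).
      apply cos_decr_1; lra.
    - rewrite RInt_const. unfold scal; simpl; unfold mult; simpl. field. }
  unfold plus; simpl. lra.
Qed.

(** With I the integral of the kernel, I g(s0) is the integral of kernel(s) (g(s0) - g(s)), because
    the kernel integrates g to zero. Points near s0 contribute at most e I, the others at most K
    rho^n, and rho^n is negligible against I >= d rho'^n since rho < rho'. *)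
Lemma fourier_unique_interior (s0 : R) : 0 < s0 < 2 * PI -> g s0 = zero.
Proof.
  intros Hs0. pose proof PI_RGT_0 as PP.
  assert (PB : 0 <= B).
  { refine (Rle_trans _ _ _ (norm_ge_0 _) (Bg 0 (Rle_refl 0))). }
  apply (norm_small_zero _ AN _ 2). intros e Pe.
  destruct (proj1 (continuous_on_iff (V := AN) g) Cg s0 ltac:(lra) e Pe)
    as [d0 [Pd0 Hd0]].
  (* Within d of s0 the map [g] varies by less than e; the window lies inside one period; and d <= 1
     < pi/2 keeps cos d positive. *)
  set (d := Rmin (Rmin d0 1) (Rmin s0 (2 * PI - s0))).
  assert (Pd : 0 < d) by (unfold d; repeat apply Rmin_pos; lra).
  assert (L1 : d <= d0) by (unfold d; eapply Rle_trans; [apply Rmin_l|apply Rmin_l]).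
  assert (L2 : d <= 1) by (unfold d; eapply Rle_trans; [apply Rmin_l|apply Rmin_r]).
  assert (L3 : d <= s0) by (unfold d; eapply Rle_trans; [apply Rmin_r|apply Rmin_l]).
  assert (L4 : d <= 2 * PI - s0)
    by (unfold d; eapply Rle_trans; [apply Rmin_r|apply Rmin_r]).
  clearbody d.
  pose proof PI2_1 as P1.
  set (rho := (1 + cos d) / 2). set (rho' := (1 + cos (d / 2)) / 2).
  assert (Pr : 0 < rho).
  { unfold rho. assert (0 < cos d) by (apply cos_gt_0; lra). lra. }
  assert (Hr : rho < rho').
  { unfold rho, rho'. assert (cos d < cos (d / 2)) by (apply cos_decreasing_1; lra).
    lra. }
  assert (Hq : Rabs (rho / rho') < 1).
  { rewrite Rabs_pos_eq by (left; apply Rdiv_lt_0_compat; lra).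
    apply Rmult_lt_reg_r with rho'; [lra|]. unfold Rdiv.
    rewrite Rmult_assoc, Rinv_l; lra. }
  set (K := 2 * PI * (2 * B)).
  assert (PK : 0 <= K) by (unfold K; nra).
  (* Chosen so that K (rho/rho')^n <= e d, hence K rho^n <= e d rho'^n <= e I; K + 1 avoids a
     division by zero. *)
  destruct (pow_lt_1_zero _ Hq (e * d / (K + 1))
    ltac:(apply Rdiv_lt_0_compat; nra)) as [n Hn].
  specialize (Hn n (le_n n)).
  set (I := RInt (kernel s0 n) 0 (2 * PI)).
  assert (HI : d * rho' ^ n <= I) by (apply RInt_kernel_ge; lra).
  assert (Pn' : 0 < rho' ^ n) by (apply pow_lt; lra).
  assert (PI0 : 0 < I) by nra.
  assert (exk : is_RInt (kernel s0 n) 0 (2 * PI) I).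
  { apply (RInt_correct (V := R_CompleteNormedModule)).
    apply (ex_RInt_continuous (V := R_CompleteNormedModule)).
    intros z _. apply continuous_kernel. }
  assert (Cgk : continuous_on Rnonneg (fun s => scal (kernel s0 n s) (g s)))
    by now apply continuous_on_kernel_mult.
  assert (Cck : continuous_on Rnonneg (fun s => scal (kernel s0 n s) (g s0)))
    by exact (continuous_on_kernel_mult s0 n (fun _ => g s0)
        (continuous_on_cst (V := AC) (g s0))).
  assert (I0 : is_RInt (V := AC) (fun s => scal (kernel s0 n s) (g s)) 0 (2 * PI) zero).
  { refine (eq_rect _ (is_RInt (V := AN) _ 0 (2 * PI)) _ _ (RInt_kernel_mult s0 n 0)).
    apply (is_RInt_ext (V := AC) (fun s => scal (kernel s0 n s)
      (End_Cscal (cis (IZR 0 * s)) (g s)))).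
    - intros s _. now rewrite Rmult_0_l, cis_0, End_Cscal_one.
    - apply is_RInt_nonneg; [|lra|lra].
      apply continuous_on_kernel_mult. now apply continuous_on_cis_mult. }
  assert (I1 : is_RInt (V := AC) (fun s => scal (kernel s0 n s) (g s0)) 0 (2 * PI)
    (scal I (g s0))).
  { refine (eq_rect _ (is_RInt (V := AC) _ _ _)
      (is_RInt_nonneg (V := AC) _ 0 (2 * PI) Cck _ _) _ _); [lra|lra|].
    refine (RInt_linear (V := R_CompleteNormedModule) (W := AC)
      (fun k => scal k (g s0)) _ (kernel s0 n) (2 * PI) _ _).
    - exact (is_linear_scal_l (V := AN) (g s0)).
    - apply (continuous_on_of_continuous (V := R_NormedModule)).
      intros; apply continuous_kernel.
    - lra. }
  assert (E1 : norm (scal I (g s0)) <= e * I + K * rho ^ n).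
  { refine (Rle_trans _ _ _ (Req_le _ _ (f_equal norm (y := minus (scal I (g s0)) zero)
      (eq_sym (minus_zero_r _)))) _).
    apply (norm_RInt_le (V := AN)
      (fun s => minus (scal (kernel s0 n s) (g s0)) (scal (kernel s0 n s) (g s)))
      (fun s => e * kernel s0 n s + 2 * B * rho ^ n) 0 (2 * PI)).
    - lra.
    - intros s Hs.
      norm_replace (scal (kernel s0 n s) (minus (g s0) (g s))); [|module].
      assert (Pk : 0 <= kernel s0 n s).
      { apply pow_le. pose proof (COS_bound (s - s0)). lra. }
      assert (Prn : 0 < rho ^ n) by (apply pow_lt; lra).
      destruct (Rlt_le_dec (Rabs (s - s0)) d) as [Hsd|Hsd].
      + specialize (Hd0 s ltac:(lra) ltac:(lra)).
        refine (Rle_trans _ _ _ (norm_scal_le _ (Rle_refl _)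
          (Rle_trans _ _ _ (Req_le _ _ (norm_minus_sym _ _ _ _))
            (Rlt_le _ _ Hd0))) _).
        rewrite Rabs_pos_eq by exact Pk. nra.
      + assert (Kr : kernel s0 n s <= rho ^ n).
        { unfold kernel, rho. apply pow_incr.
          pose proof (COS_bound (s - s0)). split; [lra|].
          assert (cos (s - s0) <= cos d); [|lra].
          replace (cos (s - s0)) with (cos (Rabs (s - s0)))
            by (unfold Rabs; destruct Rcase_abs; [apply cos_neg|reflexivity]).
          assert (Rabs (s - s0) <= 2 * PI - d)
            by (unfold Rabs; destruct Rcase_abs; lra).
          (* Beyond distance pi, the symmetry x -> 2 pi - x leads back to [d, pi], where the cosine
             decreases. *)
          destruct (Rle_dec (Rabs (s - s0)) PI).
          - apply cos_decr_1; lra.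
          - replace (cos (Rabs (s - s0))) with (cos (2 * PI - Rabs (s - s0))).
            + apply cos_decr_1; lra.
            + rewrite cos_minus, cos_2PI, sin_2PI. ring. }
        refine (Rle_trans _ _ _ (norm_scal_le _ (Rle_refl _)
          (norm_minus_le (Bg s0 _) (Bg s _))) _); [lra|lra|].
        rewrite Rabs_pos_eq by exact Pk. nra.
    - exact (is_RInt_minus (V := AN) _ _ _ _ _ _ I1 I0).
    - replace (e * I + K * rho ^ n)
        with (plus (scal e I) (scal (2 * PI - 0) (2 * B * rho ^ n)))
        by (unfold plus, scal; simpl; unfold mult; simpl; unfold K; ring).
      apply (is_RInt_plus (V := R_NormedModule)).
      + exact (is_RInt_scal (V := R_NormedModule) _ _ _ e _ exk).
      + apply (is_RInt_const (V := R_NormedModule)). }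
  assert (E2 : I * norm (g s0) <= e * I + K * rho ^ n).
  { refine (Rle_trans _ _ _ _ E1).
    assert (Es : g s0 = scal (/ I) (scal I (g s0))) by (module; field; lra).
    rewrite Es at 1.
    refine (Rle_trans _ _ _ (Rmult_le_compat_l _ _ _ (Rlt_le _ _ PI0)
      (norm_scal_le (/ I) (Rle_refl _) (Rle_refl _))) _).
    rewrite Rabs_pos_eq by (left; now apply Rinv_0_lt_compat).
    right. field. lra. }
  assert (E3 : K * rho ^ n <= e * I).
  { rewrite Rabs_pos_eq in Hn
      by (apply pow_le; left; apply Rdiv_lt_0_compat; lra).
    replace (rho ^ n) with ((rho / rho') ^ n * rho' ^ n)
      by (rewrite <- Rpow_mult_distr; f_equal; field; lra).
    apply (Rmult_lt_compat_r (K + 1)) in Hn; [|lra].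
    replace (e * d / (K + 1) * (K + 1)) with (e * d) in Hn by (field; lra).
    set (q := (rho / rho') ^ n) in *.
    assert (Pq : 0 <= q) by (apply pow_le; left; apply Rdiv_lt_0_compat; lra).
    assert (K * q <= e * d) by nra.
    apply Rle_trans with (e * d * rho' ^ n).
    - rewrite <- Rmult_assoc. apply Rmult_le_compat_r; lra.
    - rewrite Rmult_assoc. apply Rmult_le_compat_l; lra. }
  apply Rmult_le_reg_l with I; [exact PI0|]. lra.
Qed.

(** The endpoints are limits of interior points. *)
Lemma fourier_unique_circle (s0 : R) : 0 <= s0 <= 2 * PI -> g s0 = zero.
Proof.
  intros Hs0. pose proof PI_RGT_0 as PP.
  apply (norm_small_zero _ AN _ 1). intros e Pe.
  destruct (proj1 (continuous_on_iff (V := AN) g) Cg s0 ltac:(lra) e Pe)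
    as [d [Pd Hd]].
  set (h := Rmin d PI / 2).
  assert (Ph : 0 < h <= PI / 2 /\ h < d).
  { unfold h. pose proof (Rmin_pos d PI Pd PP).
    pose proof (Rmin_l d PI). pose proof (Rmin_r d PI). lra. }
  assert (E : exists s, 0 < s < 2 * PI /\ Rabs (s - s0) < d).
  { destruct (Rle_dec s0 PI).
    - exists (s0 + h). split; [lra|].
      replace (s0 + h - s0) with h by ring. rewrite Rabs_pos_eq; lra.
    - exists (s0 - h). split; [lra|].
      replace (s0 - h - s0) with (- h) by ring. rewrite Rabs_Ropp, Rabs_pos_eq; lra. }
  destruct E as [s [Hs Ds]]. specialize (Hd s ltac:(lra) Ds).
  rewrite (fourier_unique_interior s Hs) in Hd.
  rewrite norm_minus_sym in Hd. rewrite Rmult_1_r.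
  refine (Rle_trans _ _ _ (Req_le _ _ (f_equal norm (eq_sym (minus_zero_r (g s0))))) _).
  now left.
Qed.
End FourierUniquenessCircle.

(** * Means of uniformly continuous maps on the torus *)

Section TorusMean.
Context {E : CompleteNormedModule R_AbsRing}.

(** The iterated integral [torus_mean] needs each inner mean to be continuous in the outer variable.
    Uniform continuity passes to sections with the same modulus, which provides this in every
    dimension. *)
Definition bounded_uc {r : nat} (f : (Fin.t r -> R) -> E) : Prop :=
  (exists B, forall theta, norm (f theta) <= B) /\
  forall e, 0 < e -> exists d, 0 < d /\
    forall theta theta' : Fin.t r -> R,
      (forall i, Rabs (theta i - theta' i) < d) ->
      norm (minus (f theta) (f theta')) <= e.

Lemma bounded_uc_minus {r : nat} (f g : (Fin.t r -> R) -> E) :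
  bounded_uc f -> bounded_uc g -> bounded_uc (fun theta => minus (f theta) (g theta)).
Proof.
  intros [[B HB] Hf] [[B' HB'] Hg]. split.
  - exists (B + B'). intros theta.
    exact (norm_minus_le (HB theta) (HB' theta)).
  - intros e Pe. destruct (Hf (e / 2) ltac:(lra)) as [d [Pd Hd]].
    destruct (Hg (e / 2) ltac:(lra)) as [d' [Pd' Hd']].
    exists (Rmin d d'). split; [now apply Rmin_pos|]. intros x y H.
    norm_replace (minus (minus (f x) (f y)) (minus (g x) (g y))); [|module].
    refine (Rle_trans _ _ _ (norm_minus_le (Hd x y _) (Hd' x y _)) _); [| |lra];
      intros i; [refine (Rlt_le_trans _ _ _ (H i) (Rmin_l _ _))
                |refine (Rlt_le_trans _ _ _ (H i) (Rmin_r _ _))].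
Qed.

Lemma bounded_uc_section {r : nat} (f : (Fin.t (S r) -> R) -> E) (s : R) :
  bounded_uc f -> bounded_uc (fun theta => f (fin_cons s theta)).
Proof.
  intros [[B HB] Hf]. split; [now exists B|]. intros e Pe.
  destruct (Hf e Pe) as [d [Pd Hd]]. exists d. split; [exact Pd|].
  intros x y H. apply Hd. intros i.
  refine (Fin.caseS' i (fun i => Rabs (fin_cons s x i - fin_cons s y i) < d) _ H).
  simpl. rewrite Rminus_diag, Rabs_R0. exact Pd.
Qed.

Lemma continuous_on_of_uc (h : R -> E) :
  (forall e, 0 < e -> exists d, 0 < d /\ forall s t, Rabs (s - t) < d ->
     norm (minus (h s) (h t)) <= e) -> continuous_on Rnonneg h.
Proof.
  intros H. apply (continuous_on_iff h). intros t _ e Pe.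
  destruct (H (e / 2) ltac:(lra)) as [d [Pd Hd]]. exists d. split; [exact Pd|].
  intros s _ Hs. refine (Rle_lt_trans _ _ _ (Hd s t Hs) _). lra.
Qed.

(** Additivity and the bound have to be proved together: in dimension r + 1, integrability of the
    inner mean in the first variable rests on both statements in dimension r. *)
Lemma torus_mean_aux (r : nat) :
  (forall f g : (Fin.t r -> R) -> E, bounded_uc f -> bounded_uc g ->
     torus_mean (fun theta => minus (f theta) (g theta))
     = minus (torus_mean f) (torus_mean g)) /\
  (forall (f : (Fin.t r -> R) -> E) B, bounded_uc f ->
     (forall theta, norm (f theta) <= B) -> norm (torus_mean f) <= B).
Proof.
  pose proof PI_RGT_0 as PP.
  induction r as [|r [IHm IHb]]; [split; [reflexivity|intros f B _ H; apply H]|].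
  assert (Cs : forall f : (Fin.t (S r) -> R) -> E, bounded_uc f ->
    continuous_on Rnonneg (fun s => torus_mean (fun theta => f (fin_cons s theta)))).
  { intros f Hf. apply continuous_on_of_uc. intros e Pe.
    destruct (proj2 Hf e Pe) as [d [Pd Hd]]. exists d. split; [exact Pd|].
    intros s t Hst.
    refine (Rle_trans _ _ _ (Req_le _ _ (f_equal norm (eq_sym
      (IHm _ _ (bounded_uc_section f s Hf) (bounded_uc_section f t Hf))))) _).
    apply IHb; [apply bounded_uc_minus; now apply bounded_uc_section|].
    intros theta. apply Hd. intros i.
    refine (Fin.caseS' i
      (fun i => Rabs (fin_cons s theta i - fin_cons t theta i) < d) Hst _).
    intros j. simpl. rewrite Rminus_diag, Rabs_R0. exact Pd. }
  split.
  - intros f g Hf Hg. cbn [torus_mean].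
    rewrite (RInt_ext_nonneg _ (fun s =>
      minus (torus_mean (fun theta => f (fin_cons s theta)))
            (torus_mean (fun theta => g (fin_cons s theta)))) (2 * PI) ltac:(lra)).
    + refine (eq_trans (f_equal (scal _) (RInt_minus_fun_nonneg _ _ _
        (Cs f Hf) (Cs g Hg) _)) _); [lra|].
      exact (scal_minus_distr_l (V := E) _ _ _).
    + intros s _. apply IHm; now apply bounded_uc_section.
  - intros f B Hf HB. cbn [torus_mean].
    refine (Rle_trans _ _ _ (norm_scal_le _ (Rle_refl _)
      (norm_RInt_le_nonneg _ B 0 (2 * PI) (Cs f Hf) _ _)) _).
    + lra.
    + intros s _. apply IHb; [now apply bounded_uc_section|]. intros theta. apply HB.
    + rewrite Rabs_pos_eq by (left; apply Rinv_0_lt_compat; lra).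
      right. field. lra.
Qed.

Lemma torus_mean_minus {r : nat} (f g : (Fin.t r -> R) -> E) :
  bounded_uc f -> bounded_uc g ->
  torus_mean (fun theta => minus (f theta) (g theta))
  = minus (torus_mean f) (torus_mean g).
Proof. apply torus_mean_aux. Qed.

Lemma norm_torus_mean_le {r : nat} (f : (Fin.t r -> R) -> E) B :
  bounded_uc f -> (forall theta, norm (f theta) <= B) -> norm (torus_mean f) <= B.
Proof. apply torus_mean_aux. Qed.

Lemma torus_section_mean_uc {r : nat} (f : (Fin.t (S r) -> R) -> E) :
  bounded_uc f -> forall e, 0 < e -> exists d, 0 < d /\
    forall s t, Rabs (s - t) < d ->
      norm (minus (torus_mean (fun theta => f (fin_cons s theta)))
                  (torus_mean (fun theta => f (fin_cons t theta)))) <= e.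
Proof.
  intros Hf e Pe.
  destruct (proj2 Hf e Pe) as [d [Pd Hd]]. exists d. split; [exact Pd|].
  intros s t Hst.
  refine (Rle_trans _ _ _ (Req_le _ _ (f_equal norm (eq_sym (torus_mean_minus _ _
    (bounded_uc_section f s Hf) (bounded_uc_section f t Hf))))) _).
  apply norm_torus_mean_le; [apply bounded_uc_minus; now apply bounded_uc_section|].
  intros theta. apply Hd. intros i.
  refine (Fin.caseS' i
    (fun i => Rabs (fin_cons s theta i - fin_cons t theta i) < d) Hst _).
  intros j. simpl. rewrite Rminus_diag, Rabs_R0. exact Pd.
Qed.

Lemma torus_mean_ext {r : nat} (f g : (Fin.t r -> R) -> E) :
  (forall theta, f theta = g theta) -> torus_mean f = torus_mean g.
Proof. intros H. f_equal. now apply functional_extensionality. Qed.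

Lemma bounded_uc_uniform_limit {r : nat} (f : (Fin.t r -> R) -> E) :
  (forall e, 0 < e -> exists g, bounded_uc g /\
     forall theta, norm (minus (f theta) (g theta)) <= e) -> bounded_uc f.
Proof.
  intros H. split.
  - destruct (H 1 Rlt_0_1) as [g [[[B HB] _] Hg]]. exists (1 + B). intros x.
    replace (f x) with (plus (minus (f x) (g x)) (g x)) by module.
    exact (norm_plus_le (Hg x) (HB x)).
  - intros e Pe. destruct (H (e / 3) ltac:(lra)) as [g [[_ Ug] Hg]].
    destruct (Ug (e / 3) ltac:(lra)) as [d [Pd Hd]].
    exists d. split; [exact Pd|]. intros x y Hxy.
    norm_replace (plus (minus (minus (f x) (g x)) (minus (f y) (g y)))
      (minus (g x) (g y))); [|module].
    refine (Rle_trans _ _ _ (norm_plus_le (norm_minus_le (Hg x) (Hg y))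
      (Hd x y Hxy)) _). lra.
Qed.
End TorusMean.

Lemma torus_mean_linear {E : CompleteNormedModule R_AbsRing} {r : nat}
    (i : E -> E) (f : (Fin.t r -> R) -> E) (Hi : is_linear i) :
  bounded_uc f -> torus_mean (fun theta => i (f theta)) = i (torus_mean f).
Proof.
  revert f. induction r as [|r IH]; intros f Hf; [reflexivity|].
  cbn [torus_mean].
  assert (C := continuous_on_of_uc _ (torus_section_mean_uc f Hf)).
  refine (eq_trans _ (eq_sym (linear_scal i Hi _ _))). f_equal.
  refine (eq_trans _ (RInt_linear i Hi _ (2 * PI) C _)).
  - apply RInt_ext_nonneg; [pose proof PI_RGT_0; lra|]. intros s _.
    apply IH. now apply bounded_uc_section.
  - pose proof PI_RGT_0. lra.
Qed.

Lemma fin_cons_eta {r : nat} (theta : Fin.t (S r) -> R) :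
  fin_cons (theta Fin.F1) (fun i => theta (Fin.FS i)) = theta.
Proof.
  apply functional_extensionality. intros i.
  exact (Fin.caseS' i (fun i => fin_cons (theta Fin.F1)
    (fun i => theta (Fin.FS i)) i = theta i) eq_refl (fun _ => eq_refl)).
Qed.

Lemma Zdot_cons {r : nat} (alpha : Fin.t (S r) -> Z) (s : R) (theta : Fin.t r -> R) :
  Zdot alpha (fin_cons s theta)
  = IZR (alpha Fin.F1) * s + Zdot (fun i => alpha (Fin.FS i)) theta.
Proof. reflexivity. Qed.

Definition zcons {r : nat} (k : Z) (alpha : Fin.t r -> Z) (i : Fin.t (S r)) : Z :=
  Fin.caseS' i (fun _ => Z) k alpha.

Lemma zcons_eta {r : nat} (alpha : Fin.t (S r) -> Z) :
  zcons (alpha Fin.F1) (fun i => alpha (Fin.FS i)) = alpha.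
Proof.
  apply functional_extensionality. intros i.
  exact (Fin.caseS' i (fun i => zcons (alpha Fin.F1)
    (fun i => alpha (Fin.FS i)) i = alpha i) eq_refl (fun _ => eq_refl)).
Qed.

Lemma Zdot_dist_le {r : nat} (alpha : Fin.t r -> Z) (x y : Fin.t r -> R) (d : R) :
  (forall i, Rabs (x i - y i) <= d) ->
  Rabs (Zdot alpha x - Zdot alpha y) <= Zlength1 alpha * d.
Proof.
  unfold Zdot, Zlength1. induction r as [|r IH]; intros H; cbn [fin_sum].
  - rewrite Rminus_diag, Rabs_R0. lra.
  - specialize (IH (fun i => alpha (Fin.FS i)) (fun i => x (Fin.FS i))
      (fun i => y (Fin.FS i)) (fun i => H _)).
    specialize (H Fin.F1). cbv beta in IH.
    set (sx := fin_sum (fun i => IZR (alpha (Fin.FS i)) * x (Fin.FS i))) in *.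
    set (sy := fin_sum (fun i => IZR (alpha (Fin.FS i)) * y (Fin.FS i))) in *.
    replace (IZR (alpha Fin.F1) * x Fin.F1 + sx - (IZR (alpha Fin.F1) * y Fin.F1 + sy))
      with (IZR (alpha Fin.F1) * (x Fin.F1 - y Fin.F1) + (sx - sy)) by ring.
    refine (Rle_trans _ _ _ (Rabs_triang _ _) _).
    rewrite Rabs_mult, abs_IZR, Rmult_plus_distr_r.
    pose proof (Rabs_pos (IZR (alpha Fin.F1))).
    apply Rplus_le_compat; [|exact IH]. now apply Rmult_le_compat_l.
Qed.

Lemma cis_2PI_Z (k : Z) : cis (2 * PI * IZR k) = RtoC 1.
Proof.
  assert (EN : forall n : nat, cis (2 * PI * INR n) = RtoC 1).
  { induction n as [|n IH]; [rewrite Rmult_0_r; apply cis_0|].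
    rewrite S_INR, Rmult_plus_distr_l, cis_plus, IH, Rmult_1_r.
    unfold cis. rewrite cos_2PI, sin_2PI. unfold Cmult, RtoC. simpl. f_equal; ring. }
  destruct (Z_le_dec 0 k).
  - rewrite <- (Z2Nat.id k) by lia. rewrite <- INR_IZR_INZ. apply EN.
  - replace (2 * PI * IZR k) with (- (2 * PI * INR (Z.to_nat (- k)))).
    + specialize (EN (Z.to_nat (- k))). unfold cis, RtoC in *.
      injection EN as E1 E2. rewrite cos_neg, sin_neg, E1, E2. f_equal. ring.
    + rewrite INR_IZR_INZ, Z2Nat.id by lia. rewrite opp_IZR. ring.
Qed.

(** * Characters and uniqueness of Fourier coefficients on the torus *)

Section FourierTorus.
Context {Z : CompleteNormedModule C_AbsRing}.
Notation A := (End (ComplexBanach Z)).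
Notation AN := (End_NormedModule (ComplexBanach Z)).
Notation AC := (End_CompleteNormedModule (ComplexBanach Z)).

Lemma bounded_uc_cis {r : nat} (alpha : Fin.t r -> BinInt.Z)
    (f : (Fin.t r -> R) -> A) :
  bounded_uc (E := AC) f ->
  bounded_uc (E := AC) (fun theta => End_Cscal (cis (Zdot alpha theta)) (f theta)).
Proof.
  intros [[B HB] Hf]. split.
  - exists B. intros x. exact (Rle_trans _ _ _ (norm_End_cis _ _) (HB x)).
  - intros e Pe. destruct (Hf (e / 2) ltac:(lra)) as [d [Pd Hd]].
    assert (PB : 0 <= B) by exact (Rle_trans _ _ _ (norm_ge_0 _) (HB (fun _ => 0))).
    pose proof (Zlength1_ge_0 alpha) as PL.
    set (K := 2 * Zlength1 alpha * B). assert (PK : 0 <= K) by (unfold K; nra).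
    set (d' := e / (2 * (K + 1))).
    assert (Pd' : 0 < d') by (apply Rdiv_lt_0_compat; lra).
    exists (Rmin d d'). split; [now apply Rmin_pos|]. intros x y H.
    norm_replace (plus (End_Cscal (cis (Zdot alpha x)) (minus (f x) (f y)))
      (minus (End_Cscal (cis (Zdot alpha x)) (f y))
             (End_Cscal (cis (Zdot alpha y)) (f y)))).
    2: { assert (EL := linear_minus (U := AN) (V := AN)
          (End_Cscal (cis (Zdot alpha x))) (f x) (f y) (is_linear_End_Cscal _)).
         refine (eq_trans (f_equal (fun z => plus z _) EL) _). module. }
    refine (Rle_trans _ _ _ (norm_plus_le (a := e / 2) (b := e / 2) _ _) _); [| |lra].
    + refine (Rle_trans _ _ _ (norm_End_cis _ _) (Hd x y _)).
      intros i. exact (Rlt_le_trans _ _ _ (H i) (Rmin_l _ _)).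
    + refine (Rle_trans _ _ _ (norm_End_cis_minus_le _ _ _) _).
      assert (D : Rabs (Zdot alpha x - Zdot alpha y) <= Zlength1 alpha * d').
      { apply Zdot_dist_le. intros i. left.
        exact (Rlt_le_trans _ _ _ (H i) (Rmin_r _ _)). }
      pose proof (Rabs_pos (Zdot alpha x - Zdot alpha y)).
      apply Rle_trans with (2 * (Zlength1 alpha * d') * B).
      * apply Rmult_le_compat; [lra|apply norm_ge_0|lra|apply HB].
      * replace (2 * (Zlength1 alpha * d') * B) with (K * d') by (unfold K; ring).
        assert (E : (K + 1) * d' = e / 2) by (unfold d'; field; lra). lra.
Qed.

Lemma bounded_uc_const {E : CompleteNormedModule R_AbsRing} {r : nat} (c : E) :
  bounded_uc (r := r) (fun _ => c).
Proof.
  split; [exists (norm c); intros; apply Rle_refl|]. intros e Pe.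
  exists 1. split; [lra|]. intros x y _. apply norm_zero_le; [module|lra].
Qed.

(** Orthogonality of characters. At fixed first coordinate s, the factor e^(i alpha_1 s) leaves the
    inner mean; either that mean vanishes by induction, or a one-variable integral over a period
    decides. *)
Lemma torus_mean_mode {r : nat} (alpha : Fin.t r -> BinInt.Z) (c : A) :
  (alpha = (fun _ => 0%Z) ->
    torus_mean (E := AC) (fun theta => End_Cscal (cis (Zdot alpha theta)) c) = c) /\
  (alpha <> (fun _ => 0%Z) ->
    torus_mean (E := AC) (fun theta => End_Cscal (cis (Zdot alpha theta)) c) = zero).
Proof.
  pose proof PI_RGT_0 as PP.
  induction r as [|r IH].
  - split; intros H.
    + simpl. rewrite <- (End_Cscal_one c) at 2. rewrite <- cis_0. reflexivity.
    + exfalso. apply H. apply functional_extensionality. intros i.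
      now apply Fin.case0.
  - specialize (IH (fun i => alpha (Fin.FS i))). destruct IH as [IH0 IH1].
    assert (ES : forall s, torus_mean (E := AC) (fun theta =>
        End_Cscal (cis (Zdot alpha (fin_cons s theta))) c)
      = End_Cscal (cis (IZR (alpha Fin.F1) * s)) (torus_mean (E := AC)
          (fun theta => End_Cscal (cis (Zdot (fun i => alpha (Fin.FS i)) theta)) c))).
    { intros s.
      refine (eq_trans _ (torus_mean_linear (E := AC)
        (End_Cscal (cis (IZR (alpha Fin.F1) * s)))
        (fun theta => End_Cscal (cis (Zdot (fun i => alpha (Fin.FS i)) theta)) c)
        (is_linear_End_Cscal _) (bounded_uc_cis _ _ (bounded_uc_const (E := AC) c)))).
      apply torus_mean_ext. intros theta.
      now rewrite Zdot_cons, cis_plus, End_Cscal_assoc. }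
    cbn [torus_mean].
    destruct (excluded_middle_informative ((fun i => alpha (Fin.FS i)) = fun _ => 0%Z))
      as [H'|H'].
    + rewrite (RInt_ext_nonneg (V := AC) _
        (fun s => End_Cscal (cis (IZR (alpha Fin.F1) * s)) c) (2 * PI) ltac:(lra))
        by (intros s _; rewrite ES, IH0; [reflexivity|exact H']).
      destruct (Z.eq_dec (alpha Fin.F1) 0) as [H1|H1].
      * split; intros H.
        -- rewrite (RInt_ext_nonneg (V := AC) _ (fun _ => c) (2 * PI) ltac:(lra)).
           ++ rewrite (RInt_const_nonneg (V := AC)). module. field. lra.
           ++ intros s _. rewrite H1, Rmult_0_l, cis_0. apply End_Cscal_one.
        -- exfalso. apply H. rewrite <- (zcons_eta alpha), H', H1.
           apply functional_extensionality. intros i.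
           exact (Fin.caseS' i (fun i => zcons 0 (fun _ => 0%Z) i = 0%Z)
             eq_refl (fun _ => eq_refl)).
      * split; intros H; [exfalso; apply H1; now rewrite H|].
        assert (Hk : IZR (alpha Fin.F1) <> 0) by now apply not_0_IZR.
        rewrite (RInt_mode _ _ c Hk) by lra.
        assert (EP : cis (IZR (alpha Fin.F1) * (2 * PI)) = cis 0)
          by (rewrite cis_0, Rmult_comm; apply cis_2PI_Z).
        rewrite EP, Rmult_0_r. module.
    + assert (H : alpha <> (fun _ => 0%Z)) by (intros H; apply H'; now rewrite H).
      split; intros H0; [contradiction|].
      rewrite (RInt_ext_nonneg (V := AC) _ (fun _ => zero) (2 * PI) ltac:(lra)).
      * rewrite (RInt_const_nonneg (V := AC)). module.
      * intros s _. rewrite ES, (IH1 H').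
        exact (linear_zero (U := AN) (V := AN) _ (is_linear_End_Cscal _)).
Qed.

(** For a fixed frequency in the last r variables, the corresponding coefficient of the sections is
    a function of the first coordinate all of whose Fourier coefficients vanish, so it is zero on
    the circle. Every section then has zero coefficients and the induction applies to it. *)
Lemma fourier_unique_box {r : nat} (f : (Fin.t r -> R) -> A) :
  bounded_uc (E := AC) f ->
  (forall alpha, torus_mean (E := AC)
     (fun theta => End_Cscal (cis (Zdot alpha theta)) (f theta)) = zero) ->
  forall theta, (forall i, 0 <= theta i <= 2 * PI) -> f theta = zero.
Proof.
  induction r as [|r IH]; intros Hf H theta Ht.
  - specialize (H (fun _ => 0%Z)). simpl in H.
    change (cis (Zdot (fun _ : Fin.t 0 => 0%Z) (fun _ => 0))) with (cis 0) in H.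
    rewrite cis_0, End_Cscal_one in H. refine (eq_trans _ H). f_equal.
    apply functional_extensionality. intros i. now apply Fin.case0.
  - rewrite <- (fin_cons_eta theta).
    apply (IH (fun theta' => f (fin_cons (theta Fin.F1) theta'))).
    + now apply (bounded_uc_section (E := AC)).
    + intros alpha.
      (* The first frequency is set to 0, so that the inner mean [g] carries only the exponential in
         the last variables; the frequency k in the first one is put back below. *)
      set (F := fun theta => End_Cscal (cis (Zdot (zcons 0 alpha) theta)) (f theta)).
      assert (UF : bounded_uc (E := AC) F) by now apply bounded_uc_cis.
      set (g := fun s => torus_mean (E := AC) (fun theta => F (fin_cons s theta))).
      assert (Cg : continuous_on (U := AC) Rnonneg g)
        by exact (continuous_on_of_uc (E := AC) _ (torus_section_mean_uc (E := AC) F UF)).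
      destruct UF as [[B HB] UF].
      assert (Eg : g (theta Fin.F1) = zero).
      { apply (fourier_unique_circle g Cg B).
        - intros s _. apply (norm_torus_mean_le (E := AC)); [|intros; apply HB].
          apply (bounded_uc_section (E := AC)). split; [now exists B|exact UF].
        - intros k. specialize (H (zcons k alpha)). cbn [torus_mean] in H.
          rewrite (RInt_ext_nonneg (V := AC) _
            (fun s => End_Cscal (cis (IZR k * s)) (g s))) in H.
          + apply (f_equal (scal (2 * PI))) in H.
            refine (eq_trans (eq_trans _ H) _).
            * module. pose proof PI_RGT_0. field. lra.
            * exact (scal_zero_r (V := AN) _).
          + pose proof PI_RGT_0. lra.
          + intros s _. unfold g.
            refine (eq_trans _ (torus_mean_linear (E := AC)
              (End_Cscal (cis (IZR k * s))) (fun theta => F (fin_cons s theta))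
              (is_linear_End_Cscal _) _)).
            * apply torus_mean_ext. intros x. unfold F.
              rewrite !Zdot_cons, End_Cscal_assoc, <- cis_plus. simpl.
              rewrite Rmult_0_l, Rplus_0_l. reflexivity.
            * apply (bounded_uc_section (E := AC)). split; [now exists B|exact UF].
        - apply Ht. }
      unfold g in Eg. refine (eq_trans _ Eg). apply torus_mean_ext. intros x. unfold F.
      rewrite Zdot_cons. simpl. rewrite Rmult_0_l, Rplus_0_l. reflexivity.
    + intros i. apply Ht.
Qed.

Lemma torus_reduce {r : nat} (theta : Fin.t r -> R) :
  exists (x : Fin.t r -> R) (k : Fin.t r -> BinInt.Z),
    (forall i, 0 <= x i <= 2 * PI) /\
    theta = (fun i => x i + 2 * PI * IZR (k i)).
Proof.
  pose proof PI_RGT_0 as PP.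
  exists (fun i => theta i - 2 * PI * IZR (Int_part (theta i / (2 * PI)))),
    (fun i => Int_part (theta i / (2 * PI))). split.
  - intros i. destruct (base_Int_part (theta i / (2 * PI))) as [H1 H2].
    set (n := IZR (Int_part (theta i / (2 * PI)))) in *.
    assert (Et : theta i = theta i / (2 * PI) * (2 * PI)) by (field; lra).
    set (u := theta i / (2 * PI)) in *. rewrite Et. nra.
  - apply functional_extensionality. intros i. ring.
Qed.

Lemma fourier_unique {r : nat} (f : (Fin.t r -> R) -> A) :
  torus_periodic f -> bounded_uc (E := AC) f ->
  (forall alpha, torus_mean (E := AC)
     (fun theta => End_Cscal (cis (Zdot alpha theta)) (f theta)) = zero) ->
  forall theta, f theta = zero.
Proof.
  intros Pf Hf H theta. destruct (torus_reduce theta) as [x [k [Hx ->]]].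
  rewrite Pf. now apply fourier_unique_box.
Qed.
End FourierTorus.

(** * Continuous periodic maps are bounded and uniformly continuous *)

Fixpoint fin_of_Tn {n : nat} : Compactness.Tn n R -> Fin.t n -> R :=
  match n with
  | O => fun _ _ => 0
  | S n => fun x => fin_cons (fst x) (fin_of_Tn (snd x))
  end.

(** Nested pairs are the form in which [compactness_value] speaks of points of a box. *)
Fixpoint Tn_of_fin {n : nat} : (Fin.t n -> R) -> Compactness.Tn n R :=
  match n with
  | O => fun _ => tt
  | S n => fun x => (x Fin.F1, Tn_of_fin (fun i => x (Fin.FS i)))
  end.

Lemma bounded_Tn_of_fin {n : nat} (a b : R) (x : Fin.t n -> R) :
  (forall i, a <= x i <= b) ->
  bounded_n n (Tn_of_fin (fun _ => a)) (Tn_of_fin (fun _ => b)) (Tn_of_fin x).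
Proof.
  induction n as [|n IH]; intros H; simpl; [exact I|].
  split; [apply H|]. apply IH. intros i. apply H.
Qed.

Lemma close_Tn_of_fin {n : nat} (d : R) (x : Fin.t n -> R) (t : Compactness.Tn n R) :
  close_n n d (Tn_of_fin x) t -> forall i, Rabs (x i - fin_of_Tn t i) < d.
Proof.
  induction n as [|n IH]; intros H i; [now apply Fin.case0|].
  destruct t as [t0 t]. destruct H as [H0 H].
  refine (Fin.caseS' i (fun i => Rabs (x i - fin_of_Tn (n := S n) (t0, t) i) < d) H0 _).
  exact (IH _ _ H).
Qed.

(** A Lebesgue number of the box [0, 2 pi]^r gives uniform continuity, which in turn gives
    boundedness by joining any point of the box to the origin in a fixed number of short steps. *)
Lemma periodic_bounded_uc {E : CompleteNormedModule R_AbsRing} {r : nat}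
    (f : (Fin.t r -> R) -> E) :
  torus_periodic f ->
  (forall theta, continuous (T := fct_UniformSpace (Fin.t r) R_UniformSpace) f theta) ->
  bounded_uc f.
Proof.
  intros Pf Cf. pose proof PI_RGT_0 as PP.
  assert (U : forall e, 0 < e -> exists d, 0 < d /\
    forall x y : Fin.t r -> R, (forall i, Rabs (x i - y i) < d) ->
      norm (minus (f x) (f y)) <= e).
  { intros e Pe.
    assert (G : forall t : Compactness.Tn r R, exists d : posreal,
      forall x, (forall i, Rabs (x i - fin_of_Tn t i) < 2 * d) ->
        norm (minus (f x) (f (fin_of_Tn t))) < e / 2).
    { intros t.
      destruct (proj1 (filterlim_norm_iff (locally (T := fct_UniformSpace (Fin.t r)
        R_UniformSpace) (fin_of_Tn t)) f _) (Cf (fin_of_Tn t)) (e / 2) ltac:(lra))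
        as [d Hd].
      (* Half the radius of continuity: x is within delta of a center and y within delta of x, so
         both lie within twice delta of that center. *)
      exists (pos_div_2 d). intros x Hx. apply Hd. intros i.
      refine (Rlt_le_trans _ _ _ (Hx i) _). simpl. lra. }
    destruct (choice_function _ G) as [delta Hdelta].
    destruct (compactness_value r (Tn_of_fin (fun _ => 0)) (Tn_of_fin (fun _ => 2 * PI))
      delta) as [d Hd].
    exists d. split; [apply cond_pos|]. intros x y Hxy.
    (* Both points are shifted by the periods of x. The image of y may leave the box but stays close
       to x0, and only x0 has to lie in it. *)
    destruct (torus_reduce x) as [x0 [k [Hx0 Ex]]].
    assert (Ey : y = fun i => (y i - 2 * PI * IZR (k i)) + 2 * PI * IZR (k i))
      by (apply functional_extensionality; intros i; ring).
    rewrite Ex, Ey, (Pf x0 k), (Pf (fun i => y i - 2 * PI * IZR (k i)) k).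
    (* [compactness_value] yields its center under a double negation, hence a proof by
       contradiction. *)
    apply Rnot_lt_le. intros L.
    apply (Hd (Tn_of_fin x0) (bounded_Tn_of_fin _ _ _ Hx0)).
    intros [t [_ [Ht Hdt]]]. specialize (Hdelta t).
    assert (Hc := close_Tn_of_fin _ _ _ Ht).
    assert (H1 : norm (minus (f x0) (f (fin_of_Tn t))) < e / 2).
    { apply Hdelta. intros i. specialize (Hc i).
      pose proof (cond_pos (delta t)). lra. }
    assert (H2 : norm (minus (f (fun i => y i - 2 * PI * IZR (k i)))
      (f (fin_of_Tn t))) < e / 2).
    { apply Hdelta. intros i. specialize (Hc i). specialize (Hxy i).
      rewrite Ex in Hxy.
      replace (y i - 2 * PI * IZR (k i) - fin_of_Tn t i)
        with (- (x0 i + 2 * PI * IZR (k i) - y i) + (x0 i - fin_of_Tn t i)) by ring.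
      refine (Rle_lt_trans _ _ _ (Rabs_triang _ _) _). rewrite Rabs_Ropp. lra. }
    apply (Rlt_not_le _ _ L).
    norm_replace (minus (minus (f x0) (f (fin_of_Tn t)))
      (minus (f (fun i => y i - 2 * PI * IZR (k i))) (f (fin_of_Tn t)))); [|module].
    refine (Rle_trans _ _ _ (norm_minus_le (Rlt_le _ _ H1) (Rlt_le _ _ H2)) _). lra. }
  split; [|exact U].
  destruct (U 1 Rlt_0_1) as [d [Pd Hd]].
  (* The segment from the origin to a point of the box is cut into m + 1 steps; each coordinate
     moves by at most 2 pi / (m + 1) < d, so f changes by at most 1 per step. *)
  destruct (nfloor_ex (2 * PI / d)) as [m [_ Hm]];
    [left; apply Rdiv_lt_0_compat; lra|].
  assert (Pm : 0 < INR m + 1) by (pose proof (pos_INR m); lra).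
  exists (norm (f (fun _ => 0)) + (INR m + 1)). intros theta.
  destruct (torus_reduce theta) as [x [k [Hx ->]]]. rewrite Pf.
  assert (step : forall j : nat,
    norm (f (fun i => INR j * (x i / (INR m + 1)))) <= norm (f (fun _ => 0)) + INR j).
  { induction j as [|j IH].
    - simpl. rewrite Rplus_0_r. right. f_equal. f_equal.
      apply functional_extensionality. intros i. apply Rmult_0_l.
    - set (y := fun i => INR j * (x i / (INR m + 1))) in *.
      set (z := fun i => INR (S j) * (x i / (INR m + 1))).
      replace (f z) with (plus (f y) (minus (f z) (f y))) by module.
      rewrite S_INR.
      refine (Rle_trans _ _ _ (norm_plus_le IH (Hd z y _)) _); [|lra].
      intros i. unfold z, y. rewrite S_INR.
      replace ((INR j + 1) * (x i / (INR m + 1)) - INR j * (x i / (INR m + 1)))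
        with (x i / (INR m + 1)) by ring.
      destruct (Hx i) as [H1 H2].
      rewrite Rabs_pos_eq by (apply Rmult_le_pos; [lra|left; now apply Rinv_0_lt_compat]).
      apply Rmult_lt_reg_r with (INR m + 1); [exact Pm|].
      replace (x i / (INR m + 1) * (INR m + 1)) with (x i) by (field; lra).
      apply (Rmult_lt_compat_r d) in Hm; [|exact Pd].
      replace (2 * PI / d * d) with (2 * PI) in Hm by (field; lra). lra. }
  specialize (step (S m)). rewrite S_INR in step.
  replace x with (fun i => (INR m + 1) * (x i / (INR m + 1))); [exact step|].
  apply functional_extensionality. intros i. field. lra.
Qed.

(** An integer is coded as a difference of naturals, so the enumeration reaches every frequency but
    repeats them. *)
Fixpoint Zr_enum (r : nat) : nat -> Fin.t r -> Z :=
  match r with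
  | O => fun _ _ => 0%Z
  | S r => fun n =>
      let (p, q) := Cantor.of_nat n in
      let (x, y) := Cantor.of_nat p in
      zcons (Z.of_nat x - Z.of_nat y) (Zr_enum r q)
  end.

Lemma Zr_enum_surj (r : nat) (alpha : Fin.t r -> Z) : exists n, Zr_enum r n = alpha.
Proof.
  induction r as [|r IH].
  - exists O. apply functional_extensionality. intros i. now apply Fin.case0.
  - destruct (IH (fun i => alpha (Fin.FS i))) as [q Hq].
    exists (Cantor.to_nat (Cantor.to_nat
      (Z.to_nat (alpha Fin.F1), Z.to_nat (- alpha Fin.F1)), q)).
    cbn [Zr_enum]. rewrite !Cantor.cancel_of_to, Hq.
    rewrite <- (zcons_eta alpha) at 3. f_equal. lia.
Qed.

Lemma bounded_uc_plus {E : CompleteNormedModule R_AbsRing} {r : nat}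
    (f g : (Fin.t r -> R) -> E) :
  bounded_uc f -> bounded_uc g ->
  bounded_uc (fun theta => plus (f theta) (g theta)) /\
  torus_mean (fun theta => plus (f theta) (g theta))
  = plus (torus_mean f) (torus_mean g).
Proof.
  intros Hf Hg.
  assert (Ho : bounded_uc (fun theta => opp (g theta))).
  { assert (H := bounded_uc_minus _ _ (bounded_uc_const zero) Hg).
    replace (fun theta => opp (g theta)) with (fun theta => minus zero (g theta));
      [exact H|].
    apply functional_extensionality. intros x. module. }
  assert (E1 : (fun theta => plus (f theta) (g theta))
             = (fun theta => minus (f theta) (opp (g theta)))).
  { apply functional_extensionality. intros x. module. }
  rewrite E1. split; [now apply bounded_uc_minus|].
  refine (eq_trans (torus_mean_minus f _ Hf Ho) _).
  refine (eq_trans (f_equal (minus _) (torus_mean_linear opp g is_linear_opp Hg)) _).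
  module.
Qed.

Lemma Zdot_shift {r : nat} (alpha k : Fin.t r -> Z) (theta : Fin.t r -> R) :
  exists m : Z, Zdot alpha (fun i => theta i + 2 * PI * IZR (k i))
    = Zdot alpha theta + 2 * PI * IZR m.
Proof.
  unfold Zdot. induction r as [|r IH]; cbn [fin_sum].
  - exists 0%Z. ring.
  - destruct (IH (fun i => alpha (Fin.FS i)) (fun i => k (Fin.FS i))
      (fun i => theta (Fin.FS i))) as [m Hm].
    exists (alpha Fin.F1 * k Fin.F1 + m)%Z.
    rewrite Hm, plus_IZR, mult_IZR. ring.
Qed.

Lemma Zdot_opp {r : nat} (alpha : Fin.t r -> Z) (theta : Fin.t r -> R) :
  Zdot (fun i => (- alpha i)%Z) theta = - Zdot alpha theta.
Proof.
  unfold Zdot. rewrite <- (Rmult_1_l (fin_sum (fun i => IZR (alpha i) * theta i))).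
  rewrite Ropp_mult_distr_l, <- fin_sum_scal.
  apply fin_sum_ext. intros i. rewrite opp_IZR. ring.
Qed.

(** * Fourier inversion under absolute convergence *)

Section FourierInversion.
Context {Z : CompleteNormedModule C_AbsRing} {r : nat}.
Notation A := (End (ComplexBanach Z)).
Notation AN := (End_NormedModule (ComplexBanach Z)).
Notation AC := (End_CompleteNormedModule (ComplexBanach Z)).
Context (f : (Fin.t r -> R) -> A) (Pf : torus_periodic f)
  (Uf : bounded_uc (E := AC) f).
Let coef (alpha : Fin.t r -> BinInt.Z) : A :=
  torus_mean (E := AC) (fun theta => End_Cscal (cis (- Zdot alpha theta)) (f theta)).
Context (kappa N : R) (Pk : 0 <= kappa)
  (HN : forall l : list (Fin.t r -> BinInt.Z), NoDup l ->
     fold_right Rplus 0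
       (map (fun alpha => exp (kappa * Zlength1 alpha) * norm (coef alpha)) l) <= N).

Let e := Zr_enum r.
(** Since the enumeration repeats frequencies, only the first occurrence of each receives its
    coefficient. *)
Let first_occ (j : nat) : Prop := forall i, (i < j)%nat -> e i <> e j.
Let a_ (j : nat) : A :=
  if excluded_middle_informative (first_occ j) then coef (e j) else zero.
Let N_ (j : nat) : R := exp (kappa * Zlength1 (e j)) * norm (a_ j).

Lemma enum_coef_ge_0 (j : nat) : 0 <= N_ j.
Proof. apply Rmult_le_pos; [left; apply exp_pos|apply norm_ge_0]. Qed.

Lemma norm_enum_coef_le (j : nat) : norm (a_ j) <= N_ j.
Proof.
  unfold N_. pose proof (norm_ge_0 (a_ j)).
  assert (1 <= exp (kappa * Zlength1 (e j))).
  { rewrite <- exp_0. apply exp_le.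
    apply Rmult_le_pos; [exact Pk|apply Zlength1_ge_0]. }
  nra.
Qed.

(** A partial sum along the enumeration equals the sum over the duplicate-free list of frequencies
    met so far, to which the assumption on finite sums applies. *)
Lemma enum_coef_sum_le (m : nat) : sum_n N_ m <= N.
Proof.
  assert (H : exists l, NoDup l /\ (forall alpha, In alpha l -> exists i, (i <= m)%nat
      /\ e i = alpha) /\
    fold_right Rplus 0
       (map (fun alpha => exp (kappa * Zlength1 alpha) * norm (coef alpha)) l)
    = sum_n N_ m).
  { assert (Na0 : forall j, ~ first_occ j -> N_ j = 0).
    { intros j Hj. unfold N_, a_. destruct excluded_middle_informative; [contradiction|].
      rewrite <- (Rmult_0_r (exp (kappa * Zlength1 (e j)))). f_equal.
      exact (norm_zero (V := AN)). }
    assert (Na1 : forall j, first_occ j ->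
      N_ j = exp (kappa * Zlength1 (e j)) * norm (coef (e j))).
    { intros j Hj. unfold N_, a_. destruct excluded_middle_informative; [reflexivity|].
      contradiction. }
    induction m as [|m [l [ND [IN EL]]]].
    - exists (e 0%nat :: nil). split; [|split].
      + constructor; [intros []|constructor].
      + intros alpha [<-|[]]. now exists 0%nat.
      + rewrite sum_O, Na1; [simpl; ring|]. intros i Hi. lia.
    - destruct (excluded_middle_informative (first_occ (S m))) as [F|F].
      + exists (e (S m) :: l). split; [|split].
        * constructor; [|exact ND]. intros HI.
          destruct (IN _ HI) as [i [Hi Ei]]. apply (F i); [lia|exact Ei].
        * intros alpha [<-|HI]; [exists (S m); auto|].
          destruct (IN _ HI) as [i [Hi Ei]]. exists i. split; [lia|exact Ei].
        * rewrite sum_Sn, <- EL, Na1 by exact F. simpl. apply Rplus_comm.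
      + exists l. split; [exact ND|split].
        * intros alpha HI. destruct (IN _ HI) as [i [Hi Ei]].
          exists i. split; [lia|exact Ei].
        * rewrite sum_Sn, <- EL, Na0 by exact F. symmetry. apply Rplus_0_r. }
  destruct H as [l [ND [_ <-]]]. now apply HN.
Qed.

Let mode (j : nat) (theta : Fin.t r -> R) : A :=
  End_Cscal (cis (Zdot (e j) theta)) (a_ j).

Lemma norm_mode_le j theta : norm (mode j theta) <= N_ j.
Proof. exact (Rle_trans _ _ _ (norm_End_cis _ _) (norm_enum_coef_le j)). Qed.

Lemma bounded_uc_mode j : bounded_uc (E := AC) (mode j).
Proof. exact (bounded_uc_cis (e j) _ (bounded_uc_const (E := AC) (a_ j))). Qed.

Lemma bounded_uc_partial_sum m :
  bounded_uc (E := AC) (fun theta => sum_n (G := AC) (fun j => mode j theta) m).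
Proof.
  induction m as [|m IH].
  - replace (fun theta => sum_n (G := AC) (fun j => mode j theta) 0) with (mode 0);
      [apply bounded_uc_mode|].
    apply functional_extensionality. intros x. now rewrite sum_O.
  - replace (fun theta => sum_n (G := AC) (fun j => mode j theta) (S m))
      with (fun theta => plus (sum_n (G := AC) (fun j => mode j theta) m)
                              (mode (S m) theta)).
    + exact (proj1 (bounded_uc_plus (E := AC) _ _ IH (bounded_uc_mode (S m)))).
    + apply functional_extensionality. intros x. now rewrite sum_Sn.
Qed.

(** Multiplying by e^(i beta.theta) moves the frequency -beta to zero, and only the zero frequency
    has a nonzero mean. *)
Lemma torus_mean_partial_sum beta m :
  torus_mean (E := AC) (fun theta => End_Cscal (cis (Zdot beta theta))
    (sum_n (G := AC) (fun j => mode j theta) m))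
  = sum_n (G := AC) (fun j => if excluded_middle_informative
      (e j = fun i => (- beta i)%Z) then a_ j else zero) m.
Proof.
  assert (T : forall j, torus_mean (E := AC) (fun theta =>
      End_Cscal (cis (Zdot beta theta)) (mode j theta))
    = if excluded_middle_informative (e j = fun i => (- beta i)%Z)
      then a_ j else zero).
  { intros j.
    rewrite (torus_mean_ext (E := AC) _ (fun theta => End_Cscal
      (cis (Zdot (fun i => (beta i + e j i)%Z) theta)) (a_ j))).
    - destruct (torus_mean_mode (fun i => (beta i + e j i)%Z) (a_ j)) as [H0 H1].
      destruct excluded_middle_informative as [H|H].
      + apply H0. rewrite H. apply functional_extensionality. intros i. lia.
      + apply H1. intros H'. apply H. apply functional_extensionality. intros i.
        apply (f_equal (fun g => g i)) in H'. cbv beta in H'. lia.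
    - intros theta. unfold mode. rewrite End_Cscal_assoc, <- cis_plus, Zdot_plus.
      reflexivity. }
  induction m as [|m IH].
  - rewrite sum_O, <- T. apply torus_mean_ext. intros x. now rewrite sum_O.
  - rewrite sum_Sn, <- T, <- IH.
    refine (eq_trans _ (proj2 (bounded_uc_plus (E := AC) _ _
      (bounded_uc_cis beta _ (bounded_uc_partial_sum m))
      (bounded_uc_cis beta _ (bounded_uc_mode (S m)))))).
    apply torus_mean_ext. intros x. rewrite sum_Sn. apply End_Cscal_plus_r.
Qed.

(** Exactly one index is the first occurrence of alpha; from there on the partial sums are
    constant. *)
Lemma partial_sum_coef (alpha : Fin.t r -> BinInt.Z) :
  exists m0, forall m, (m0 <= m)%nat ->
    sum_n (G := AC) (fun j => if excluded_middle_informative (e j = alpha)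
      then a_ j else zero) m = coef alpha.
Proof.
  destruct (Zr_enum_surj r alpha) as [n Hn].
  (* The least index, by strong induction. *)
  assert (E0 : exists j, e j = alpha /\ first_occ j).
  { revert Hn. induction n as [n IH] using (well_founded_induction lt_wf). intros Hn.
    destruct (excluded_middle_informative (first_occ n)) as [F|F]; [now exists n|].
    destruct (excluded_middle_informative
      (exists i, (i < n)%nat /\ e i = e n)) as [[i [Hi Ei]]|Hi].
    - apply (IH i Hi). now rewrite <- Hn.
    - exfalso. apply F. intros i Hin Ei. apply Hi. now exists i. }
  destruct E0 as [j0 [Ej0 Fj0]]. exists j0.
  assert (U : forall j, (if excluded_middle_informative (e j = alpha)
      then a_ j else zero) = if Nat.eqb j j0 then coef alpha else zero).
  { intros j. destruct (excluded_middle_informative (e j = alpha)) as [H|H].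
    - destruct (Nat.eqb_spec j j0) as [->|D].
      + unfold a_. destruct excluded_middle_informative; [now rewrite H|contradiction].
      + unfold a_. destruct excluded_middle_informative as [F|F]; [exfalso|reflexivity].
        destruct (Nat.lt_total j j0) as [L|[L|L]]; [|contradiction|].
        * apply (Fj0 j L). now rewrite Ej0.
        * apply (F j0 L). now rewrite Ej0.
    - destruct (Nat.eqb_spec j j0) as [->|D]; [contradiction|reflexivity]. }
  intros m Hm.
  rewrite (sum_n_ext (G := AC) _ (fun j => if Nat.eqb j j0 then coef alpha else zero))
    by exact U.
  assert (L0 : forall k, (k < j0)%nat ->
    sum_n (G := AC) (fun j => if Nat.eqb j j0 then coef alpha else zero) k = zero).
  { induction k as [|k IH]; intros Hk.
    - rewrite sum_O. destruct (Nat.eqb_spec 0 j0); [lia|reflexivity].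
    - rewrite sum_Sn, IH by lia. destruct (Nat.eqb_spec (S k) j0); [lia|].
      exact (plus_zero_l (G := AC) _). }
  induction Hm as [|m Hm IH].
  - destruct j0 as [|j]; [now rewrite sum_O|].
    rewrite sum_Sn, L0, Nat.eqb_refl by lia. exact (plus_zero_l (G := AC) _).
  - rewrite sum_Sn, IH. destruct (Nat.eqb_spec (S m) j0); [lia|].
    exact (plus_zero_r (G := AC) _).
Qed.

(** The dominated series has a sum S, a periodic uniform limit of trigonometric polynomials. S and f
    have the same coefficients, so they agree by uniqueness. *)
Lemma fourier_series_sum (theta : Fin.t r -> R) :
  is_series (V := AN) (fun j => mode j theta) (f theta).
Proof.
  assert (ES : forall x, exists s : A, is_series (V := AN) (fun j => mode j x) s).
  { intros x. exact (ex_series_dominated (V := AC) N_ N enum_coef_ge_0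
      enum_coef_sum_le (fun j => mode j x) (fun j => norm_mode_le j x)). }
  destruct (choice_function _ ES) as [S HS].
  assert (tail : forall d, 0 < d -> exists m0, forall m, (m0 <= m)%nat -> forall x,
    norm (minus (S x) (sum_n (G := AC) (fun j => mode j x) m)) <= d).
  { intros d Pd. destruct (dominated_series_tail (V := AC) N_ N enum_coef_ge_0
      enum_coef_sum_le d Pd) as [m0 Hm0].
    exists m0. intros m Hm x. apply (Hm0 m Hm (fun j => mode j x)).
    - intros j. apply norm_mode_le.
    - apply HS. }
  assert (US : bounded_uc (E := AC) S).
  { apply (bounded_uc_uniform_limit (E := AC)). intros d Pd.
    destruct (tail d Pd) as [m Hm]. specialize (Hm m (le_n m)).
    exists (fun x => sum_n (G := AC) (fun j => mode j x) m).
    split; [apply bounded_uc_partial_sum|exact Hm]. }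
  assert (PS : torus_periodic S).
  { intros x k. apply (filterlim_locally_unique (F := eventually) (V := AN)
      (sum_n (fun j => mode j x))); [|apply HS].
    apply (is_series_ext (V := AN)
      (fun j => mode j (fun i => x i + 2 * PI * IZR (k i)))); [|apply HS].
    intros j. unfold mode. destruct (Zdot_shift (e j) k x) as [m ->].
    now rewrite cis_plus, cis_2PI_Z, Cmult_1_r. }
  replace (f theta) with (S theta); [apply HS|].
  symmetry. apply minus_zero_eq.
  apply (fourier_unique (fun x => minus (f x) (S x))).
  - intros x k. now rewrite Pf, PS.
  - exact (bounded_uc_minus (E := AC) _ _ Uf US).
  - intros beta. set (alpha := fun i => (- beta i)%Z).
    assert (E1 : torus_mean (E := AC) (fun x =>
      End_Cscal (cis (Zdot beta x)) (f x)) = coef alpha).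
    { apply (torus_mean_ext (E := AC)). intros x. unfold alpha.
      now rewrite Zdot_opp, Ropp_involutive. }
    assert (E2 : torus_mean (E := AC) (fun x =>
      End_Cscal (cis (Zdot beta x)) (S x)) = coef alpha).
    (* The coefficient of S differs by at most d from that of a far partial sum, which is exactly
       [coef alpha]. *)
    { apply minus_zero_eq. apply (norm_small_zero _ AN _ 1). intros d Pd.
      rewrite Rmult_1_r. destruct (tail d Pd) as [m1 Hm1].
      destruct (partial_sum_coef alpha) as [m0 Hm0].
      set (m := Nat.max m0 m1).
      specialize (Hm0 m ltac:(lia)). specialize (Hm1 m ltac:(lia)).
      rewrite <- (eq_trans (torus_mean_partial_sum beta m) Hm0).
      refine (Rle_trans _ _ _ (Req_le _ _ (f_equal norm (eq_sym (torus_mean_minus (E := AC)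
        _ _ (bounded_uc_cis beta S US)
        (bounded_uc_cis beta _ (bounded_uc_partial_sum m)))))) _).
      apply (norm_torus_mean_le (E := AC)).
      - exact (bounded_uc_minus (E := AC) _ _ (bounded_uc_cis beta S US)
          (bounded_uc_cis beta _ (bounded_uc_partial_sum m))).
      - intros x. refine (Rle_trans _ _ _ (Req_le _ _ (f_equal norm (eq_sym
          (linear_minus (U := AN) (V := AN) _ _ _ (is_linear_End_Cscal _))))) _).
        exact (Rle_trans _ _ _ (norm_End_cis _ _) (Hm1 x)). }
    rewrite (torus_mean_ext (E := AC) _ (fun x =>
      minus (End_Cscal (cis (Zdot beta x)) (f x)) (End_Cscal (cis (Zdot beta x)) (S x))))
      by (intros x; exact (linear_minus (U := AN) (V := AN) _
            (f x) (S x) (is_linear_End_Cscal _))).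
    refine (eq_trans (torus_mean_minus (E := AC) _ _ (bounded_uc_cis beta f Uf)
      (bounded_uc_cis beta S US)) _).
    rewrite E1, E2. module.
Qed.

Lemma wiener_of_fourier (omega : Fin.t r -> R) :
  wiener omega kappa (fun t => f (fun i => omega i * t)) N.
Proof.
  apply (wiener_series omega kappa
    (fun j t => End_Cscal (cis (Zdot (e j) omega * t)) (a_ j)) N_).
  - intros j. apply wiener_mode. apply Rle_refl.
  - exact enum_coef_sum_le.
  - intros t _. apply (is_series_ext (V := AN)
      (fun j => mode j (fun i => omega i * t))); [|apply fourier_series_sum].
    intros j. unfold mode. now rewrite Zdot_scal.
Qed.
End FourierInversion.

(** * Quasi-periodic operators *)

Lemma is_avg_linear {V W : CompleteNormedModule R_AbsRing} (i : V -> W)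
    (f : R -> V) (L : V) :
  is_linear i -> continuous_on Rnonneg f -> is_avg f L ->
  is_avg (fun t => i (f t)) (i L).
Proof.
  intros Hi Cf HL. apply is_avg_iff. intros e Pe.
  destruct (linear_norm i Hi) as [M [PM HM]].
  destruct (proj1 (is_avg_iff f L) HL (e / M) ltac:(now apply Rdiv_lt_0_compat))
    as [T [PT HT]].
  exists T. split; [exact PT|]. intros t Ht. specialize (HT t Ht).
  rewrite (RInt_linear i Hi f t Cf) by lra.
  refine (Rle_lt_trans _ _ _ (Req_le _ _ (f_equal norm
    (eq_trans (f_equal (fun x => minus x (i L)) (eq_sym (linear_scal i Hi _ _)))
              (eq_sym (linear_minus i _ _ Hi))))) _).
  refine (Rle_lt_trans _ _ _ (HM _) _).
  apply (Rmult_lt_compat_l M) in HT; [|exact PM].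
  replace (M * (e / M)) with e in HT by (field; lra). exact HT.
Qed.

(** Origin of [c_I]: the maximum of x^nu exp(-delta x) over x > 0 is (nu / (delta e))^nu, reached at
    x = nu / delta; it is divided by c_D and replaced by 1 if smaller. For nu = 0 the exponential is
    simply bounded by 1. *)
Lemma small_divisors_diophantine {r : nat} (omega : Fin.t r -> R) (cD nu delta : R) :
  (1 <= r)%nat -> diophantine omega cD nu -> 0 < delta ->
  small_divisors omega delta (c_I cD nu delta).
Proof.
  intros Hr [PcD [Hnu [HD _]]] Pd.
  assert (Pnu : 0 <= nu) by (apply le_INR in Hr; simpl in Hr; lra).
  assert (K1 : 1 <= c_I cD nu delta)
    by (unfold c_I; destruct Req_EM_T; apply Rmax_l).
  split; [exact K1|]. intros alpha Ha.
  pose proof (Zlength1_ge_1 alpha Ha) as HL. set (L := Zlength1 alpha) in *.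
  specialize (HD alpha Ha). fold L in HD.
  assert (PR : 0 < Rpower L nu) by apply exp_pos.
  assert (PQ : 0 < cD / Rpower L nu) by now apply Rdiv_lt_0_compat.
  split.
  { intros E. rewrite E, Rabs_R0 in HD. lra. }
  apply Rle_trans with (c_I cD nu delta * (cD / Rpower L nu));
    [|apply Rmult_le_compat_l; lra].
  apply Rmult_le_reg_r with (Rpower L nu); [exact PR|].
  replace (c_I cD nu delta * (cD / Rpower L nu) * Rpower L nu)
    with (c_I cD nu delta * cD) by (field; lra).
  unfold c_I. destruct (Req_EM_T nu 0) as [E|E].
  - rewrite E, Rpower_O by lra. rewrite Rmult_1_r.
    apply Rle_trans with (/ cD * cD).
    + rewrite Rinv_l by lra. rewrite <- exp_0. apply exp_le. nra.
    + apply Rmult_le_compat_r; [lra|apply Rmax_r].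
  - apply Rle_trans with (/ cD * Rpower (nu / (delta * exp 1)) nu * cD);
      [|apply Rmult_le_compat_r; [lra|apply Rmax_r]].
    replace (/ cD * Rpower (nu / (delta * exp 1)) nu * cD)
      with (Rpower (nu / (delta * exp 1)) nu) by (field; lra).
    unfold Rpower. rewrite <- exp_plus. apply exp_le.
    pose proof (exp_pos 1) as P1.
    (* This is [ln x <= x - 1] at [x = delta L / nu]. *)
    assert (Elog : ln (nu / (delta * exp 1)) = ln L - ln (delta * L / nu) - 1).
    { unfold Rdiv. rewrite !ln_mult, !ln_Rinv, ln_mult, ln_exp;
        try apply Rinv_0_lt_compat; try nra; try ring. }
    assert (Hln : ln (delta * L / nu) <= delta * L / nu - 1).
    { assert (Px : 0 < delta * L / nu) by (apply Rdiv_lt_0_compat; nra).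
      pose proof (exp_ineq1_le (ln (delta * L / nu))) as H.
      rewrite exp_ln in H by exact Px. lra. }
    rewrite Elog.
    assert (E2 : nu * (delta * L / nu) = delta * L) by (field; lra).
    nra.
Qed.

Lemma norm_minus_End_cplx {X : Banach} (A B : End X) :
  norm (minus (End_cplx A) (End_cplx B)) = norm (minus A B).
Proof. rewrite <- End_cplx_minus. apply norm_End_cplx. Qed.

(** * Transfer of the algebra to operators on the original space *)

Section QuasiPeriodicOperators.
Context {X : Banach} {r : nat} (omega : Fin.t r -> R).
Notation ER := (End_CompleteNormedModule X).
Notation EC := (End_CompleteNormedModule (ComplexBanach (cplx_space X))).

(** Read through complexification, so that real and complex X are treated alike; for complex X,
    [End_cplx] is the identity. *)
Definition quasi (kappa : R) (phi : R -> End X) (N : R) : Prop :=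
  wiener omega kappa (fun t => End_cplx (phi t)) N.

Lemma quasi_bound kappa phi N :
  0 <= kappa -> quasi kappa phi N ->
  0 <= N /\ forall t, 0 <= t -> norm (phi t) <= N.
Proof.
  intros Pk H. destruct (wiener_bound omega _ _ _ Pk H) as [PN HN].
  split; [exact PN|]. intros t Pt.
  exact (Rle_trans _ _ _ (Req_le _ _ (eq_sym (norm_End_cplx (phi t)))) (HN t Pt)).
Qed.

Lemma quasi_continuous kappa phi N :
  0 <= kappa -> quasi kappa phi N -> continuous_on Rnonneg phi.
Proof.
  intros Pk H. apply (wiener_continuous omega _ _ _ Pk) in H.
  apply (continuous_on_iff (V := ER) phi). intros t Pt e Pe.
  destruct (proj1 (continuous_on_iff (V := EC) _) H t Pt e Pe) as [d [Pd Hd]].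
  exists d. split; [exact Pd|]. intros s Ps Hs. specialize (Hd s Ps Hs).
  exact (Rle_lt_trans _ _ _ (Req_le _ _ (eq_sym (norm_minus_End_cplx _ _))) Hd).
Qed.

Lemma quasi_ext_le kappa phi psi N M :
  0 <= kappa -> (forall t, 0 <= t -> phi t = psi t) -> N <= M ->
  quasi kappa phi N -> quasi kappa psi M.
Proof.
  intros Pk E L. apply wiener_ext_le; [exact Pk| |exact L].
  intros t Pt. now rewrite E.
Qed.

Lemma quasi_weaken kappa kappa' phi N :
  0 <= kappa' <= kappa -> quasi kappa phi N -> quasi kappa' phi N.
Proof. apply wiener_weaken. Qed.

Lemma quasi_const kappa (B : End X) N :
  0 <= kappa -> norm B <= N -> quasi kappa (fun _ => B) N.
Proof.
  intros Pk H. apply (wiener_const omega kappa (End_cplx B)); [exact Pk|].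
  exact (Rle_trans _ _ _ (Req_le _ _ (norm_End_cplx B)) H).
Qed.

Lemma quasi_plus kappa phi psi N M :
  0 <= kappa -> quasi kappa phi N -> quasi kappa psi M ->
  quasi kappa (fun t => plus (phi t) (psi t)) (N + M).
Proof.
  intros Pk H1 H2.
  apply (wiener_ext_le omega kappa
    (fun t => plus (End_cplx (phi t)) (End_cplx (psi t))) _ (N + M)).
  - exact Pk.
  - intros t _. symmetry. apply End_cplx_plus.
  - apply Rle_refl.
  - now apply wiener_plus.
Qed.

Lemma quasi_comp kappa phi psi N M :
  0 <= kappa -> quasi kappa phi N -> quasi kappa psi M ->
  quasi kappa (fun t => End_comp (phi t) (psi t)) (N * M).
Proof.
  intros Pk H1 H2.
  apply (wiener_ext_le omega kappa
    (fun t => End_comp (End_cplx (phi t)) (End_cplx (psi t))) _ (N * M)).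
  - exact Pk.
  - intros t _. symmetry. apply End_cplx_comp.
  - apply Rle_refl.
  - now apply wiener_mult.
Qed.

(** Multiplication by k is composition with the constant operator k id, so it is a case of the
    product. *)
Lemma quasi_scal kappa (k : R) phi N :
  0 <= kappa -> quasi kappa phi N ->
  quasi kappa (fun t => scal k (phi t)) (Rabs k * N).
Proof.
  intros Pk H.
  apply (quasi_ext_le kappa (fun t => End_comp (scal k End_id) (phi t)) _
    (Rabs k * N)); [exact Pk| |apply Rle_refl|].
  - intros t _. refine (eq_trans (bil_scal_l _ bilinear_End_comp k End_id (phi t)) _).
    now rewrite End_comp_id_l.
  - apply quasi_comp; [exact Pk| |exact H]. apply quasi_const; [exact Pk|].
    rewrite <- (Rmult_1_r (Rabs k)).
    exact (norm_scal_le (V := ER) k (Rle_refl _) norm_End_id).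
Qed.

Lemma quasi_minus kappa phi psi N M :
  0 <= kappa -> quasi kappa phi N -> quasi kappa psi M ->
  quasi kappa (fun t => minus (phi t) (psi t)) (N + M).
Proof.
  intros Pk H1 H2.
  apply (quasi_ext_le kappa (fun t => plus (phi t) (scal (-1) (psi t))) _
    (N + Rabs (-1) * M)).
  - exact Pk.
  - intros t _. module.
  - rewrite Rabs_left by lra. lra.
  - apply quasi_plus; [exact Pk|exact H1|]. now apply quasi_scal.
Qed.

(** L' is not known beforehand to be the complexification of an operator. The means of phi are
    Cauchy because [End_cplx] is isometric; completeness provides their limit, and uniqueness
    identifies its image with L'. *)
Lemma is_avg_descend (phi : R -> End X) (L' : End (ComplexBanach (cplx_space X))) :
  continuous_on Rnonneg phi ->
  is_avg (V := EC) (fun t => End_cplx (phi t)) L' ->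
  exists L, End_cplx L = L' /\ is_avg (V := ER) phi L.
Proof.
  intros Cf HL'.
  assert (EI : forall t, 0 <= t ->
    RInt (V := EC) (fun s => End_cplx (phi s)) 0 t = End_cplx (RInt (V := ER) phi 0 t)).
  { intros t Pt. exact (RInt_linear (V := ER) (W := EC) End_cplx is_linear_End_cplx
      phi t Cf Pt). }
  assert (EL : exists L : ER, is_avg (V := ER) phi L).
  { apply (filterlim_locally_cauchy (U := ER) (F := Rbar_locally p_infty)
      (fun tau => scal (/ tau) (RInt (V := ER) phi 0 tau))).
    intros e.
    destruct (proj1 (is_avg_iff (V := EC) _ L') HL' (e / 2)
      ltac:(pose proof (cond_pos e); lra)) as [T [PT HT]].
    exists (fun t => T < t). split; [now exists T|]. intros u v Hu Hv.
    assert (HS : forall t, T < t -> norm (minus (End_cplx (scal (/ t)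
      (RInt (V := ER) phi 0 t))) L') < e / 2).
    { intros t Ht. refine (Rle_lt_trans _ _ _ (Req_le _ _ (f_equal
        (fun x => norm (minus x L')) _)) (HT t Ht)).
      refine (eq_trans (End_cplx_scal _ _) (f_equal (scal (/ t)) (eq_sym (EI t _)))).
      lra. }
    assert (Hu' := HS u Hu). assert (Hv' := HS v Hv).
    apply (norm_compat1 (V := ER)).
    refine (Rle_lt_trans _ _ _ (Req_le _ _ (eq_sym (norm_minus_End_cplx _ _))) _).
    norm_replace (minus (minus (End_cplx (scal (/ v) (RInt (V := ER) phi 0 v))) L')
      (minus (End_cplx (scal (/ u) (RInt (V := ER) phi 0 u))) L')); [|module].
    refine (Rle_lt_trans _ (e / 2 + norm (minus (End_cplx (scal (/ u)
      (RInt (V := ER) phi 0 u))) L')) _ _ _).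
    - exact (norm_minus_le (V := EC) (Rlt_le _ _ Hv') (Rle_refl _)).
    - apply Rlt_le_trans with (e / 2 + e / 2); [|lra]. now apply Rplus_lt_compat_l. }
  destruct EL as [L HL]. exists L. split; [|exact HL].
  apply (is_avg_unique (V := EC) (fun t => End_cplx (phi t))); [|exact HL'].
  exact (is_avg_linear (V := ER) (W := EC) End_cplx phi L is_linear_End_cplx Cf HL).
Qed.

(** The primitive F' found among complexified operators need not come from End(X), so it is rebuilt
    there: psi(t) = int_0^t phi - t L has complexification F' - F'(0), whose average -F'(0) descends
    to some m, and psi - m complexifies to F'. *)
Lemma quasi_primitive kappa delta K phi N :
  0 <= kappa -> 0 < delta -> small_divisors omega delta K ->
  quasi (kappa + delta) phi N ->
  exists (L : End X) (F : R -> End X), norm L <= N /\ is_avg (V := ER) phi L /\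
    quasi kappa F (K * N) /\ is_avg (V := ER) F zero /\
    forall t, 0 <= t ->
      RInt (V := ER) phi 0 t = plus (minus (F t) (F 0)) (scal t L).
Proof.
  intros Pk Pd SD H.
  assert (Pkd : 0 <= kappa + delta) by lra.
  assert (Cf := quasi_continuous _ _ _ Pkd H).
  destruct (wiener_primitive omega kappa delta K _ N Pk Pd SD H)
    as [L' [F' [NL [WF [AF EF]]]]].
  assert (AL' : is_avg (V := EC) (fun t => End_cplx (phi t)) L').
  { apply (is_avg_primitive (V := EC) _ F' L' (K * N) EF).
    apply (wiener_bound omega _ _ _ Pk WF). }
  destruct (is_avg_descend phi L' Cf AL') as [L [EL AL]].
  set (psi := fun t => minus (RInt (V := ER) phi 0 t) (scal t L) : End X).
  assert (Cpsi : continuous_on Rnonneg psi).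
  { apply (continuous_on_minus (V := ER) (fun t => RInt (V := ER) phi 0 t)
      (fun t => scal t L)).
    - now apply (continuous_on_RInt (V := ER)).
    - apply (is_derive_on_continuous (V := ER) _ (fun _ => L)). intros t Pt.
      apply is_derive_on_of_is_derive; [exact Pt|].
      exact (eq_rect _ (is_derive (V := ER) (fun t => scal t L) t)
        (is_derive_scal_l (V := ER) (fun t => t) t 1 L (is_derive_id t)) _
        (scal_one (V := ER) L)). }
  assert (Epsi : forall t, 0 <= t -> End_cplx (psi t) = minus (F' t) (F' 0)).
  { intros t Pt. refine (eq_trans (End_cplx_minus _ _) _).
    refine (eq_trans (f_equal (minus _) (End_cplx_scal t L)) _). rewrite EL.
    refine (eq_trans (f_equal (fun x => minus x _) (eq_trans (eq_sym (RInt_linear (V := ER)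
      (W := EC) End_cplx is_linear_End_cplx phi t Cf Pt)) (EF t Pt))) _).
    module. }
  assert (Apsi : is_avg (V := EC) (fun t => End_cplx (psi t)) (minus zero (F' 0))).
  { apply (is_avg_ext (V := EC) (fun t => minus (F' t) (F' 0))).
    - intros t Pt. symmetry. now apply Epsi.
    - apply (is_avg_minus (V := EC) F' (fun _ => F' 0)).
      + exact (wiener_continuous omega _ _ _ Pk WF).
      + apply (continuous_on_cst (V := EC)).
      + exact AF.
      + apply (is_avg_const (V := EC)). }
  destruct (is_avg_descend psi _ Cpsi Apsi) as [m [Em Am]].
  exists L, (fun t => minus (psi t) m). split; [|split; [exact AL|split; [|split]]].
  - refine (Rle_trans _ _ _ (Req_le _ _ (eq_sym (norm_End_cplx L))) _).
    now rewrite EL.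
  - apply (wiener_ext_le omega kappa F' _ (K * N)); [exact Pk| |apply Rle_refl|exact WF].
    intros t Pt. symmetry. refine (eq_trans (End_cplx_minus _ _) _).
    rewrite Epsi, Em by exact Pt. module.
  - replace (zero : ER) with (minus m m : ER) by (symmetry; module).
    apply (is_avg_minus (V := ER) psi (fun _ => m)); [exact Cpsi| |exact Am|].
    + apply (continuous_on_cst (V := ER)).
    + apply (is_avg_const (V := ER)).
  - intros t Pt. unfold psi. rewrite RInt_point.
    refine (eq_trans (y := plus (minus (RInt (V := ER) phi 0 t) (scal t L))
      (scal t L)) _ _); [module|].
    f_equal. module.
Qed.

Lemma quasi_of_E_norm kappa (a : R -> End X) (Na : R) :
  0 <= kappa -> is_E_norm omega kappa a Na -> quasi kappa a Na.
Proof.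
  intros Pk [phis [phif [Ns [Nf [[Ps [Cs Ls]] [[Cf Lf] [Ea ->]]]]]]].
  apply (quasi_ext_le kappa (fun t => plus (phis (fun i => omega i * t)) (phif t)) _
    (Ns + Nf)); [exact Pk| |apply Rle_refl|].
  { intros t Pt. symmetry. now apply Ea. }
  apply quasi_plus; [exact Pk| |].
  - assert (Us := periodic_bounded_uc (E := ER) phis Ps Cs).
    apply (wiener_of_fourier (fun theta => End_cplx (phis theta))).
    + intros theta k. now rewrite Ps.
    + destruct Us as [[B HB] U]. split.
      * exists B. intros x.
        exact (Rle_trans _ _ _ (Req_le _ _ (norm_End_cplx _)) (HB x)).
      * intros e Pe. destruct (U e Pe) as [d [Pd Hd]]. exists d.
        split; [exact Pd|]. intros x y Hxy.
        exact (Rle_trans _ _ _ (Req_le _ _ (norm_minus_End_cplx _ _)) (Hd x y Hxy)).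
    + exact Pk.
    + intros l ND. apply Ls. exists l. split; [exact ND|]. f_equal.
      apply map_ext. intros alpha. f_equal. f_equal. unfold fourier_coef.
      apply torus_mean_ext. intros theta.
      unfold cis. now rewrite cos_neg, sin_neg.
  - apply wiener_flat.
    + exact (continuous_on_linear (V := ER) (W := EC) End_cplx is_linear_End_cplx
        phif Cf).
    + intros t Pt. refine (Rle_trans _ _ _ (Req_le _ _ (norm_End_cplx _)) _).
      assert (H : exp t * norm (phif t) <= Nf) by (apply Lf; exists t; auto).
      pose proof (exp_pos t). rewrite exp_Ropp.
      apply Rmult_le_reg_l with (exp t); [assumption|].
      replace (exp t * (Nf * / exp t)) with Nf by (field; lra). exact H.
Qed.
End QuasiPeriodicOperators.

(** * Picard iterates *)

Section AveragedPrimitive.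
Context {X : Banach}.
Notation ER := (End_CompleteNormedModule X).

Definition centered_primitive (psi : R -> End X) (t : R) : End X :=
  minus (RInt (V := ER) psi 0 t)
        (time_average (V := ER) (fun s => RInt (V := ER) psi 0 s)).

Lemma is_derive_centered_primitive psi t :
  continuous_on Rnonneg psi -> 0 <= t ->
  is_derive_on Rnonneg (centered_primitive psi) t (psi t).
Proof.
  intros C Pt.
  refine (eq_rect _ (is_derive_on (V := ER) Rnonneg (centered_primitive psi) t)
    (is_derive_on_minus (V := ER) _ _ t _ _ (is_derive_on_RInt (V := ER) psi t C Pt)
      (is_derive_on_const (V := ER) _ t Pt)) _ _).
  exact (minus_zero_r _).
Qed.

Lemma centered_primitive_zero t : centered_primitive (fun _ => zero) t = zero.
Proof.
  assert (E : forall s, RInt (V := ER) (fun _ => zero) 0 s = zero).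
  { intros s. rewrite (RInt_const_nonneg (V := ER)). exact (scal_zero_r (V := ER) s). }
  unfold centered_primitive. rewrite E.
  rewrite (time_average_is_avg (V := ER) _ zero); [module|].
  apply (is_avg_ext (V := ER) (fun _ => zero)); [intros s _; now rewrite E|].
  apply (is_avg_const (V := ER)).
Qed.

Lemma centered_primitive_minus psi1 psi2 m1 m2 t :
  continuous_on Rnonneg psi1 -> continuous_on Rnonneg psi2 ->
  is_avg (V := ER) (fun s => RInt (V := ER) psi1 0 s) m1 ->
  is_avg (V := ER) (fun s => RInt (V := ER) psi2 0 s) m2 -> 0 <= t ->
  centered_primitive (fun s => minus (psi1 s) (psi2 s)) t
  = minus (centered_primitive psi1 t) (centered_primitive psi2 t).
Proof.
  intros C1 C2 A1 A2 Pt. unfold centered_primitive.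
  rewrite (time_average_is_avg (V := ER) _ _ A1), (time_average_is_avg (V := ER) _ _ A2).
  rewrite (time_average_is_avg (V := ER) _ (minus m1 m2)).
  - refine (eq_trans (f_equal (fun x => minus x _)
      (RInt_minus_fun_nonneg (V := ER) psi1 psi2 t C1 C2 Pt)) _). module.
  - apply (is_avg_ext (V := ER)
      (fun s => minus (RInt (V := ER) psi1 0 s) (RInt (V := ER) psi2 0 s))).
    + intros s Ps. symmetry. exact (RInt_minus_fun_nonneg (V := ER) psi1 psi2 s C1 C2 Ps).
    + exact (is_avg_minus (V := ER) _ _ _ _ (continuous_on_RInt (V := ER) _ C1)
        (continuous_on_RInt (V := ER) _ C2) A1 A2).
Qed.

(** A zero average removes the drift t L, and the normalization singles out F. The existence of m is
    recorded because the total [time_average] of the primitive is meaningless without it, for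
    instance when two primitives are subtracted. *)
Lemma quasi_centered_primitive {r : nat} (omega : Fin.t r -> R) kappa delta K psi N :
  0 <= kappa -> 0 < delta -> small_divisors omega delta K ->
  quasi omega (kappa + delta) psi N -> is_avg (V := ER) psi zero ->
  quasi omega kappa (centered_primitive psi) (K * N) /\
  is_avg (V := ER) (centered_primitive psi) zero /\
  exists m, is_avg (V := ER) (fun s => RInt (V := ER) psi 0 s) m.
Proof.
  intros Pk Pd SD H A0.
  destruct (quasi_primitive omega kappa delta K psi N Pk Pd SD H)
    as [L [F [_ [AL [QF [AF EF]]]]]].
  assert (EL : L = zero) by exact (is_avg_unique (V := ER) psi _ _ AL A0).
  assert (EI : forall t, 0 <= t -> RInt (V := ER) psi 0 t = minus (F t) (F 0)).
  { intros t Pt. rewrite EF, EL by exact Pt.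
    refine (eq_trans (f_equal (plus _) (scal_zero_r (V := ER) t)) _).
    apply plus_zero_r. }
  assert (CF := quasi_continuous omega _ _ _ Pk QF).
  assert (Am : is_avg (V := ER) (fun s => RInt (V := ER) psi 0 s) (minus zero (F 0))).
  { apply (is_avg_ext (V := ER) (fun s => minus (F s) (F 0))).
    - intros t Pt. symmetry. now apply EI.
    - exact (is_avg_minus (V := ER) F (fun _ => F 0) _ _ CF
        (continuous_on_cst (V := ER) (F 0)) AF (is_avg_const (V := ER) (F 0))). }
  assert (EJ : forall t, 0 <= t -> F t = centered_primitive psi t).
  { intros t Pt. unfold centered_primitive.
    rewrite (time_average_is_avg (V := ER) _ _ Am), EI by exact Pt. module. }
  split; [|split].
  - exact (quasi_ext_le omega kappa F _ (K * N) _ Pk EJ (Rle_refl _) QF).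
  - exact (is_avg_ext (V := ER) F _ _ EJ AF).
  - now exists (minus zero (F 0)).
Qed.
End AveragedPrimitive.

Section PicardIterates.
Context {X : Banach} {r : nat} (omega : Fin.t r -> R).
Notation ER := (End_CompleteNormedModule X).
Context (a : R -> End X) (delta K M c : R) (n : nat).
Context (Pdelta : 0 < delta) (SD : small_divisors omega delta K) (PM : 0 < M)
  (Hc : 0 < c < 1).

(** The width left after k steps: it starts at (n + 1) delta and reaches 0 at k = n + 1. *)
Definition width (k : nat) : R := (INR (S n) - INR k) * delta.

Context (Qa : quasi omega (width 0) a M).

Definition eps_max : R := c / (K * ((2 + c) * (1 + c)) * M).

Lemma K_ge_1 : 1 <= K.
Proof. exact (proj1 SD). Qed.

Lemma eps_max_spec : 0 < eps_max /\ eps_max * (K * (M * ((2 + c) * (1 + c)))) = c.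
Proof.
  pose proof K_ge_1. assert (0 < K * ((2 + c) * (1 + c)) * M).
  { apply Rmult_lt_0_compat; [|lra]. apply Rmult_lt_0_compat; [lra|nra]. }
  unfold eps_max. split; [apply Rdiv_lt_0_compat; lra|]. field.
  repeat split; lra.
Qed.

Lemma width_S k : width k = width (S k) + delta.
Proof. unfold width. rewrite (S_INR k). ring. Qed.

Lemma width_ge_0 k : (k <= S n)%nat -> 0 <= width k.
Proof.
  intros H. apply le_INR in H. unfold width. apply Rmult_le_pos; lra.
Qed.

Lemma width_decr j k : (j <= k)%nat -> width k <= width j.
Proof.
  intros H. apply le_INR in H. unfold width. apply Rmult_le_compat_r; lra.
Qed.

Lemma quasi_a k : (k <= S n)%nat -> quasi omega (width k) a M.
Proof.
  intros H. apply (quasi_weaken omega (width 0)); [|exact Qa].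
  split; [now apply width_ge_0|apply width_decr; lia].
Qed.

Lemma norm_a_le t : 0 <= t -> norm (a t) <= M.
Proof. apply (quasi_bound omega (width 0)); [apply width_ge_0; lia|exact Qa]. Qed.

Lemma continuous_a : continuous_on Rnonneg a.
Proof. apply (quasi_continuous omega (width 0) a M); [apply width_ge_0; lia|exact Qa]. Qed.

(** Existence of the average comes from a bounded primitive and so costs one step of width, whence k
    <= n; the value itself is bounded without loss. *)
Lemma is_avg_comp_a k phi N :
  (k <= n)%nat -> quasi omega (width k) phi N ->
  norm (time_average (V := ER) (fun s => End_comp (a s) (phi s))) <= M * N /\
  is_avg (V := ER) (fun s => End_comp (a s) (phi s))
    (time_average (V := ER) (fun s => End_comp (a s) (phi s))).
Proof.
  intros Hk Hphi. assert (Pw : 0 <= width (S k)) by (apply width_ge_0; lia).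
  assert (Pw' : 0 <= width k) by (apply width_ge_0; lia).
  assert (Q := quasi_comp omega _ _ _ _ _ Pw' (quasi_a k ltac:(lia)) Hphi).
  rewrite width_S in Q.
  destruct (quasi_primitive omega _ delta K _ _ Pw Pdelta SD Q)
    as [L [_ [NL [AL _]]]].
  rewrite (time_average_is_avg (V := ER) _ _ AL). now split.
Qed.

(** If phi has average id, the average of phi B is B for the constant B = average of a phi: this
    cancellation centers [Lambda]. *)
Lemma quasi_Lambda k phi N :
  (k <= n)%nat -> quasi omega (width k) phi N ->
  quasi omega (width k) (Lambda a phi) (M * N + N * (M * N)) /\
  continuous_on Rnonneg (Lambda a phi) /\
  (is_avg (V := ER) phi End_id -> is_avg (V := ER) (Lambda a phi) zero).
Proof.
  intros Hk Hphi. destruct (is_avg_comp_a k phi N Hk Hphi) as [NA AA].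
  assert (Pw : 0 <= width k) by (apply width_ge_0; lia).
  assert (Cphi := quasi_continuous omega _ _ _ Pw Hphi).
  set (B := time_average (V := ER) (fun s => End_comp (a s) (phi s))) in *.
  assert (Q : quasi omega (width k) (Lambda a phi) (M * N + N * (M * N))).
  { apply quasi_minus; [exact Pw| |].
    - apply quasi_comp; [exact Pw|apply quasi_a; lia|exact Hphi].
    - apply quasi_comp; [exact Pw|exact Hphi|now apply quasi_const]. }
  split; [exact Q|split].
  - exact (quasi_continuous omega _ _ _ Pw Q).
  - intros Aphi.
    assert (A2 : is_avg (V := ER) (fun t => End_comp (phi t) B) B).
    { exact (eq_rect _ (is_avg (V := ER) _)
        (is_avg_linear (V := ER) (W := ER) (fun D => End_comp D B) phi End_id
          (is_linear_End_comp_r B) Cphi Aphi) _ (End_comp_id_l B)). }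
    replace (zero : ER) with (minus B B : ER) by (symmetry; module).
    apply (is_avg_minus (V := ER) (fun t => End_comp (a t) (phi t))
      (fun t => End_comp (phi t) B)).
    + exact (continuous_on_bilinear _ bilinear_End_comp _ _ continuous_a Cphi).
    + exact (continuous_on_bilinear _ bilinear_End_comp _ _ Cphi
        (continuous_on_cst (V := ER) B)).
    + exact AA.
    + exact A2.
Qed.

(** [Lambda] is the sum of a linear and a quadratic expression in phi; the difference is arranged so
    that each term has exactly one factor phi - psi. *)
Lemma Lambda_minus k phi psi N P :
  (k <= n)%nat -> quasi omega (width k) phi N -> quasi omega (width k) psi P ->
  forall t,
  minus (Lambda a phi t) (Lambda a psi t)
  = minus (minus (End_comp (a t) (minus (phi t) (psi t)))
             (End_comp (minus (phi t) (psi t))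
                (time_average (V := ER) (fun s => End_comp (a s) (phi s)))))
          (End_comp (psi t) (time_average (V := ER)
             (fun s => End_comp (a s) (minus (phi s) (psi s))))).
Proof.
  intros Hk Hphi Hpsi t.
  assert (Pw : 0 <= width k) by (apply width_ge_0; lia).
  assert (Cphi := quasi_continuous omega _ _ _ Pw Hphi).
  assert (Cpsi := quasi_continuous omega _ _ _ Pw Hpsi).
  destruct (is_avg_comp_a k phi N Hk Hphi) as [_ A1].
  destruct (is_avg_comp_a k psi P Hk Hpsi) as [_ A2].
  assert (A3 : time_average (V := ER) (fun s => End_comp (a s) (minus (phi s) (psi s)))
    = minus (time_average (V := ER) (fun s => End_comp (a s) (phi s)))
            (time_average (V := ER) (fun s => End_comp (a s) (psi s)))).
  { apply (time_average_is_avg (V := ER)).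
    apply (is_avg_ext (V := ER) (fun s => minus (End_comp (a s) (phi s))
      (End_comp (a s) (psi s)))).
    - intros s _. symmetry. exact (bil_minus_r _ bilinear_End_comp (a s) (phi s) (psi s)).
    - exact (is_avg_minus (V := ER) _ _ _ _
        (continuous_on_bilinear _ bilinear_End_comp _ _ continuous_a Cphi)
        (continuous_on_bilinear _ bilinear_End_comp _ _ continuous_a Cpsi) A1 A2). }
  rewrite A3. unfold Lambda.
  set (B1 := time_average (fun s => End_comp (a s) (phi s))).
  set (B2 := time_average (fun s => End_comp (a s) (psi s))).
  change (@time_average ER) with (@time_average (End_CompleteNormedModule X)).
  fold B1 B2.
  assert (E1 : End_comp (a t) (minus (phi t) (psi t))
    = minus (End_comp (a t) (phi t)) (End_comp (a t) (psi t)))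
    by exact (bil_minus_r _ bilinear_End_comp (a t) (phi t) (psi t)).
  assert (E2 : End_comp (minus (phi t) (psi t)) B1
    = minus (End_comp (phi t) B1) (End_comp (psi t) B1))
    by exact (bil_minus_l _ bilinear_End_comp (phi t) (psi t) B1).
  assert (E3 : End_comp (psi t) (minus B1 B2)
    = minus (End_comp (psi t) B1) (End_comp (psi t) B2))
    by exact (bil_minus_r _ bilinear_End_comp (psi t) B1 B2).
  rewrite E1, E2, E3. module.
Qed.

Context (eps : R) (Heps : 0 < eps <= eps_max).

(* Phi^[k-1], with Phi^[-1] = 0 so that the recursion formula also yields
   Phi^[0] = id. *)
Definition Psi (k : nat) : R -> End X :=
  match k with
  | O => fun _ => zero
  | S k => Phi a eps k
  end.

Lemma Lambda_zero t : Lambda a (fun _ => zero) t = zero.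
Proof.
  unfold Lambda.
  refine (eq_trans (f_equal2 minus (y1 := zero) (y2 := zero) _ _) _).
  - exact (linear_zero (U := ER) (V := ER) _ (is_linear_End_comp_l (a t))).
  - now apply End_ext.
  - module.
Qed.

Lemma Psi_S_eq k t :
  Psi (S k) t = plus End_id (scal eps (centered_primitive (Lambda a (Psi k)) t)).
Proof.
  destruct k as [|k].
  - simpl. replace (Lambda a (fun _ => zero)) with (fun _ : R => zero : End X)
      by (symmetry; apply functional_extensionality; apply Lambda_zero).
    rewrite centered_primitive_zero.
    refine (eq_sym (eq_trans (f_equal (plus _) (scal_zero_r (V := ER) eps)) _)).
    apply plus_zero_r.
  - simpl. unfold centered_primitive. module.
Qed.

Lemma Phi_estimate k :
  (k <= S n)%nat ->
  quasi omega (width k) (fun t => minus (Phi a eps k t) End_id)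
    (c * (eps / eps_max)) /\
  is_avg (V := ER) (Phi a eps k) End_id.
Proof.
  destruct eps_max_spec as [P0 E0].
  assert (Hq : 0 <= eps / eps_max <= 1).
  { split; [left; apply Rdiv_lt_0_compat; lra|].
    apply Rmult_le_reg_r with eps_max; [exact P0|].
    unfold Rdiv. rewrite Rmult_assoc, Rinv_l; lra. }
  induction k as [|k IH]; intros Hk.
  - assert (Pw : 0 <= width 0) by (apply width_ge_0; lia). split.
    + apply (quasi_ext_le omega _ (fun _ => zero) _ 0); [exact Pw| |nra|].
      * intros t _. simpl. symmetry. module.
      * apply quasi_const; [exact Pw|]. apply norm_zero_le; [reflexivity|lra].
    + apply (is_avg_const (V := ER)).
  - destruct (IH ltac:(lia)) as [Q A]. clear IH.
    assert (Pw : 0 <= width (S k)) by (apply width_ge_0; lia).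
    assert (Pw' : 0 <= width k) by (apply width_ge_0; lia).
    assert (QPhi : quasi omega (width k) (Phi a eps k) (1 + c)).
    { apply (quasi_ext_le omega _ (fun t => plus End_id (minus (Phi a eps k t) End_id))
        _ (1 + c * (eps / eps_max))); [exact Pw'| |nra|].
      - intros t _. module.
      - apply quasi_plus; [exact Pw'|apply quasi_const; [exact Pw'|apply norm_End_id]|].
        exact Q. }
    destruct (quasi_Lambda k _ _ ltac:(lia) QPhi) as [QL [_ AL]].
    specialize (AL A). rewrite width_S in QL.
    destruct (quasi_centered_primitive omega _ delta K _ _ Pw Pdelta SD QL AL)
      as [QJ [AJ _]].
    assert (E : forall t, 0 <= t ->
      scal eps (centered_primitive (Lambda a (Phi a eps k)) t)
      = minus (Phi a eps (S k) t) End_id).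
    { intros t _. rewrite (Psi_S_eq (S k) t : Phi a eps (S k) t = _). simpl. module. }
    assert (QD : quasi omega (width (S k)) (fun t => minus (Phi a eps (S k) t) End_id)
      (c * (eps / eps_max))).
    { apply (quasi_ext_le omega _ _ _ _ _ Pw E) with
        (2 := quasi_scal omega _ eps _ _ Pw QJ).
      rewrite Rabs_pos_eq by lra.
      (* With |Phi^[k]| <= 1 + c, Lambda is bounded by M (1 + c) + M (1 + c)^2 = M (1 + c) (2 + c).
         This is the origin of N_c, and [E0] turns the product into c eps/eps_max. *)
      apply Rle_trans with (eps_max * (K * (M * ((2 + c) * (1 + c)))) * (eps / eps_max)).
      - right. field. lra.
      - rewrite E0. apply Rle_refl. }
    split; [exact QD|].
    apply (is_avg_ext (V := ER) (fun t => plus End_id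
      (scal eps (centered_primitive (Lambda a (Phi a eps k)) t)))).
    + intros t Pt. now rewrite (Psi_S_eq (S k) t : Phi a eps (S k) t = _).
    + assert (CJ := quasi_continuous omega _ _ _ Pw QJ).
      assert (A1 := is_avg_plus (V := ER) (fun _ => End_id) _ _ _
        (continuous_on_cst (V := ER) End_id) (continuous_on_scal (V := ER) eps _ CJ)
        (is_avg_const (V := ER) End_id) (is_avg_scal (V := ER) eps _ _ CJ AJ)).
      refine (eq_rect _ (is_avg (V := ER) _) A1 _ _).
      refine (eq_trans (f_equal (plus _) (scal_zero_r (V := ER) eps)) _).
      apply plus_zero_r.
Qed.

Lemma norm_Phi_0_minus_id_le : norm (minus (Phi a eps n 0) End_id) <= c.
Proof.
  destruct (Phi_estimate n ltac:(lia)) as [Q _].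
  assert (Pw : 0 <= width n) by (apply width_ge_0; lia).
  refine (Rle_trans _ _ _ (proj2 (quasi_bound omega _ _ _ Pw Q) 0 (Rle_refl 0)) _).
  destruct eps_max_spec as [P0 _]. rewrite <- (Rmult_1_r c) at 2.
  apply Rmult_le_compat_l; [lra|].
  apply Rmult_le_reg_r with eps_max; [exact P0|].
  unfold Rdiv. rewrite Rmult_assoc, Rinv_l; lra.
Qed.

(** [Psi k] is Phi^[k-1] and has lost k - 1 steps of width, whence k <= S j; the bound 2 stands for
    1 + c. *)
Lemma quasi_Psi k j :
  (k <= S j)%nat -> (j <= S n)%nat -> quasi omega (width j) (Psi k) 2.
Proof.
  intros Hkj Hj. assert (Pj : 0 <= width j) by now apply width_ge_0.
  destruct k as [|k].
  - apply quasi_const; [exact Pj|]. apply norm_zero_le; [reflexivity|lra].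
  - assert (Pk : 0 <= width k) by (apply width_ge_0; lia).
    apply (quasi_weaken omega (width k));
      [split; [exact Pj|apply width_decr; lia]|].
    destruct (Phi_estimate k ltac:(lia)) as [Q _].
    apply (quasi_ext_le omega _ (fun t => plus End_id (minus (Phi a eps k t) End_id))
      _ (1 + c * (eps / eps_max))); [exact Pk| | |].
    + intros t _. simpl. module.
    + destruct eps_max_spec as [P0 _].
      assert (eps / eps_max <= 1); [|nra].
      apply Rmult_le_reg_r with eps_max; [exact P0|].
      unfold Rdiv. rewrite Rmult_assoc, Rinv_l; lra.
    + apply quasi_plus; [exact Pk|apply quasi_const; [exact Pk|apply norm_End_id]|].
      exact Q.
Qed.

Lemma Lambda_Psi k :
  (k <= S n)%nat ->
  continuous_on Rnonneg (Lambda a (Psi k)) /\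
  is_avg (V := ER) (Lambda a (Psi k)) zero /\
  exists m, is_avg (V := ER) (fun s => RInt (V := ER) (Lambda a (Psi k)) 0 s) m.
Proof.
  intros Hk. destruct k as [|k].
  - assert (E : Lambda a (Psi 0) = fun _ => zero)
      by (apply functional_extensionality; apply Lambda_zero).
    rewrite E. split; [apply (continuous_on_cst (V := ER))|split].
    + apply (is_avg_const (V := ER)).
    + exists zero. apply (is_avg_ext (V := ER) (fun _ => zero)).
      * intros s _. rewrite (RInt_const_nonneg (V := ER)).
        symmetry. exact (scal_zero_r (V := ER) s).
      * apply (is_avg_const (V := ER)).
  - assert (Q := quasi_Psi (S k) k (le_n _) ltac:(lia)).
    destruct (quasi_Lambda k _ _ ltac:(lia) Q) as [QL [CL AL]].
    specialize (AL (proj2 (Phi_estimate k ltac:(lia)))).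
    split; [exact CL|split; [exact AL|]]. rewrite width_S in QL.
    apply (quasi_centered_primitive omega _ delta K _ _
      (width_ge_0 (S k) Hk) Pdelta SD QL AL).
Qed.

Lemma is_derive_Psi k t :
  (k <= S n)%nat -> 0 <= t ->
  is_derive_on (V := ER) Rnonneg (Psi (S k)) t (scal eps (Lambda a (Psi k) t)).
Proof.
  intros Hk Pt. destruct (Lambda_Psi k Hk) as [CL _].
  apply (is_derive_on_ext_nonneg (V := ER)
    (fun t => plus End_id (scal eps (centered_primitive (Lambda a (Psi k)) t))));
    [exact Pt|intros s _; symmetry; apply Psi_S_eq|].
  refine (eq_rect _ (is_derive_on (V := ER) Rnonneg _ t)
    (is_derive_on_plus (V := ER) _ _ t _ _ (is_derive_on_const (V := ER) _ t Pt)
      (is_derive_on_scal (V := ER) eps _ t _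
        (is_derive_centered_primitive _ t CL Pt))) _ (plus_zero_l _)).
Qed.

(** The difference D_k of two successive iterates; D_0 = id by the convention on [Psi 0]. *)
Definition dPsi (k : nat) (t : R) : End X := minus (Psi (S k) t) (Psi k t).

Lemma dPsi_Lambda k :
  (k <= n)%nat -> quasi omega (width k) (dPsi k) ((5 * M * K * eps) ^ k) ->
  norm (time_average (V := ER) (fun s => End_comp (a s) (dPsi k s)))
    <= M * (5 * M * K * eps) ^ k /\
  forall t, minus (Lambda a (Psi (S k)) t) (Lambda a (Psi k) t)
    = minus (minus (End_comp (a t) (dPsi k t))
                   (End_comp (dPsi k t) (Amac a eps k)))
            (End_comp (Psi k t)
               (time_average (V := ER) (fun s => End_comp (a s) (dPsi k s)))).
Proof.
  intros Hk Q. split.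
  - exact (proj1 (is_avg_comp_a k _ _ Hk Q)).
  - apply (Lambda_minus k (Psi (S k)) (Psi k) 2 2 Hk);
      apply quasi_Psi; lia.
Qed.

Lemma norm_Amac_le k : (k <= n)%nat -> norm (Amac a eps k) <= 2 * M.
Proof.
  intros Hk. rewrite Rmult_comm.
  exact (proj1 (is_avg_comp_a k (Phi a eps k) 2 Hk
    (quasi_Psi (S k) k (le_n _) ltac:(lia)))).
Qed.

Lemma quasi_dPsi k :
  (k <= S n)%nat -> quasi omega (width k) (dPsi k) ((5 * M * K * eps) ^ k).
Proof.
  pose proof K_ge_1 as PK.
  induction k as [|k IH]; intros Hk.
  - assert (Pw : 0 <= width 0) by (apply width_ge_0; lia).
    apply (quasi_ext_le omega _ (fun _ => End_id) _ 1); [exact Pw| |simpl; lra|].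
    + intros t _. unfold dPsi. simpl. symmetry. exact (minus_zero_r (G := ER) _).
    + apply quasi_const; [exact Pw|apply norm_End_id].
  - specialize (IH ltac:(lia)).
    assert (Pw : 0 <= width (S k)) by (apply width_ge_0; lia).
    assert (Pw' : 0 <= width k) by (apply width_ge_0; lia).
    destruct (dPsi_Lambda k ltac:(lia) IH) as [NB EL].
    set (P := (5 * M * K * eps) ^ k) in *.
    assert (PP : 0 <= P).
    { apply pow_le. apply Rmult_le_pos; [|lra]. apply Rmult_le_pos; lra. }
    set (L := fun t => minus (Lambda a (Psi (S k)) t) (Lambda a (Psi k) t)).
    assert (QL : quasi omega (width k) L (5 * M * P)).
    (* Origin of the 5: the three terms a D, D A with |A| <= 2 M, and Psi times the average of a D
       with |Psi| <= 2. The primitive then adds the factor K and the recursion the factor eps. *)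
    { apply (quasi_ext_le omega _ _ _ (M * P + P * (2 * M) + 2 * (M * P)) _ Pw'
        (fun t _ => eq_sym (EL t))); [lra|].
      apply quasi_minus; [exact Pw'|apply quasi_minus; [exact Pw'| |]|].
      - apply quasi_comp; [exact Pw'|apply quasi_a; lia|exact IH].
      - apply quasi_comp; [exact Pw'|exact IH|]. apply quasi_const; [exact Pw'|].
        apply norm_Amac_le. lia.
      - apply quasi_comp; [exact Pw'|apply quasi_Psi; lia|].
        now apply quasi_const. }
    destruct (Lambda_Psi (S k) ltac:(lia)) as [C1 [A1 [m1 I1]]].
    destruct (Lambda_Psi k ltac:(lia)) as [C0 [A0 [m0 I0]]].
    assert (AL : is_avg (V := ER) L zero).
    { replace (zero : ER) with (minus zero zero : ER) by (symmetry; module).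
      exact (is_avg_minus (V := ER) _ _ _ _ C1 C0 A1 A0). }
    rewrite width_S in QL.
    destruct (quasi_centered_primitive omega _ delta K _ _ Pw Pdelta SD QL AL)
      as [QJ _].
    apply (quasi_ext_le omega _ (fun t => scal eps (centered_primitive L t)) _
      (Rabs eps * (K * (5 * M * P)))); [exact Pw| | |].
    + intros t Pt. unfold dPsi. rewrite !Psi_S_eq.
      refine (eq_trans (f_equal (scal eps)
        (centered_primitive_minus _ _ _ _ t C1 C0 I1 I0 Pt)) _). module.
    + rewrite Rabs_pos_eq by lra. right. unfold P. simpl. ring.
    + now apply quasi_scal.
Qed.

Lemma is_derive_dPsi_S k t :
  (k <= n)%nat -> 0 <= t ->
  is_derive_on (V := ER) Rnonneg (dPsi (S k)) t
    (scal eps (minus (Lambda a (Psi (S k)) t) (Lambda a (Psi k) t))).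
Proof.
  intros Hk Pt.
  refine (eq_rect _ (is_derive_on (V := ER) Rnonneg _ t)
    (is_derive_on_minus (V := ER) _ _ t _ _ (is_derive_Psi (S k) t ltac:(lia) Pt)
      (is_derive_Psi k t ltac:(lia) Pt)) _ _).
  module.
Qed.

(** In this form the defect is -1/eps times the derivative of [dPsi (S n)], which gives both its
    size and its derivatives. *)
Lemma defect_Lambda t :
  0 <= t ->
  defect a eps n t = minus (Lambda a (Psi n) t) (Lambda a (Psi (S n)) t).
Proof.
  intros Pt. unfold defect.
  assert (D : Derive_on (V := ER) Rnonneg (Phi a eps n) t
    = scal eps (Lambda a (Psi n) t)).
  { apply (iota_unique (V := ER)).
    - intros l Hl. exact (is_derive_on_unique (V := ER) _ t _ _ Pt Hl
        (is_derive_Psi n t ltac:(lia) Pt)).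
    - apply (is_derive_Psi n t); [lia|exact Pt]. }
  refine (eq_trans (f_equal (fun x => minus (scal (/ eps) x) _) D) _).
  change (minus (End_comp (a t) (Phi a eps n t))
    (End_comp (Phi a eps n t) (Amac a eps n))) with (Lambda a (Psi (S n)) t).
  module. field. lra.
Qed.
End PicardIterates.

(** * Bounds on derivatives *)

Section NeumannSeries.
Context {X : Banach}.
Notation EN := (End_NormedModule X).
Notation ER := (End_CompleteNormedModule X).

Fixpoint End_pow (S : End X) (j : nat) : End X :=
  match j with
  | O => End_id
  | Datatypes.S j => End_comp S (End_pow S j)
  end.

Lemma End_pow_comm (S : End X) (j : nat) :
  End_comp (End_pow S j) S = End_comp S (End_pow S j).
Proof.
  induction j as [|j IH]; [now apply End_ext|].
  simpl. rewrite <- End_comp_assoc, IH. reflexivity.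
Qed.

Lemma sum_n_geometric_le (c : R) (m : nat) :
  0 <= c < 1 -> sum_n (fun j => c ^ j) m <= / (1 - c).
Proof.
  intros Hc.
  assert (E : sum_n (fun j => c ^ j) m * (1 - c) = 1 - c ^ S m).
  { induction m as [|m IH]; [rewrite sum_O; simpl; ring|].
    rewrite sum_Sn. change (plus (sum_n (fun j => c ^ j) m) (c ^ S m))
      with (sum_n (fun j => c ^ j) m + c ^ S m).
    rewrite Rmult_plus_distr_r, IH. simpl. ring. }
  apply Rmult_le_reg_r with (1 - c); [lra|]. rewrite E, Rinv_l by lra.
  pose proof (pow_le c (S m) (proj1 Hc)). lra.
Qed.

(** The Neumann series T of powers of S = id - B. As [End_inv] is a description, T must be shown to
    be a two-sided inverse and the only one. *)
Lemma norm_End_inv_le (B : End X) (c : R) :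
  0 <= c < 1 -> norm (minus B End_id) <= c -> norm (End_inv B) <= / (1 - c).
Proof.
  intros Hc HB. set (S := minus End_id B : End X).
  assert (NS : norm S <= c).
  { refine (Rle_trans _ _ _ (Req_le _ _ (norm_minus_sym _ EN _ _)) HB). }
  assert (Npow : forall j, norm (End_pow S j) <= c ^ j).
  { induction j as [|j IH]; [apply norm_End_id|].
    refine (Rle_trans _ _ _ (norm_End_comp _ _) _). simpl.
    apply Rmult_le_compat; [apply norm_ge_0|apply norm_ge_0|exact NS|exact IH]. }
  assert (Ppow : forall j, 0 <= c ^ j) by (intros j; apply pow_le; lra).
  assert (Hsum : forall m, sum_n (fun j => c ^ j) m <= / (1 - c))
    by (intros m; now apply sum_n_geometric_le).
  destruct (ex_series_dominated (V := ER) _ _ Ppow Hsum (End_pow S) Npow) as [T HT].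
  (* The series without its first term; its sum is also S T and T S, which yields both inverse
     identities. *)
  assert (Sh : is_series (V := EN) (fun j => End_pow S (Datatypes.S j))
    (minus T End_id)).
  { apply (is_series_incr_1 (V := EN)).
    refine (eq_rect _ (is_series (V := EN) _) HT _ _).
    change (End_pow S 0) with (End_id (X := X)). module. }
  assert (ST : End_comp S T = minus T End_id).
  { refine (filterlim_locally_unique (F := eventually) (V := EN) _ _ _ _ Sh).
    exact (is_series_linear (V := ER) (W := ER) (End_comp S) (End_pow S) T
      (is_linear_End_comp_l S) HT). }
  assert (TS : End_comp T S = minus T End_id).
  { refine (filterlim_locally_unique (F := eventually) (V := EN) _ _ _ _ Sh).
    apply (is_series_ext (V := EN) (fun j => End_comp (End_pow S j) S)).
    - intros j. apply End_pow_comm.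
    - exact (is_series_linear (V := ER) (W := ER) (fun A => End_comp A S)
        (End_pow S) T (is_linear_End_comp_r S) HT). }
  assert (EB : B = minus End_id S) by (unfold S; module).
  assert (BT : End_comp B T = End_id).
  { rewrite EB. refine (eq_trans (bil_minus_l _ bilinear_End_comp End_id S T) _).
    rewrite End_comp_id_l, ST. module. }
  assert (TB : End_comp T B = End_id).
  { rewrite EB. refine (eq_trans (bil_minus_r _ bilinear_End_comp T End_id S) _).
    rewrite End_comp_id_r, TS. module. }
  assert (EI : End_inv B = T).
  { apply (iota_unique (V := ER)); [|now split].
    intros T' [H1 _]. rewrite <- (End_comp_id_l T'), <- TB, <- End_comp_assoc, H1.
    apply End_comp_id_r. }
  rewrite EI. exact (norm_dominated_series (V := ER) _ _ Ppow Hsum _ T Npow HT).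
Qed.
End NeumannSeries.

(** [is_derive_n_on] adds the last derivative, while differential equations provide the first one;
    this lemma and its converse exchange the two ends. *)
Lemma is_derive_n_on_cons {V : NormedModule R_AbsRing} (f f1 : R -> V) p g :
  (forall t, 0 <= t -> is_derive_on Rnonneg f t (f1 t)) ->
  is_derive_n_on Rnonneg f1 p g -> is_derive_n_on Rnonneg f (S p) g.
Proof.
  intros H1. revert g. induction p as [|p IH]; intros g Hg.
  - exists f. split; [intros t _; reflexivity|]. intros t Pt. rewrite (Hg t Pt). now apply H1.
  - destruct Hg as [h [Hh Dh]]. exists h. split; [now apply IH|exact Dh].
Qed.

Lemma is_derive_n_on_uncons {V : NormedModule R_AbsRing} (f : R -> V) p g :
  is_derive_n_on Rnonneg f (S p) g ->
  exists f1, (forall t, 0 <= t -> is_derive_on Rnonneg f t (f1 t)) /\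
    is_derive_n_on Rnonneg f1 p g.
Proof.
  revert g. induction p as [|p IH]; intros g [h [Hh Dh]].
  - exists g. split; [|intros t _; reflexivity]. intros t Pt.
    apply (is_derive_on_ext_nonneg h); [exact Pt|exact Hh|now apply Dh].
  - destruct (IH h Hh) as [f1 [H1 Hn]]. exists f1. split; [exact H1|].
    now exists h.
Qed.

(** * Geometric bounds on successive derivatives *)

Section DerivativeBounds.
Context (I : R -> Prop) (HI : forall t, I t -> 0 <= t).

(* Bounds K lam^k on the k-th derivatives are stable under products (up to a
   factor 2^p), and the substitution t/eps amounts to lam = 1/eps. *)
Fixpoint deriv_bounds {V : NormedModule R_AbsRing} (lam : R) (p : nat)
    (f : R -> V) (K : R) : Prop :=
  (forall t, I t -> norm (f t) <= K) /\
  match p with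
  | O => True
  | S p => exists g, (forall t, 0 <= t -> is_derive_on Rnonneg f t (g t)) /\
             deriv_bounds lam p g (K * lam)
  end.

Section OneSpace.
Context {V : CompleteNormedModule R_AbsRing}.
Implicit Types f g : R -> V.

Lemma deriv_bounds_le lam lam' p p' f K K' :
  0 <= lam <= lam' -> 0 <= K <= K' -> (p' <= p)%nat ->
  deriv_bounds lam p f K -> deriv_bounds lam' p' f K'.
Proof.
  intros Hl. revert p' f K K'.
  induction p as [|p IH]; intros p' f K K' HK Hp [B D].
  - replace p' with O by lia. split; [|exact Logic.I].
    intros t Ht. specialize (B t Ht). lra.
  - destruct p' as [|p'];
      (split; [intros t Ht; specialize (B t Ht); lra|]); [exact Logic.I|].
    destruct D as [g [Dg Bg]]. exists g. split; [exact Dg|].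
    apply (IH p' g (K * lam)); [split; [nra|apply Rmult_le_compat; lra]|lia|exact Bg].
Qed.

Lemma deriv_bounds_ext lam p f g K :
  (forall t, 0 <= t -> f t = g t) ->
  deriv_bounds lam p f K -> deriv_bounds lam p g K.
Proof.
  intros E H. destruct p as [|p]; destruct H as [B D]; split.
  - intros t Ht. rewrite <- E by now apply HI. now apply B.
  - exact Logic.I.
  - intros t Ht. rewrite <- E by now apply HI. now apply B.
  - destruct D as [h [Dh Bh]]. exists h. split; [|exact Bh].
    intros t Pt. apply (is_derive_on_ext_nonneg f); auto.
Qed.

Lemma deriv_bounds_plus lam p f g K L :
  deriv_bounds lam p f K -> deriv_bounds lam p g L ->
  deriv_bounds lam p (fun t => plus (f t) (g t)) (K + L).
Proof.
  revert f g K L. induction p as [|p IH]; intros f g K L [B D] [B' D']; split;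
    try (intros t Ht; exact (norm_plus_le (B t Ht) (B' t Ht))); [exact Logic.I|].
  destruct D as [f1 [D1 H1]], D' as [g1 [D2 H2]].
  exists (fun t => plus (f1 t) (g1 t)). split.
  - intros t Pt. exact (is_derive_on_plus f g t _ _ (D1 t Pt) (D2 t Pt)).
  - rewrite Rmult_plus_distr_r. now apply IH.
Qed.

Lemma deriv_bounds_scal lam p (k : R) f K :
  deriv_bounds lam p f K ->
  deriv_bounds lam p (fun t => scal k (f t)) (Rabs k * K).
Proof.
  revert f K. induction p as [|p IH]; intros f K [B D]; split;
    try (intros t Ht; exact (norm_scal_le k (Rle_refl _) (B t Ht))); [exact Logic.I|].
  destruct D as [f1 [D1 H1]].
  exists (fun t => scal k (f1 t)). split.
  - intros t Pt. exact (is_derive_on_scal k f t _ (D1 t Pt)).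
  - rewrite Rmult_assoc. now apply IH.
Qed.

Lemma deriv_bounds_minus lam p f g K L :
  deriv_bounds lam p f K -> deriv_bounds lam p g L ->
  deriv_bounds lam p (fun t => minus (f t) (g t)) (K + L).
Proof.
  intros H1 H2.
  apply (deriv_bounds_ext lam p (fun t => plus (f t) (scal (-1) (g t)))).
  - intros t _. module.
  - replace (K + L) with (K + Rabs (-1) * L)
      by (rewrite Rabs_left by lra; ring).
    apply deriv_bounds_plus; [exact H1|]. now apply deriv_bounds_scal.
Qed.

Lemma deriv_bounds_const lam p (x : V) K :
  0 <= lam -> norm x <= K -> deriv_bounds lam p (fun _ => x) K.
Proof.
  intros Pl. revert x K. induction p as [|p IH]; intros x K H; split;
    try (intros; exact H); [exact Logic.I|].
  exists (fun _ => zero). split.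
  - intros t Pt. now apply is_derive_on_const.
  - apply IH. apply norm_zero_le; [reflexivity|].
    pose proof (norm_ge_0 x). nra.
Qed.

Lemma deriv_bounds_derive lam p f K :
  deriv_bounds lam p f K ->
  exists df, is_derive_n_on Rnonneg f p df /\
    forall t, I t -> norm (df t) <= K * lam ^ p.
Proof.
  revert f K. induction p as [|p IH]; intros f K [B D].
  - exists f. split; [intros t _; reflexivity|]. intros t Ht. simpl. rewrite Rmult_1_r.
    now apply B.
  - destruct D as [g [Dg Bg]]. destruct (IH g _ Bg) as [df [H1 H2]].
    exists df. split; [now apply (is_derive_n_on_cons f g)|].
    intros t Ht. simpl. rewrite <- Rmult_assoc. now apply H2.
Qed.
End OneSpace.

(** Each differentiation doubles the number of products, whence 2^p; both factors must share the
    same rate lam. *)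
Lemma deriv_bounds_bilinear {U V W : CompleteNormedModule R_AbsRing}
    (B : U -> V -> W) (HB : bilinear_le1 B) lam p f g K L :
  0 <= lam -> 0 <= K -> 0 <= L ->
  deriv_bounds lam p f K -> deriv_bounds lam p g L ->
  deriv_bounds lam p (fun t => B (f t) (g t)) (2 ^ p * (K * L)).
Proof.
  intros Pl. revert f g K L. induction p as [|p IH]; intros f g K L PK PL Hf Hg.
  - destruct Hf as [Bf _], Hg as [Bg _]. split; [|exact Logic.I].
    intros t Ht. refine (Rle_trans _ _ _ (bil_norm B HB _ _) _).
    simpl. rewrite Rmult_1_l.
    apply Rmult_le_compat; [apply norm_ge_0|apply norm_ge_0|now apply Bf|now apply Bg].
  - assert (Hf' := deriv_bounds_le lam lam (S p) p f K K (conj Pl (Rle_refl _))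
      (conj PK (Rle_refl _)) (le_S _ _ (le_n p)) Hf).
    assert (Hg' := deriv_bounds_le lam lam (S p) p g L L (conj Pl (Rle_refl _))
      (conj PL (Rle_refl _)) (le_S _ _ (le_n p)) Hg).
    destruct Hf as [Bf [f1 [Df Hf1]]], Hg as [Bg [g1 [Dg Hg1]]].
    assert (P2 : 1 <= 2 ^ S p) by (apply pow_R1_Rle; lra).
    split.
    + intros t Ht. refine (Rle_trans _ _ _ (bil_norm B HB _ _) _).
      apply Rle_trans with (K * L).
      * apply Rmult_le_compat;
          [apply norm_ge_0|apply norm_ge_0|now apply Bf|now apply Bg].
      * assert (0 <= K * L) by now apply Rmult_le_pos. nra.
    + exists (fun t => plus (B (f1 t) (g t)) (B (f t) (g1 t))). split.
      * intros t Pt. exact (is_derive_on_bilinear B HB f g t _ _ Pt (Df t Pt) (Dg t Pt)).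
      * replace (2 ^ S p * (K * L) * lam)
          with (2 ^ p * (K * lam * L) + 2 ^ p * (K * (L * lam))) by (simpl; ring).
        apply deriv_bounds_plus; apply IH; auto; now apply Rmult_le_pos.
Qed.
End DerivativeBounds.

Lemma deriv_bounds_rescale {V : CompleteNormedModule R_AbsRing}
    (I : R -> Prop) (eps : R) p (f : R -> V) K :
  0 < eps -> (forall t, I t -> 0 <= t) ->
  deriv_bounds Rnonneg 1 p f K ->
  deriv_bounds I (/ eps) p (fun t => f (t / eps)) K.
Proof.
  intros Pe HI.
  assert (Pi : 0 < / eps) by now apply Rinv_0_lt_compat.
  revert f K. induction p as [|p IH]; intros f K [B D]; split;
    try (intros t Ht; apply B; apply Rmult_le_pos; [now apply HI|lra]);
    [exact Logic.I|].
  destruct D as [g [Dg Bg]]. exists (fun t => scal (/ eps) (g (t / eps))). split.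
  - intros t Pt. apply (is_derive_on_rescale f eps t); [exact Pe|exact Pt|].
    apply Dg. apply Rmult_le_pos; lra.
  - replace (K * / eps) with (Rabs (/ eps) * (K * 1))
      by (rewrite Rabs_pos_eq by lra; ring).
    apply deriv_bounds_scal. now apply IH.
Qed.

Lemma deriv_bounds_of_derive_n {V : CompleteNormedModule R_AbsRing} q
    (f : R -> V) K :
  (exists g, is_derive_n_on Rnonneg f q g) ->
  (forall p g, (p <= q)%nat -> is_derive_n_on Rnonneg f p g ->
     forall t, 0 <= t -> norm (g t) <= K) ->
  deriv_bounds Rnonneg 1 q f K.
Proof.
  revert f. induction q as [|q IH]; intros f [g Hg] H; split;
    try (intros t Pt; apply (H O f); [lia|intros s _; reflexivity|exact Pt]); [exact I|].
  destruct (is_derive_n_on_uncons f q g Hg) as [f1 [D1 H1]].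
  exists f1. split; [exact D1|]. rewrite Rmult_1_r. apply IH; [now exists g|].
  intros p h Hp Hh. apply (H (S p)); [lia|]. now apply (is_derive_n_on_cons f f1).
Qed.

(** * The micro-macro problem *)

Section UniformDerivativeBounds.
Context {X : Banach} {r : nat} (omega : Fin.t r -> R).
Notation EN := (End_NormedModule X).
Notation ER := (End_CompleteNormedModule X).
Context (a : R -> End X) (delta K M c : R) (n : nat).
Context (Pdelta : 0 < delta) (SD : small_divisors omega delta K) (PM : 0 < M)
  (Hc : 0 < c < 1) (Qa : quasi omega (width delta n 0) a M).
Context (q : nat) (Ca : R) (PCa : 0 <= Ca)
  (Da : deriv_bounds (V := EN) Rnonneg 1 q a Ca).

Notation e_max := (eps_max K M c).
Let P5 : R := 5 * M * K.

Lemma P5_ge_0 : 0 <= P5.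
Proof.
  assert (1 <= K) by exact (proj1 SD).
  unfold P5. apply Rmult_le_pos; lra.
Qed.

Lemma norm_dPsi_le eps k t :
  0 < eps <= e_max -> (k <= S n)%nat -> 0 <= t ->
  norm (dPsi a eps k t) <= P5 ^ k * eps ^ k.
Proof.
  intros Heps Hk Pt. rewrite <- Rpow_mult_distr.
  exact (proj2 (quasi_bound omega _ _ _ (width_ge_0 delta n Pdelta k Hk)
    (quasi_dPsi omega a delta K M c n Pdelta SD PM Hc Qa eps Heps k Hk)) t Pt).
Qed.

(** The order of quantifiers matters: C is fixed before eps. Derivatives are taken in the fast time,
    so lam = 1. *)
Definition dPsi_bounded (p k : nat) : Prop :=
  exists C, 0 <= C /\ forall eps, 0 < eps <= e_max ->
    deriv_bounds (V := EN) Rnonneg 1 p (dPsi a eps k) (C * eps ^ k).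

(** [Psi k] is the telescoping sum of the [dPsi j] for j < k, and the powers of eps are bounded by
    those of the threshold. *)
Lemma Psi_bounded p k :
  (forall j, (j <= S n)%nat -> dPsi_bounded p j) -> (k <= S n)%nat ->
  exists C, 0 <= C /\ forall eps, 0 < eps <= e_max ->
    deriv_bounds (V := EN) Rnonneg 1 p (Psi a eps k) C.
Proof.
  intros HD. induction k as [|k IH]; intros Hk.
  - exists 0. split; [lra|]. intros eps _.
    apply (deriv_bounds_const (V := ER) Rnonneg 1 p zero); [lra|].
    apply norm_zero_le; [reflexivity|lra].
  - destruct (IH ltac:(lia)) as [C [PC HC]].
    destruct (HD k ltac:(lia)) as [C' [PC' HC']].
    assert (Pe : 0 <= e_max ^ k).
    { apply pow_le. left.
      exact (proj1 (eps_max_spec omega delta K M c SD PM Hc)). }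
    exists (C + C' * e_max ^ k). split; [nra|]. intros eps Heps.
    apply (deriv_bounds_ext (V := ER) Rnonneg (fun t H => H) 1 p
      (fun t => plus (Psi a eps k t) (dPsi a eps k t))).
    + intros t _. unfold dPsi. module.
    + apply (deriv_bounds_plus (V := ER) Rnonneg); [now apply HC|].
      apply (deriv_bounds_le (V := ER) Rnonneg 1 1 p p _ (C' * eps ^ k));
        [lra| |lia|now apply HC'].
      assert (0 <= eps ^ k) by (apply pow_le; lra).
      split; [nra|]. apply Rmult_le_compat_l; [exact PC'|].
      apply pow_incr. lra.
Qed.

(** The averages in the expansion are constant in time, so only [a], [dPsi k] and [Psi k] get
    differentiated; each term retains one factor of size eps^k. *)
Lemma Lambda_diff_bounded p k :
  (forall j, (j <= S n)%nat -> dPsi_bounded p j) -> (p <= q)%nat -> (k <= n)%nat ->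
  exists C, 0 <= C /\ forall eps, 0 < eps <= e_max ->
    deriv_bounds (V := EN) Rnonneg 1 p
      (fun t => minus (Lambda a (Psi a eps (S k)) t) (Lambda a (Psi a eps k) t))
      (C * eps ^ k).
Proof.
  intros HD Hp Hk.
  destruct (HD k ltac:(lia)) as [C [PC HC]].
  destruct (Psi_bounded p k HD ltac:(lia)) as [CP [PCP HCP]].
  pose proof P5_ge_0 as PP5.
  assert (PP : 0 <= P5 ^ k) by now apply pow_le.
  assert (P2 : 0 <= 2 ^ p) by (apply pow_le; lra).
  exists (2 ^ p * (Ca * C) + 2 ^ p * (C * (2 * M)) + 2 ^ p * (CP * (M * P5 ^ k))).
  assert (0 <= CP * (M * P5 ^ k))
    by (apply Rmult_le_pos; [lra|apply Rmult_le_pos; lra]).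
  split.
  { assert (0 <= Ca * C) by now apply Rmult_le_pos.
    assert (0 <= C * (2 * M)) by (apply Rmult_le_pos; lra). nra. }
  intros eps Heps.
  assert (Pek : 0 <= eps ^ k) by (apply pow_le; lra).
  destruct (dPsi_Lambda omega a delta K M c n Pdelta SD PM Hc Qa eps Heps k Hk
    (quasi_dPsi omega a delta K M c n Pdelta SD PM Hc Qa eps Heps k ltac:(lia)))
    as [NB EL].
  assert (NB' : norm (time_average (V := ER) (fun s => End_comp (a s) (dPsi a eps k s)))
    <= M * (P5 ^ k * eps ^ k)).
  { rewrite <- Rpow_mult_distr. exact NB. }
  apply (deriv_bounds_ext (V := ER) Rnonneg (fun t H => H) 1 p _ _ _
    (fun t _ => eq_sym (EL t))).
  replace ((2 ^ p * (Ca * C) + 2 ^ p * (C * (2 * M)) + 2 ^ p * (CP * (M * P5 ^ k)))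
      * eps ^ k)
    with (2 ^ p * (Ca * (C * eps ^ k)) + 2 ^ p * (C * eps ^ k * (2 * M))
          + 2 ^ p * (CP * (M * (P5 ^ k * eps ^ k)))) by ring.
  assert (PCe : 0 <= C * eps ^ k) by now apply Rmult_le_pos.
  apply (deriv_bounds_minus (V := ER) Rnonneg (fun t H => H));
    [apply (deriv_bounds_minus (V := ER) Rnonneg (fun t H => H))|].
  - apply (deriv_bounds_bilinear (U := ER) (V := ER) (W := ER) Rnonneg _
      bilinear_End_comp); [lra|exact PCa|exact PCe| |now apply HC].
    exact (deriv_bounds_le (V := ER) Rnonneg 1 1 q p a Ca Ca ltac:(lra)
      (conj PCa (Rle_refl _)) Hp Da).
  - apply (deriv_bounds_bilinear (U := ER) (V := ER) (W := ER) Rnonneg _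
      bilinear_End_comp); [lra|exact PCe|lra|now apply HC|].
    apply (deriv_bounds_const (V := ER) Rnonneg); [lra|].
    exact (norm_Amac_le omega a delta K M c n Pdelta SD PM Hc Qa eps Heps k Hk).
  - apply (deriv_bounds_bilinear (U := ER) (V := ER) (W := ER) Rnonneg _
      bilinear_End_comp); [lra|exact PCP| |now apply HCP|].
    + apply Rmult_le_pos; [lra|]. now apply Rmult_le_pos.
    + apply (deriv_bounds_const (V := ER) Rnonneg); [lra|exact NB'].
Qed.

(** Induction on the order p, for all k together: one derivative of D_(k+1) is eps times the
    difference of Lambdas at level k, so order falls by one while a power of eps is gained. Hence S
    q orders from q derivatives of [a]. *)
Lemma dPsi_bounded_all p k :
  (p <= S q)%nat -> (k <= S n)%nat -> dPsi_bounded p k.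
Proof.
  pose proof P5_ge_0 as PP5.
  revert k. induction p as [|p IH]; intros k Hp Hk.
  - exists (P5 ^ k). split; [now apply pow_le|]. intros eps Heps.
    split; [|exact I]. intros t Pt. now apply norm_dPsi_le.
  - destruct k as [|k].
    + exists 1. split; [lra|]. intros eps Heps.
      apply (deriv_bounds_ext (V := ER) Rnonneg (fun t H => H) 1 (S p) (fun _ => End_id)).
      * intros t _. unfold dPsi. simpl. symmetry. exact (minus_zero_r (G := ER) _).
      * apply (deriv_bounds_const (V := ER) Rnonneg); [lra|].
        simpl. rewrite Rmult_1_l. apply norm_End_id.
    + destruct (Lambda_diff_bounded p k (fun j => IH j ltac:(lia)) ltac:(lia) ltac:(lia))
        as [C [PC HC]].
      exists (Rmax (P5 ^ S k) C).
      pose proof (Rmax_l (P5 ^ S k) C) as M1. pose proof (Rmax_r (P5 ^ S k) C) as M2.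
      split; [lra|]. intros eps Heps.
      assert (Pe : 0 <= eps ^ S k) by (apply pow_le; lra).
      split.
      * intros t Pt.
        refine (Rle_trans _ _ _ (norm_dPsi_le eps (S k) t Heps Hk Pt) _).
        now apply Rmult_le_compat_r.
      * eexists. split.
        -- intros t Pt. exact (is_derive_dPsi_S omega a delta K M c n Pdelta SD PM Hc Qa
             eps Heps k t ltac:(lia) Pt).
        -- apply (deriv_bounds_le (V := ER) Rnonneg 1 1 p p _ (Rabs eps * (C * eps ^ k)));
             [lra| |lia|apply (deriv_bounds_scal (V := ER) Rnonneg); now apply HC].
           rewrite Rabs_pos_eq by lra. simpl in Pe |- *.
           split; [apply Rmult_le_pos; [lra|]; apply Rmult_le_pos;
                   [lra|apply pow_le; lra]|].
           replace (eps * (C * eps ^ k)) with (C * (eps * eps ^ k)) by ring.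
           rewrite Rmult_1_r. apply Rmult_le_compat_r; [exact Pe|exact M2].
Qed.

(** * Estimates on the interval [0, T] *)

Context (u0 : X) (T : R) (PT : 0 < T).
Let IT (t : R) : Prop := 0 <= t <= T.
(** Gronwall's bound for the macro part, with |A| <= 2 M and |Phi_0^{-1}| <= 1 / (1 - c). *)
Let V0 : R := exp (2 * M * T) * (/ (1 - c) * norm u0).
(** Chosen so that, for every admissible eps, the single rate L / eps dominates 1 / eps, the rate of
    a(t/eps), and 1 + 2 M, the rate of v. *)
Let L : R := 1 + e_max * (1 + 2 * M).

Lemma V0_ge_0 : 0 <= V0.
Proof.
  apply Rmult_le_pos; [left; apply exp_pos|].
  apply Rmult_le_pos; [|apply norm_ge_0].
  left. apply Rinv_0_lt_compat. lra.
Qed.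

Lemma L_spec eps : 0 < eps <= e_max ->
  1 <= L /\ eps <= L /\ / eps <= L / eps /\ 1 + 2 * M <= L / eps.
Proof.
  intros Heps. assert (H : 0 <= e_max * (1 + 2 * M)) by (apply Rmult_le_pos; lra).
  assert (1 <= L) by (unfold L; lra).
  split; [assumption|split; [unfold L; nra|]].
  assert (Pi : 0 < / eps) by (apply Rinv_0_lt_compat; lra). split.
  - rewrite <- (Rmult_1_l (/ eps)) at 1. apply Rmult_le_compat_r; lra.
  - apply Rmult_le_reg_r with eps; [lra|].
    replace (L / eps * eps) with L by (field; lra).
    unfold L. nra.
Qed.

(** The derivative A f solves the same equation with a bound multiplied by |A|, so no new estimate
    is required at higher orders. *)
Lemma deriv_bounds_autonomous (A : End X) (lam : R) p (f : R -> X) (V : R) :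
  0 <= V -> norm A <= lam ->
  (forall t, 0 <= t -> is_derive_on Rnonneg f t (A (f t))) ->
  (forall t, IT t -> norm (f t) <= V) ->
  deriv_bounds IT lam p f V.
Proof.
  intros PV HA. assert (PA := norm_ge_0 A). revert f V PV.
  induction p as [|p IH]; intros f V PV Df Bf; split; try exact Bf; [exact I|].
  exists (fun t => A (f t)). split; [exact Df|].
  apply IH.
  - apply Rmult_le_pos; lra.
  - intros t Pt. apply (is_derive_on_linear A (bounded_linear_R X A (End_linear A)));
      [exact Pt|now apply Df].
  - intros t Ht. refine (Rle_trans _ _ _ (op_norm_apply X A (f t)) _).
    rewrite Rmult_comm. apply Rmult_le_compat;
      [apply norm_ge_0|exact PA|now apply Bf|exact HA].
Qed.

Section FixedEps.
Context (eps : R) (Heps : 0 < eps <= e_max) (v w : R -> X)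
  (sol : micro_macro_solution a eps n u0 v w).

Lemma norm_macro_le t : IT t -> norm (v t) <= V0.
Proof.
  intros Ht.
  assert (NA := norm_Amac_le omega a delta K M c n Pdelta SD PM Hc Qa eps Heps n (le_n n)).
  assert (Dv := macro_eq _ _ _ _ _ _ sol).
  assert (Cv := is_derive_on_continuous v _ Dv).
  refine (Rle_trans _ _ _ (gronwall v (fun t => Amac a eps n (v t)) (2 * M) 0 T
    ltac:(lra) ltac:(lra) Dv _ _ t Ht) _).
  - exact (continuous_on_linear _ (bounded_linear_R X _ (End_linear (Amac a eps n))) v Cv).
  - intros s Hs. rewrite Rplus_0_r.
    refine (Rle_trans _ _ _ (op_norm_apply X (Amac a eps n) (v s)) _).
    apply Rmult_le_compat_r; [apply norm_ge_0|exact NA].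
  - unfold V0. apply Rmult_le_compat_l; [left; apply exp_pos|].
    rewrite Rmult_0_l, Rplus_0_r, (macro_init _ _ _ _ _ _ sol).
    refine (Rle_trans _ _ _ (op_norm_apply X _ u0) _).
    apply Rmult_le_compat_r; [apply norm_ge_0|].
    apply norm_End_inv_le; [lra|].
    exact (norm_Phi_0_minus_id_le omega a delta K M c n Pdelta SD PM Hc Qa eps Heps).
Qed.

(** The rate is left free: 1 + 2 M gives bounds on v uniform in eps, while L / eps is the common
    rate for the products in the micro equation. *)
Lemma macro_bounds lam p : 1 + 2 * M <= lam -> deriv_bounds IT lam p v V0.
Proof.
  intros Hl. apply (deriv_bounds_autonomous (Amac a eps n)).
  - exact V0_ge_0.
  - refine (Rle_trans _ _ _ (norm_Amac_le omega a delta K M c n Pdelta SD PM Hc Qa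
      eps Heps n (le_n n)) _). lra.
  - exact (macro_eq _ _ _ _ _ _ sol).
  - exact norm_macro_le.
Qed.

(* With G := dPsi (n+1), the defect is the derivative of -G / eps, so that
   z = w - G(t/eps) v solves a linear equation with source
   O(|G|) = O(eps^(n+1)). *)
Lemma norm_micro_le t :
  IT t ->
  norm (w t) <= (exp (M * T) * (1 + 3 * M * T) + 1) * V0 * (P5 ^ S n * eps ^ S n).
Proof.
  intros Ht. set (g := P5 ^ S n * eps ^ S n).
  assert (Pi : 0 < / eps) by (apply Rinv_0_lt_compat; lra).
  assert (Pdiv : forall s, 0 <= s -> 0 <= s / eps)
    by (intros s Ps; apply Rmult_le_pos; lra).
  set (G := fun s => dPsi a eps (S n) (s / eps)).
  assert (NG : forall s, 0 <= s -> norm (G s) <= g).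
  { intros s Ps. apply norm_dPsi_le; [exact Heps|lia|now apply Pdiv]. }
  assert (Pg : 0 <= g) by exact (Rle_trans _ _ _ (norm_ge_0 _) (NG 0 (Rle_refl 0))).
  pose proof V0_ge_0 as PV.
  set (A := Amac a eps n).
  assert (NA := norm_Amac_le omega a delta K M c n Pdelta SD PM Hc Qa eps Heps n (le_n n)
    : norm A <= 2 * M).
  assert (Dv := macro_eq _ _ _ _ _ _ sol).
  assert (Dw := micro_eq _ _ _ _ _ _ sol).
  fold A in Dv.
  assert (Cv := is_derive_on_continuous v _ Dv).
  assert (Cw := is_derive_on_continuous w _ Dw).
  assert (DG : forall s, 0 <= s -> is_derive_on (V := EN) Rnonneg G s
    (opp (defect a eps n (s / eps)))).
  { intros s Ps.
    refine (eq_rect _ (is_derive_on (V := EN) Rnonneg G s)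
      (is_derive_on_rescale (V := EN) _ eps s _ (proj1 Heps) Ps
        (is_derive_dPsi_S omega a delta K M c n Pdelta SD PM Hc Qa eps Heps n (s / eps)
          (le_n n) (Pdiv s Ps))) _ _).
    rewrite (defect_Lambda omega a delta K M c n Pdelta SD PM Hc Qa eps Heps
      (s / eps) (Pdiv s Ps)).
    module; field; lra. }
  assert (CG := is_derive_on_continuous (V := EN) G _ DG).
  set (z := (fun s => minus (w s) (G s (v s))) : R -> X).
  (* The source - defect v of the micro equation has cancelled against G' v; the defect, of order
     eps^n only, is gone. *)
  set (dz := (fun s => minus (a (s / eps) (w s)) (G s (A (v s)))) : R -> X).
  assert (Dz : forall s, 0 <= s -> is_derive_on Rnonneg z s (dz s)).
  { intros s Ps.
    refine (eq_rect _ (is_derive_on Rnonneg z s)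
      (is_derive_on_minus w (fun s => G s (v s)) s _ _ (Dw s Ps)
        (is_derive_on_bilinear _ bilinear_End_apply G v s _ _ Ps (DG s Ps) (Dv s Ps))) _ _).
    unfold dz.
    change (opp (defect a eps n (s / eps)) (v s))
      with (opp (defect a eps n (s / eps) (v s))).
    module. }
  assert (Cdz : continuous_on Rnonneg dz).
  { apply (continuous_on_minus (fun s => a (s / eps) (w s)) (fun s => G s (A (v s)))).
    - exact (continuous_on_bilinear _ bilinear_End_apply _ _
        (continuous_on_rescale (V := ER) a eps (proj1 Heps)
          (continuous_a omega a delta M n Pdelta Qa)) Cw).
    - exact (continuous_on_bilinear _ bilinear_End_apply _ _ CG
        (continuous_on_linear _ (bounded_linear_R X A (End_linear A)) v Cv)). }
  assert (NGv : forall s, IT s -> norm (G s (v s)) <= g * V0).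
  { intros s Hs. refine (Rle_trans _ _ _ (op_norm_apply X (G s) (v s)) _).
    apply Rmult_le_compat; [apply op_norm_ge_0|apply norm_ge_0| |now apply norm_macro_le].
    apply NG, Hs. }
  (* With a w = a z + a G v, the remaining source is a G v - G A v, of norm at most (M + 2 M) g
     V0. *)
  assert (Bdz : forall s, 0 <= s <= T -> norm (dz s) <= M * norm (z s) + 3 * M * (g * V0)).
  { intros s Hs.
    assert (Na : norm (a (s / eps)) <= M)
      by exact (norm_a_le omega a delta M n Pdelta Qa (s / eps) (Pdiv s (proj1 Hs))).
    replace (dz s) with (minus (plus (a (s / eps) (z s)) (a (s / eps) (G s (v s))))
      (G s (A (v s)))).
    - replace (M * norm (z s) + 3 * M * (g * V0))
        with ((M * norm (z s) + M * (g * V0)) + g * (2 * M * V0)) by ring.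
      refine (norm_minus_le (norm_plus_le _ _) _).
      + refine (Rle_trans _ _ _ (op_norm_apply X _ _) _).
        apply Rmult_le_compat_r; [apply norm_ge_0|exact Na].
      + refine (Rle_trans _ _ _ (op_norm_apply X _ _) _).
        apply Rmult_le_compat; [apply op_norm_ge_0|apply norm_ge_0|exact Na|now apply NGv].
      + refine (Rle_trans _ _ _ (op_norm_apply X _ _) _).
        apply Rmult_le_compat; [apply op_norm_ge_0|apply norm_ge_0|apply NG, Hs|].
        refine (Rle_trans _ _ _ (op_norm_apply X _ _) _).
        apply Rmult_le_compat; [apply op_norm_ge_0|apply norm_ge_0|exact NA|
          now apply norm_macro_le].
    - unfold dz, z. f_equal.
      refine (eq_trans (eq_sym (bil_plus_r _ bilinear_End_apply (a (s / eps)) _ _)) _).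
      f_equal. module. }
  assert (Gz := gronwall z dz M (3 * M * (g * V0)) T ltac:(lra)
    ltac:(apply Rmult_le_pos; [lra|now apply Rmult_le_pos]) Dz Cdz Bdz t Ht).
  (* As w(0) = 0, the initial value z(0) = - G(0) v(0) is not zero but has the size of G. *)
  assert (Nz0 : norm (z 0) <= g * V0).
  { unfold z. rewrite (micro_init _ _ _ _ _ _ sol).
    refine (Rle_trans _ _ _ (norm_minus_le (norm_zero_le _ 0 eq_refl (Rle_refl 0))
      (NGv 0 _)) _); [split; lra|lra]. }
  replace (w t) with (plus (z t) (G t (v t))) by (unfold z; module).
  refine (Rle_trans _ _ _ (norm_plus_le Gz (NGv t Ht)) _).
  replace ((exp (M * T) * (1 + 3 * M * T) + 1) * V0 * g)
    with (exp (M * T) * (g * V0 + 3 * M * (g * V0) * T) + g * V0) by ring.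
  apply Rplus_le_compat_r. apply Rmult_le_compat_l; [left; apply exp_pos|].
  apply Rplus_le_compat_r. exact Nz0.
Qed.
End FixedEps.

(** The equation expresses w' through [a], w and the defect, so order p + 1 of w needs order p of
    each: one order more than [a] possesses, whence p <= S q. Order 0 is not recovered from the
    equation but is the estimate [B0]. *)
Lemma micro_bounds p :
  (p <= S q)%nat ->
  exists C, 0 <= C /\ forall eps, 0 < eps <= e_max ->
  forall v w, micro_macro_solution a eps n u0 v w ->
    deriv_bounds IT (L / eps) p w (C * eps ^ S n).
Proof.
  pose proof V0_ge_0 as PV. pose proof P5_ge_0 as PP5.
  set (C0 := (exp (M * T) * (1 + 3 * M * T) + 1) * V0 * P5 ^ S n).
  assert (PC0 : 0 <= C0).
  { unfold C0. apply Rmult_le_pos; [|now apply pow_le].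
    apply Rmult_le_pos; [|exact PV]. pose proof (exp_pos (M * T)).
    assert (0 <= M * T) by (apply Rmult_le_pos; lra). nra. }
  assert (B0 : forall eps, 0 < eps <= e_max -> forall v w,
    micro_macro_solution a eps n u0 v w -> forall t, IT t ->
    norm (w t) <= C0 * eps ^ S n).
  { intros eps Heps v w sol t Ht.
    refine (Rle_trans _ _ _ (norm_micro_le eps Heps v w sol t Ht) _).
    unfold C0. right. ring. }
  induction p as [|p IH]; intros Hp.
  - exists C0. split; [exact PC0|]. intros eps Heps v w sol.
    split; [exact (B0 eps Heps v w sol)|exact I].
  - destruct (IH ltac:(lia)) as [C [PC HC]].
    destruct (Lambda_diff_bounded p n (fun j => dPsi_bounded_all p j ltac:(lia))
      ltac:(lia) (le_n n)) as [Cd [PCd HCd]].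
    assert (P2 : 0 <= 2 ^ p) by (apply pow_le; lra).
    set (C1 := 2 ^ p * (Ca * C) + 2 ^ p * (Cd * V0)).
    assert (PC1 : 0 <= C1).
    { unfold C1. assert (0 <= Ca * C) by now apply Rmult_le_pos.
      assert (0 <= Cd * V0) by now apply Rmult_le_pos. nra. }
    (* [deriv_bounds] uses one constant for all orders: [C0] serves w and [C1] serves w', up to the
       rate L / eps. *)
    exists (C0 + C1). split; [lra|]. intros eps Heps v w sol.
    destruct (L_spec eps Heps) as [L1 [L2 [L3 L4]]].
    assert (Pi : 0 < / eps) by (apply Rinv_0_lt_compat; lra).
    assert (Pen : 0 <= eps ^ n) by (apply pow_le; lra).
    assert (Pdiv : forall s, 0 <= s -> 0 <= s / eps)
      by (intros s Ps; apply Rmult_le_pos; lra).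
    assert (HIT : forall t, IT t -> 0 <= t) by (intros t Ht; apply Ht).
    split.
    { intros t Ht. refine (Rle_trans _ _ _ (B0 eps Heps v w sol t Ht) _).
      apply Rmult_le_compat_r; [apply pow_le; lra|lra]. }
    exists (fun t => minus (a (t / eps) (w t)) (defect a eps n (t / eps) (v t))).
    split; [exact (micro_eq _ _ _ _ _ _ sol)|].
    assert (Bw := HC eps Heps v w sol).
    assert (Bv := macro_bounds eps Heps v w sol (L / eps) p L4).
    assert (Ba : deriv_bounds (V := EN) IT (L / eps) p (fun t => a (t / eps)) Ca).
    { apply (deriv_bounds_le (V := ER) IT (/ eps) (L / eps) q p _ Ca Ca); [lra|lra|lia|].
      exact (deriv_bounds_rescale (V := ER) IT eps q a Ca (proj1 Heps) HIT Da). }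
    assert (Bd : deriv_bounds (V := EN) IT (L / eps) p
      (fun t => defect a eps n (t / eps)) (Cd * eps ^ n)).
    { assert (Pcd : 0 <= Cd * eps ^ n) by now apply Rmult_le_pos.
      apply (deriv_bounds_le (V := ER) IT (/ eps) (L / eps) p p _
        (Cd * eps ^ n) (Cd * eps ^ n)); [lra|lra|lia|].
      replace (Cd * eps ^ n) with (Rabs (-1) * (Cd * eps ^ n))
        by (rewrite Rabs_left by lra; ring).
      apply (deriv_bounds_rescale (V := ER) IT eps p (defect a eps n) _ (proj1 Heps) HIT).
      apply (deriv_bounds_ext (V := ER) Rnonneg (fun t H => H) 1 p (fun t => scal (-1)
        (minus (Lambda a (Psi a eps (S n)) t) (Lambda a (Psi a eps n) t)))).
      - intros t Pt. rewrite (defect_Lambda omega a delta K M c n Pdelta SD PM Hc Qa eps Heps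
          t Pt). module.
      - apply (deriv_bounds_scal (V := ER) Rnonneg). now apply HCd. }
    assert (PL : 0 <= L / eps) by lra.
    apply (deriv_bounds_le IT (L / eps) (L / eps) p p _
      (2 ^ p * (Ca * (C * eps ^ S n)) + 2 ^ p * (Cd * eps ^ n * V0))); [lra| |lia|].
    (* The rate turns eps^(n+1) into L eps^n, which absorbs both terms of w': a w, of size
       eps^(n+1), through eps <= L, and defect v, of size eps^n, through 1 <= L. *)
    + assert (E1 : (C0 + C1) * eps ^ S n * (L / eps) = (C0 + C1) * L * eps ^ n)
        by (simpl; field; lra).
      rewrite E1. split.
      * assert (Pe1 : 0 <= eps ^ S n) by (apply pow_le; lra).
        apply Rplus_le_le_0_compat; (apply Rmult_le_pos; [exact P2|]).
        -- apply Rmult_le_pos; [exact PCa|]. now apply Rmult_le_pos.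
        -- apply Rmult_le_pos; [now apply Rmult_le_pos|exact PV].
      * assert (E2 : 2 ^ p * (Ca * (C * eps ^ S n)) <= 2 ^ p * (Ca * C) * L * eps ^ n).
        { simpl. replace (2 ^ p * (Ca * (C * (eps * eps ^ n))))
            with (2 ^ p * (Ca * C) * eps * eps ^ n) by ring.
          apply Rmult_le_compat_r; [exact Pen|]. apply Rmult_le_compat_l; [|exact L2].
          apply Rmult_le_pos; [exact P2|now apply Rmult_le_pos]. }
        assert (E3 : 2 ^ p * (Cd * eps ^ n * V0) <= 2 ^ p * (Cd * V0) * L * eps ^ n).
        { replace (2 ^ p * (Cd * eps ^ n * V0)) with (2 ^ p * (Cd * V0) * 1 * eps ^ n)
            by ring.
          apply Rmult_le_compat_r; [exact Pen|]. apply Rmult_le_compat_l; [|exact L1].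
          apply Rmult_le_pos; [exact P2|now apply Rmult_le_pos]. }
        apply Rle_trans with (C1 * L * eps ^ n).
        -- unfold C1. rewrite !Rmult_plus_distr_r. now apply Rplus_le_compat.
        -- apply Rmult_le_compat_r; [exact Pen|]. apply Rmult_le_compat_r; lra.
    + apply (deriv_bounds_minus IT HIT).
      * apply (deriv_bounds_bilinear (U := ER) IT _ bilinear_End_apply);
          [exact PL|exact PCa|apply Rmult_le_pos; [exact PC|apply pow_le; lra]
          |exact Ba|exact Bw].
      * apply (deriv_bounds_bilinear (U := ER) IT _ bilinear_End_apply);
          [exact PL|now apply Rmult_le_pos|exact PV|exact Bd|exact Bv].
Qed.

(** Here p <= S n enters: the p factors 1 / eps are taken from eps^(n+1), leaving a natural exponent
    and hence a bound O(1). *)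
Lemma uniform_bounds p :
  (p <= S q)%nat -> (p <= S n)%nat ->
  exists B, forall eps, 0 < eps <= e_max ->
  forall v w, micro_macro_solution a eps n u0 v w ->
  exists dv dw : R -> X,
    is_derive_n_on Rnonneg v p dv /\ is_derive_n_on Rnonneg w p dw /\
    forall t, 0 <= t <= T ->
      norm (dv t) <= B /\ norm (dw t) <= B /\ norm (dw t) <= B * eps ^ (S n - p).
Proof.
  intros Hpq Hpn. destruct (micro_bounds p Hpq) as [C [PC HC]].
  pose proof V0_ge_0 as PV.
  assert (PL : 1 <= L).
  { apply (L_spec e_max). split; [|apply Rle_refl].
    exact (proj1 (eps_max_spec omega delta K M c SD PM Hc)). }
  assert (PLp : 0 <= C * L ^ p) by (apply Rmult_le_pos; [exact PC|apply pow_le; lra]).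
  assert (PLn : 1 <= L ^ S n) by now apply pow_R1_Rle.
  assert (PVp : 0 <= V0 * (1 + 2 * M) ^ p)
    by (apply Rmult_le_pos; [exact PV|apply pow_le; lra]).
  exists (V0 * (1 + 2 * M) ^ p + C * L ^ p * L ^ S n).
  intros eps Heps v w sol. destruct (L_spec eps Heps) as [_ [L2 _]].
  destruct (deriv_bounds_derive IT _ _ _ _
    (macro_bounds eps Heps v w sol (1 + 2 * M) p (Rle_refl _))) as [dv [Dv Bv]].
  destruct (deriv_bounds_derive IT _ _ _ _ (HC eps Heps v w sol)) as [dw [Dw Bw]].
  exists dv, dw. split; [exact Dv|split; [exact Dw|]]. intros t Ht.
  specialize (Bv t Ht). specialize (Bw t Ht).
  assert (E : C * eps ^ S n * (L / eps) ^ p = C * L ^ p * eps ^ (S n - p)).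
  { replace (eps ^ S n) with (eps ^ p * eps ^ (S n - p))
      by (rewrite <- pow_add; f_equal; lia).
    replace (L ^ p) with ((L / eps) ^ p * eps ^ p)
      by (rewrite <- Rpow_mult_distr; f_equal; field; lra).
    ring. }
  rewrite E in Bw.
  assert (Pe : 0 <= eps ^ (S n - p)) by (apply pow_le; lra).
  (* eps is not assumed to be at most 1, so its powers are bounded through eps <= L. *)
  assert (Le : eps ^ (S n - p) <= L ^ S n).
  { apply Rle_trans with (L ^ (S n - p)); [apply pow_incr; lra|].
    apply Rle_pow; [exact PL|lia]. }
  split; [|split].
  - refine (Rle_trans _ _ _ Bv _). nra.
  - refine (Rle_trans _ _ _ Bw _).
    assert (C * L ^ p * eps ^ (S n - p) <= C * L ^ p * L ^ S n)
      by now apply Rmult_le_compat_l. lra.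
  - refine (Rle_trans _ _ _ Bw _). apply Rmult_le_compat_r; [exact Pe|]. nra.
Qed.
End UniformDerivativeBounds.

Theorem corollary2p18 (X : Banach) (u0 : X)
  (r : nat) (hr : (1 <= r)%nat) (omega : Fin.t r -> R) (cD nu : R)
  (homega : diophantine omega cD nu)
  (a : R -> End X) (mu M Na : R) (hmu : 0 < mu) (hM : 0 < M)
  (ha : is_E_norm omega mu a Na) (hNa : Na <= M)
  (q : nat) (Ca : R) (hCa : 0 < Ca) (haC : class_C_on Rnonneg q a)
  (haq : forall (p : nat) (g : R -> End X), (p <= q)%nat ->
     is_derive_n_on Rnonneg a p g -> forall tau, 0 <= tau ->
     norm (g tau) <= Ca * M)
  (c : R) (hc : 0 < c < 1) (n : nat) (T : R) (hT : 0 < T) :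
  forall p : nat, (p <= Nat.min n q + 1)%nat ->
  exists K : R, forall eps : R, 0 < eps <= eps_threshold cD nu mu M c n ->
  forall v w : R -> X, micro_macro_solution a eps n u0 v w ->
  exists dv dw : R -> X,
    is_derive_n_on Rnonneg v p dv /\ is_derive_n_on Rnonneg w p dw /\
    forall t, 0 <= t <= T ->
      norm (dv t) <= K /\ norm (dw t) <= K /\
      norm (dw t) <= K * eps ^ (n + 1 - p).
Proof.
  intros p Hp.
  set (delta := mu / (INR n + 1)).
  assert (Pn : 0 < INR n + 1) by (pose proof (pos_INR n); lra).
  assert (Pdelta : 0 < delta) by now apply Rdiv_lt_0_compat.
  assert (SD := small_divisors_diophantine omega cD nu delta hr homega Pdelta).
  assert (Ew : width delta n 0 = mu).
  { unfold width, delta. rewrite S_INR. simpl. field. lra. }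
  assert (Qa : quasi omega (width delta n 0) a M).
  { rewrite Ew. apply (quasi_ext_le omega mu a a Na M);
      [lra|reflexivity|exact hNa|]. apply quasi_of_E_norm; [lra|exact ha]. }
  assert (Da : deriv_bounds (V := End_NormedModule X) Rnonneg 1 q a (Ca * M)).
  { apply (deriv_bounds_of_derive_n (V := End_CompleteNormedModule X)).
    - destruct (haC q (le_n q)) as [g [Hg _]]. now exists g.
    - exact haq. }
  assert (PCa : 0 <= Ca * M) by (apply Rmult_le_pos; lra).
  replace (n + 1)%nat with (S n) by lia.
  (* The placeholder is K = c_I(mu / (n + 1)), for which [eps_max] is convertible to
     [eps_threshold]. *)
  exact (uniform_bounds omega a delta _ M c n Pdelta SD hM hc Qa q (Ca * M) PCa Da
    u0 T hT p ltac:(lia) ltac:(lia)).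
Qed.
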